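(* Let $\mathcal H$ be a Heyting category, $A$ an order partial applicative structure in $\mathcal H$ and $\phi$ a combinatory complete external filter of $A$. Let $\nabla:\mathcal H\to\mathrm{Asm}(\mathsf DA/\phi)$ be the constant object functor. Then $(\mathrm{Asm}(\mathsf DA/\phi),\nabla,\mathring A)$ is the pseudoinitial regular model for $(A,\phi)$.
   Context: All categories are small. A Heyting category is a regular category in which every $\mathrm{Sub}(X)$ has finite joins and every $f^{-1}$ between subobject posets has a right adjoint. Set-builder notation refers to its internal language. Order partial applicative structure: an object $A$ with a preorder $\le$ and a partial binary operator $(x,y)\mapsto xy$ with domain $D\subseteq A^2$ ($xy\downarrow$ means $(x,y)\in D$) such that $x\le x'$, $y\le y'$, $x'y'\downarrow$ imply $xy\downarrow$, $xy\le x'y'$ (preserved by finite limit preserving functors). A filter of $A$ is a subobject closed under application and upward closed. Partial combinatory functions are the least class of partial functions $A^n\rightharpoonup A$ (all arities) containing projections and closed under pointwise application. For $f:A^{n+1}\rightharpoonup A$, $[\![f]\!]=\{r\in A\mid\forall\vec x\in A^n.\,r\vec x\downarrow,\ \forall\vec y\in\mathrm{dom}f.\ r\vec y\downarrow\wedge r\vec y\le f(\vec y)\}$. $\mathbf DA$ is the set of downward closed subobjects of $A$; $UV\downarrow$ iff $U\times V\subseteq D$, and then $UV=\{z\mid\exists x\in U,y\in V.\,z\le xy\}$. An external filter is $\phi\subseteq\mathbf DA$ upward closed under $\subseteq$ and closed under defined application; it is combinatory complete if $[\![f]\!]\in\phi$ for all partial combinatory $f$. Realizability fibration $\mathsf DA/\phi:\mathcal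 DA/\phi\to\mathcal H$: objects are pairs $(X,Y)$ with $Y\subseteq A\times X$ downward closed in the $A$-coordinate; a morphism $(X,Y)\to(X',Y')$ is $f:X\to X'$ such that for some $U\in\phi$, for all $u\in U$, $(a,x)\in Y$, $ua\downarrow$ and $(ua,f(x))\in Y'$. $\mathrm{Asm}(\mathsf DA/\phi)$ (a regular category) is the localization of $\mathcal DA/\phi$ at the monomorphisms that are supine (coCartesian) over $\mathcal H$. $\nabla X=(X,A\times X)$, and $\mathring A=(A,\{(a,b)\mid a\le b\})$, viewed as a filter of $\nabla A$. A regular model $(\mathcal R,F,C)$ for $(A,\phi)$ is a regular category $\mathcal R$ with a regular functor $F:\mathcal H\to\mathcal R$ and a filter $C\subseteq FA$ such that $C\cap FU$ is inhabited (its map to $1$ is a regular epimorphism) for all $U\in\phi$. A 1-morphism $(\mathcal R,F,C)\to(\mathcal S,G,D)$ is a regular functor $H:\mathcal R\to\mathcal S$ with a natural isomorphism $h:HF\to G$ such that $h_A$ restricts to an isomorphism $HC\to D$. A 2-morphism $(H,h)\to(K,k)$ is a natural isomorphism $\eta:H\to K$ with $k\circ\eta F=h$. An object $I$ of a $(2,1)$-category is pseudoinitial if there is an up to isomorphism unique 1-morphism from $I$ to every object. *)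

(* Defs.v *)
From mathcomp Require Import all_boot.
From mathcomp Require Import boolp.

Set Implicit Arguments.
Unset Strict Implicit.
Unset Printing Implicit Defensive.

Declare Scope cat_scope.
Delimit Scope cat_scope with cat.
Local Open Scope cat_scope.

Reserved Notation "X ~> Y" (at level 99, Y at level 200, right associativity).
Reserved Notation "g ∘ f" (at level 40, left associativity).
Reserved Notation "z ∈ U" (at level 70, no associativity).
Reserved Notation "⟨ x , y ⟩ ∈ S" (at level 70, x, y at level 69, no associativity).

Record category := Category {
  ob :> Type;
  hom : ob -> ob -> Type;
  idm : forall X, hom X X;
  comp : forall X Y Z, hom Y Z -> hom X Y -> hom X Z;
  comp1m : forall X Y (f : hom X Y), comp (idm Y) f = f;
  compm1 : forall X Y (f : hom X Y), comp f (idm X) = f;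
  compA : forall W X Y Z (h : hom Y Z) (g : hom X Y) (f : hom W X),
    comp h (comp g f) = comp (comp h g) f
}.

Notation "X ~> Y" := (hom X Y) : cat_scope.
Notation "g ∘ f" := (comp g f) : cat_scope.
Arguments idm {c} X.

Record functor (C D : category) := Functor {
  fob :> C -> D;
  fmap : forall X Y, (X ~> Y) -> (fob X ~> fob Y);
  fmap1 : forall X, fmap (idm X) = idm (fob X);
  fmapM : forall X Y Z (g : Y ~> Z) (f : X ~> Y),
    fmap (g ∘ f) = fmap g ∘ fmap f
}.
Arguments fmap {C D} _ {X Y} _.

Lemma comp_fmap1 (C D E : category) (G : functor D E) (F : functor C D) (X : C) :
  fmap G (fmap F (idm X)) = idm (G (F X)).
Proof. by rewrite !fmap1. Qed.

Lemma comp_fmapM (C D E : category) (G : functor D E) (F : functor C D)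
    (X Y Z : C) (g : Y ~> Z) (f : X ~> Y) :
  fmap G (fmap F (g ∘ f)) = fmap G (fmap F g) ∘ fmap G (fmap F f).
Proof. by rewrite !fmapM. Qed.

Definition comp_functor (C D E : category) (G : functor D E) (F : functor C D) :
    functor C E :=
  @Functor C E (fun X => G (F X)) (fun X Y f => fmap G (fmap F f))
    (@comp_fmap1 C D E G F) (@comp_fmapM C D E G F).

Definition is_iso (C : category) (X Y : C) (f : X ~> Y) : Prop :=
  exists g : Y ~> X, g ∘ f = idm X /\ f ∘ g = idm Y.

Record nat_iso (C D : category) (F G : functor C D) := NatIso {
  ncomp :> forall X : C, F X ~> G X;
  ncomp_natural : forall X Y (f : X ~> Y), ncomp Y ∘ fmap F f = fmap G f ∘ ncomp X;
  ncomp_iso : forall X, is_iso (ncomp X)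
}.

Definition mono (C : category) (X Y : C) (m : X ~> Y) : Prop :=
  forall Z (f g : Z ~> X), m ∘ f = m ∘ g -> f = g.

Definition is_terminal (C : category) (T : C) : Prop :=
  forall Z : C, exists! f : Z ~> T, True.

Definition is_product (C : category) (X Y P : C) (p : P ~> X) (q : P ~> Y) : Prop :=
  forall Z (f : Z ~> X) (g : Z ~> Y), exists! h : Z ~> P, p ∘ h = f /\ q ∘ h = g.

Definition is_equalizer (C : category) (X Y E : C) (f g : X ~> Y) (e : E ~> X) : Prop :=
  f ∘ e = g ∘ e /\
  forall Z (z : Z ~> X), f ∘ z = g ∘ z -> exists! h : Z ~> E, e ∘ h = z.

Definition is_pullback (C : category) (X Y B P : C) (f : X ~> B) (g : Y ~> B)
    (p : P ~> X) (q : P ~> Y) : Prop :=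
  f ∘ p = g ∘ q /\
  forall Z (x : Z ~> X) (y : Z ~> Y), f ∘ x = g ∘ y ->
    exists! h : Z ~> P, p ∘ h = x /\ q ∘ h = y.

Definition is_coequalizer (C : category) (W X Y : C) (g h : W ~> X) (e : X ~> Y) : Prop :=
  e ∘ g = e ∘ h /\
  forall Z (z : X ~> Z), z ∘ g = z ∘ h -> exists! k : Y ~> Z, k ∘ e = z.

Definition regular_epi (C : category) (X Y : C) (e : X ~> Y) : Prop :=
  exists (W : C) (g h : W ~> X), is_coequalizer g h e.

Record has_finite_limits (C : category) : Prop := HasFiniteLimits {
  has_terminal : exists T : C, is_terminal T;
  has_products : forall X Y : C, exists (P : C) (p : P ~> X) (q : P ~> Y), is_product p q;
  has_equalizers : forall (X Y : C) (f g : X ~> Y),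
    exists (E : C) (e : E ~> X), is_equalizer f g e
}.

Record is_regular (C : category) : Prop := IsRegular {
  regular_finlim : has_finite_limits C;
  regular_image : forall (X Y : C) (f : X ~> Y),
    exists (I : C) (e : X ~> I) (m : I ~> Y),
      [/\ regular_epi e, mono m & f = m ∘ e];
  regular_stable : forall (X Y B P : C) (f : X ~> B) (g : Y ~> B) (p : P ~> X) (q : P ~> Y),
    is_pullback f g p q -> regular_epi f -> regular_epi q
}.

Record preserves_finite_limits (C D : category) (F : functor C D) : Prop :=
  PreservesFiniteLimits {
  preserves_terminal : forall T : C, is_terminal T -> is_terminal (F T);
  preserves_product : forall (X Y P : C) (p : P ~> X) (q : P ~> Y),
    is_product p q -> is_product (fmap F p) (fmap F q);
  preserves_equalizer : forall (X Y E : C) (f g : X ~> Y) (e : E ~> X),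
    is_equalizer f g e -> is_equalizer (fmap F f) (fmap F g) (fmap F e)
}.

Record regular_functor (C D : category) (F : functor C D) : Prop := RegularFunctor {
  regular_functor_finlim : preserves_finite_limits F;
  regular_functor_epi : forall (X Y : C) (e : X ~> Y),
    regular_epi e -> regular_epi (fmap F e)
}.

(** Statements of the internal language are interpreted by quantifying over
   generalized elements [Z ~> X] (Kripke-Joyal semantics): universal
   quantification and implication range over all restrictions [Z' ~> Z], and
   existential quantification is local with respect to regular epimorphisms. *)

(** A representative of a subobject; [U ⊆ V] and [V ⊆ U] means that [U] and [V]
    represent the same subobject. *)
Record sub (C : category) (X : C) := Sub {
  sub_dom : C;
  sub_arr : sub_dom ~> X;
  sub_mono : mono sub_arr
}.

Definition mem (C : category) (X Z : C) (z : Z ~> X) (U : sub X) : Prop :=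
  exists k : Z ~> sub_dom U, sub_arr U ∘ k = z.
Notation "z ∈ U" := (mem z U) : cat_scope.

Definition subset (C : category) (X : C) (U V : sub X) : Prop :=
  forall Z (z : Z ~> X), z ∈ U -> z ∈ V.

Record span (C : category) (X Y : C) := Span {
  tip : C;
  lleg : tip ~> X;
  rleg : tip ~> Y
}.

(** A subobject of [X × Y] is the same thing as a jointly monic span from [X]
    to [Y]. *)
Definition jointly_monic (C : category) (X Y : C) (S : span X Y) : Prop :=
  forall Z (f g : Z ~> tip S),
    lleg S ∘ f = lleg S ∘ g -> rleg S ∘ f = rleg S ∘ g -> f = g.

Definition rel_mem (C : category) (X Y Z : C) (x : Z ~> X) (y : Z ~> Y)
    (S : span X Y) : Prop :=
  exists k : Z ~> tip S, lleg S ∘ k = x /\ rleg S ∘ k = y.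
Notation "⟨ x , y ⟩ ∈ S" := (rel_mem x y S) : cat_scope.

Record is_heyting (C : category) : Prop := IsHeyting {
  heyting_regular : is_regular C;
  heyting_bottom : forall X : C, exists U : sub X, forall V : sub X, subset U V;
  heyting_join : forall (X : C) (U V : sub X), exists W : sub X,
    forall T : sub X, subset W T <-> subset U T /\ subset V T;
  (* the left hand side of the equivalence spells out [f^-1 T ⊆ U] *)
  heyting_forall : forall (X Y : C) (f : X ~> Y) (U : sub X), exists V : sub Y,
    forall T : sub Y, (forall Z (z : Z ~> X), f ∘ z ∈ T -> z ∈ U) <-> subset T V
}.

Record heyting_category := HeytingCategory {
  hcat :> category;
  hcatP : is_heyting hcat
}.

Record opas_data (C : category) := OpasData {
  carrier :> C;
  ole : span carrier carrier;
  odom : span carrier carrier;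
  oapp : tip odom ~> carrier
}.

Definition le (C : category) (A : opas_data C) (Z : C) (x y : Z ~> A) : Prop :=
  ⟨x, y⟩ ∈ ole A.

(** [app x y v]: the application [xy] is defined and equal to [v]. *)
Definition app (C : category) (A : opas_data C) (Z : C) (x y v : Z ~> A) : Prop :=
  exists k : Z ~> tip (odom A),
    [/\ lleg (odom A) ∘ k = x, rleg (odom A) ∘ k = y & oapp A ∘ k = v].

Definition app_defined (C : category) (A : opas_data C) (Z : C) (x y : Z ~> A) : Prop :=
  ⟨x, y⟩ ∈ odom A.

Record is_opas (C : category) (A : opas_data C) : Prop := IsOpas {
  ole_jointly_monic : jointly_monic (ole A);
  odom_jointly_monic : jointly_monic (odom A);
  ole_refl : forall Z (x : Z ~> A), le x x;
  ole_trans : forall Z (x y z : Z ~> A), le x y -> le y z -> le x z;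
  oapp_le : forall Z (x x' y y' v' : Z ~> A), le x x' -> le y y' -> app x' y' v' ->
    exists2 v, app x y v & le v v'
}.

Record opas (C : category) := Opas {
  opas_of :> opas_data C;
  opasP : is_opas opas_of
}.

Definition map_span (C D : category) (F : functor C D) (X Y : C) (S : span X Y) :
    span (F X) (F Y) :=
  Span (fmap F (lleg S)) (fmap F (rleg S)).

Definition map_opas (C D : category) (F : functor C D) (A : opas_data C) : opas_data D :=
  @OpasData D (F A) (map_span F (ole A)) (map_span F (odom A)) (fmap F (oapp A)).

(** The map [c : C ~> A] represents a filter of [A]. *)
Record is_filter (R : category) (A : opas_data R) (C : R) (c : C ~> A) : Prop := IsFilter {
  filter_mono : mono c;
  filter_app : forall Z (x y : Z ~> C) (v : Z ~> A), app (c ∘ x) (c ∘ y) v ->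
    exists z : Z ~> C, c ∘ z = v;
  filter_up : forall Z (x : Z ~> C) (y : Z ~> A), le (c ∘ x) y ->
    exists z : Z ~> C, c ∘ z = y
}.

(** A partial function [A^n ⇀ A]: the subobject of [A^n] on which it is defined
    is presented by a jointly monic family of [n] maps. *)
Record pfun (C : category) (A : C) (n : nat) := Pfun {
  pdom : C;
  parg : 'I_n -> (pdom ~> A);
  pval : pdom ~> A;
  parg_jointly_monic : forall Z (f g : Z ~> pdom),
    (forall i, parg i ∘ f = parg i ∘ g) -> f = g
}.

Definition graph (C : category) (A : C) (n : nat) (f : pfun A n) (Z : C)
    (x : n.-tuple (Z ~> A)) (v : Z ~> A) : Prop :=
  exists k : Z ~> pdom f, (forall i, tnth x i = parg f i ∘ k) /\ v = pval f ∘ k.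

Inductive combinatory (C : category) (A : opas_data C) (n : nat) : pfun A n -> Prop :=
| combinatory_proj (i : 'I_n) (f : pfun A n) :
    (forall Z (x : n.-tuple (Z ~> A)) (v : Z ~> A), graph f x v <-> v = tnth x i) ->
    combinatory f
| combinatory_app (f g h : pfun A n) :
    combinatory f -> combinatory g ->
    (forall Z (x : n.-tuple (Z ~> A)) (v : Z ~> A),
      graph h x v <-> exists u w, [/\ graph f x u, graph g x w & app u w v]) ->
    combinatory h.

(** [apps r s v]: the iterated application [r s_1 ... s_n] is defined and equal
    to [v]. *)
Fixpoint apps (C : category) (A : opas_data C) (Z : C) (r : Z ~> A) (s : seq (Z ~> A))
    (v : Z ~> A) : Prop :=
  if s is x :: s' then exists2 w, app r x w & apps w s' v else v = r.

Definition realizes (C : category) (A : opas_data C) (n : nat) (f : pfun A n.+1) (Z : C)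
    (r : Z ~> A) : Prop :=
  forall Z' (h : Z' ~> Z),
    (forall x : n.-tuple (Z' ~> A), exists v, apps (r ∘ h) x v) /\
    (forall (y : n.+1.-tuple (Z' ~> A)) (w : Z' ~> A), graph f y w ->
      exists2 v, apps (r ∘ h) y v & le v w).

(** [U × V ⊆ D] *)
Definition sub_app_defined (C : category) (A : opas_data C) (U V : sub A) : Prop :=
  forall Z (x y : Z ~> A), x ∈ U -> y ∈ V -> app_defined x y.

(** [∃x∈U, y∈V. z ≤ xy] *)
Definition below_app (C : category) (A : opas_data C) (U V : sub A) (Z : C)
    (z : Z ~> A) : Prop :=
  exists (Z' : C) (e : Z' ~> Z), regular_epi e /\
    exists x y v : Z' ~> A, [/\ x ∈ U, y ∈ V, app x y v & le (z ∘ e) v].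

Lemma pullback_exists (C : category) (lim : has_finite_limits C) (X Y B : C)
    (f : X ~> B) (g : Y ~> B) :
  exists (P : C) (p : P ~> X) (q : P ~> Y), is_pullback f g p q.
Proof.
have [P [p [q prod]]] := has_products lim X Y.
have [E [e [fe eq]]] := has_equalizers lim (f ∘ p) (g ∘ q).
exists E, (p ∘ e), (q ∘ e); split; first by rewrite !compA.
move=> Z x y xy; have [h [[hx hy] hU]] := prod Z x y.
have hE : f ∘ p ∘ h = g ∘ q ∘ h by rewrite -!compA hx hy.
have [k [ke kU]] := eq Z h hE.
exists k; split; first by rewrite -!compA ke.
move=> k' [k'x k'y]; apply: kU; symmetry; apply: hU.
by rewrite !compA.
Qed.

Lemma span_preimage (C : category) (lim : has_finite_limits C) (X Y E : C) (S : span X Y)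
    (x : E ~> X) (y : E ~> Y) : jointly_monic S ->
  exists (E' : C) (j : E' ~> E) (t : E' ~> tip S),
    [/\ mono j, lleg S ∘ t = x ∘ j, rleg S ∘ t = y ∘ j &
      forall Z (z : Z ~> E) (s : Z ~> tip S), lleg S ∘ s = x ∘ z -> rleg S ∘ s = y ∘ z ->
        exists2 l : Z ~> E', j ∘ l = z & t ∘ l = s].
Proof.
move=> Sjm.
have [P [p [q [pq pb]]]] := pullback_exists lim x (lleg S).
have [E' [e [eq eU]]] := has_equalizers lim (y ∘ p) (rleg S ∘ q).
have lift Z (z : Z ~> E) (s : Z ~> tip S) : lleg S ∘ s = x ∘ z -> rleg S ∘ s = y ∘ z ->
    exists! l : Z ~> E', (p ∘ e) ∘ l = z /\ (q ∘ e) ∘ l = s.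
  move=> sx sy; have [h [[hz hs] hU]] := pb Z z s (esym sx).
  have hE : y ∘ p ∘ h = rleg S ∘ q ∘ h by rewrite -!compA hz hs.
  have [k [ke kU]] := eU Z h hE.
  exists k; split; first by rewrite -!compA ke.
  move=> k' [k1 k2]; apply: kU; symmetry; apply: hU.
  by rewrite !compA.
exists E', (p ∘ e), (q ∘ e).
have tl : lleg S ∘ (q ∘ e) = x ∘ (p ∘ e) by rewrite !compA pq.
have tr : rleg S ∘ (q ∘ e) = y ∘ (p ∘ e) by rewrite !compA eq.
split=> //.
- move=> Z f g fg.
  have fs : q ∘ e ∘ f = q ∘ e ∘ g.
    apply: Sjm.
      by rewrite !(compA (lleg S) (q ∘ e)) tl -!(compA x) fg.
    by rewrite !(compA (rleg S) (q ∘ e)) tr -!(compA y) fg.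
  have [|| k [_ kU]] := lift Z (p ∘ e ∘ g) (q ∘ e ∘ g).
  + by rewrite compA tl -!compA.
  + by rewrite compA tr -!compA.
  by rewrite -(kU f) // -(kU g).
- move=> Z z s sx sy; have [l [[lz ls] _]] := lift Z z s sx sy.
  by exists l.
Qed.

Lemma mem_comp (C : category) (X Z Z' : C) (U : sub X) (z : Z ~> X) (h : Z' ~> Z) :
  z ∈ U -> z ∘ h ∈ U.
Proof. by move=> [k <-]; exists (k ∘ h); rewrite compA. Qed.

Lemma rel_mem_comp (C : category) (X Y Z Z' : C) (S : span X Y) (x : Z ~> X) (y : Z ~> Y)
    (h : Z' ~> Z) :
  ⟨x, y⟩ ∈ S -> ⟨x ∘ h, y ∘ h⟩ ∈ S.
Proof. by move=> [k [<- <-]]; exists (k ∘ h); rewrite !compA. Qed.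

Lemma app_comp (C : category) (A : opas_data C) (Z Z' : C) (x y v : Z ~> A) (h : Z' ~> Z) :
  app x y v -> app (x ∘ h) (y ∘ h) (v ∘ h).
Proof. by move=> [k [<- <- <-]]; exists (k ∘ h); rewrite !compA. Qed.

Lemma app_dom (C : category) (A : opas_data C) (Z : C) (x y v : Z ~> A) :
  app x y v -> app_defined x y.
Proof. by move=> [k [? ? _]]; exists k. Qed.

Lemma app_definedP (C : category) (A : opas_data C) (Z : C) (x y : Z ~> A) :
  app_defined x y <-> exists v, app x y v.
Proof.
split=> [[k [kx ky]]|[v]]; last exact: app_dom.
by exists (oapp A ∘ k), k.
Qed.

Lemma app_fun (C : category) (A : opas C) (Z : C) (x y v w : Z ~> A) :
  app x y v -> app x y w -> v = w.
Proof.
move=> [k [kx ky <-]] [l [lx ly <-]]; congr (_ ∘ _).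
by apply: (odom_jointly_monic (opasP A)); rewrite ?kx ?ky.
Qed.

Lemma regular_epi_epi (C : category) (X Y Z : C) (e : X ~> Y) (f g : Y ~> Z) :
  regular_epi e -> f ∘ e = g ∘ e -> f = g.
Proof.
move=> [W [a [b [ab eU]]]] fg.
have [|k [_ kU]] := eU Z (g ∘ e); first by rewrite -!compA ab.
by rewrite -(kU f) // -(kU g).
Qed.

Lemma rel_mem_descent (C : category) (X Y Z Z' : C) (S : span X Y) (x : Z ~> X) (y : Z ~> Y)
    (e : Z' ~> Z) : jointly_monic S -> regular_epi e ->
  ⟨x ∘ e, y ∘ e⟩ ∈ S -> ⟨x, y⟩ ∈ S.
Proof.
move=> Sjm re [k [kx ky]]; have [W [a [b [ab eU]]]] := re.
have kab : k ∘ a = k ∘ b by apply: Sjm; rewrite !compA ?kx ?ky -!compA ab.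
have [d [dk _]] := eU _ k kab; exists d.
by split; apply: (regular_epi_epi re); rewrite -compA dk.
Qed.

Lemma mem_descent (C : category) (X Z Z' : C) (U : sub X) (z : Z ~> X) (e : Z' ~> Z) :
  regular_epi e -> z ∘ e ∈ U -> z ∈ U.
Proof.
move=> re [k kz]; have [W [a [b [ab eU]]]] := re.
have kab : k ∘ a = k ∘ b by apply: (sub_mono (s := U)); rewrite !compA kz -!compA ab.
have [d [dk _]] := eU _ k kab; exists d.
by apply: (regular_epi_epi re); rewrite -compA dk.
Qed.

Lemma sub_forall (H : heyting_category) (X P : H) (S : span X P) : jointly_monic S ->
  exists R : sub X, forall Z (r : Z ~> X),
    r ∈ R <-> forall Z' (h : Z' ~> Z) (p : Z' ~> P), ⟨r ∘ h, p⟩ ∈ S.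
Proof.
move=> Sjm; have reg := heyting_regular (hcatP H); have lim := regular_finlim reg.
have [XP [p1 [p2 prod]]] := has_products lim X P.
have [s [[s1 s2] _]] := prod _ (lleg S) (rleg S).
have smono : mono s.
  by move=> Z f g fg; apply: Sjm; rewrite -?s1 -?s2 -!compA fg.
pose S' := Sub smono.
have S'P Z (z : Z ~> XP) : z ∈ S' <-> ⟨p1 ∘ z, p2 ∘ z⟩ ∈ S.
  split=> [[k <-]|[k [k1 k2]]]; first by exists k; rewrite /= !compA s1 s2.
  exists k => /=; have [h [_ hU]] := prod Z (p1 ∘ z) (p2 ∘ z).
  by rewrite -(hU z) // -(hU (s ∘ k)) // !compA s1 s2.
have [V VP] := heyting_forall (hcatP H) p1 S'.
exists V => Z r; split=> [rV Z' h p|rS].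
  have [z [[z1 z2] _]] := prod Z' (r ∘ h) p.
  rewrite -z1 -z2; apply/S'P; apply: (proj2 (VP V)) => //.
  by rewrite z1; apply: mem_comp.
have [I [e [m [re mm rE]]]] := regular_image reg r.
pose T := Sub mm.
suff : subset T V by apply; exists e.
apply: (proj1 (VP T)) => W z [k /= kz].
have [W' [k' [e' pb]]] := pullback_exists lim e k.
have re' := regular_stable reg pb re.
apply: (mem_descent re'); apply/S'P; rewrite !compA -kz -compA -(proj1 pb) compA -rE.
exact: rS.
Qed.

Lemma sub_meet (C : category) (lim : has_finite_limits C) (X : C) (U V : sub X) :
  exists W : sub X, forall Z (z : Z ~> X), z ∈ W <-> z ∈ U /\ z ∈ V.
Proof.
have [P [p [q [pq pb]]]] := pullback_exists lim (sub_arr U) (sub_arr V).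
have mP : mono (sub_arr U ∘ p).
  move=> Z f g; rewrite -!compA => fg; have pfg := sub_mono fg.
  have qfg : q ∘ f = q ∘ g.
    by apply: (sub_mono (s := V)); rewrite !compA -pq -!compA fg.
  have [|k [_ kU]] := pb Z (p ∘ g) (q ∘ g); first by rewrite !compA pq.
  by rewrite -(kU f) // -(kU g).
exists (Sub mP) => Z z; split=> [[k /= <-]|[[k kz] [l lz]]].
  by split; [exists (p ∘ k)|exists (q ∘ k)]; rewrite ?compA // pq.
have [|h [[hk hl] _]] := pb Z k l; first by rewrite kz lz.
by exists h => /=; rewrite -compA hk.
Qed.

Lemma apps_defined_sub (H : heyting_category) (A : opas H) (n : nat) :
  exists R : sub A, forall Z (r : Z ~> A),
    r ∈ R <-> forall Z' (h : Z' ~> Z) (x : n.-tuple (Z' ~> A)), exists v, apps (r ∘ h) x v.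
Proof.
have lim := regular_finlim (heyting_regular (hcatP H)).
elim: n => [|n [R RP]].
  have m1 : mono (idm (A : H)) by move=> Z f g; rewrite !comp1m.
  exists (Sub m1) => Z r; split=> [_ Z' h x|_]; last by exists r; rewrite /= comp1m.
  by rewrite (tuple0 x); exists (r ∘ h).
have [P [p [q [pq pb]]]] := pullback_exists lim (oapp A) (sub_arr R).
pose S := Span (lleg (odom A) ∘ p) (rleg (odom A) ∘ p).
have Sjm : jointly_monic S.
  move=> Z f g /=; rewrite -!compA => fg fg'.
  have pfg : p ∘ f = p ∘ g by apply: (odom_jointly_monic (opasP A)).
  have qfg : q ∘ f = q ∘ g.
    by apply: (sub_mono (s := R)); rewrite !compA -pq -!compA pfg.
  have [|k [_ kU]] := pb Z (p ∘ g) (q ∘ g); first by rewrite !compA pq.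
  by rewrite -(kU f) // -(kU g).
have SP Z (r x : Z ~> A) : ⟨r, x⟩ ∈ S <-> exists2 w, app r x w & w ∈ R.
  split=> [[k [/= <- <-]]|[w [k [kr kx kw]] [l lw]]].
    exists (oapp A ∘ (p ∘ k)); first by exists (p ∘ k); rewrite !compA.
    by exists (q ∘ k); rewrite !compA pq.
  have [|h [[hk hl] _]] := pb Z k l; first by rewrite kw lw.
  by exists h => /=; rewrite -!compA hk.
have [T TP] := sub_forall Sjm.
exists T => Z r; rewrite TP; split=> rS Z' h.
  move=> x; case/tupleP: x => x xs.
  have /SP [w rw /RP wR] := rS _ h x.
  have [v wv] := wR _ (idm _) xs; rewrite compm1 in wv.
  by exists v, w.
move=> x; apply/SP.
have [v' [w rw _]] := rS Z' h [tuple of x :: [tuple x | i < n]].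
exists w => //; apply/RP => Z'' h' xs.
have [v [w' rw' wv]] := rS Z'' (h ∘ h') [tuple of x ∘ h' :: xs].
exists v; rewrite (app_fun (app_comp h' rw) (w := w')) //.
by rewrite -compA.
Qed.

Lemma apps_representable (C : category) (A : opas C) (lim : has_finite_limits C)
    (P : C) (ys : seq (P ~> A)) (E : C) (c : E ~> A) (p : E ~> P) :
  exists (E' : C) (j : E' ~> E) (w : E' ~> A), mono j /\
    forall Z (k : Z ~> E) (v : Z ~> A),
      apps (c ∘ k) [seq y ∘ (p ∘ k) | y <- ys] v <->
      exists2 l : Z ~> E', j ∘ l = k & w ∘ l = v.
Proof.
elim: ys E c p => [|y ys IH] E c p.
  exists E, (idm E), c; split=> [Z f g|Z k v /=]; first by rewrite !comp1m.
  by split=> [->|[l <- <-]]; [exists k; rewrite ?comp1m|rewrite comp1m].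
have [E1 [j1 [t [mj1 tl tr tU]]]] :=
  span_preimage lim c (y ∘ p) (odom_jointly_monic (opasP A)).
have [E2 [j2 [w [mj2 wP]]]] := IH E1 (oapp A ∘ t) (p ∘ j1).
exists E2, (j1 ∘ j2), w; split.
  by move=> Z f g; rewrite -!compA => /mj1 /mj2.
move=> Z k v /=; split.
  case=> u [s [sc sy su]] uv.
  have [||l1 jl1 tl1] := tU Z k s; rewrite ?sc ?sy ?compA //.
  have [|l2 jl2 wl2] := proj1 (wP Z l1 v).
    by rewrite -compA tl1 su -!compA jl1.
  by exists l2 => //; rewrite -compA jl2.
case=> l jl wl; exists (oapp A ∘ t ∘ (j2 ∘ l)).
  exists (t ∘ (j2 ∘ l)); split; last by rewrite compA.
    by rewrite compA tl -jl !compA.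
  by rewrite compA tr -jl !compA.
have kE : p ∘ k = p ∘ j1 ∘ (j2 ∘ l) by rewrite -jl !compA.
by rewrite kE; apply/wP; exists l.
Qed.

Lemma realizers_exist (H : heyting_category) (A : opas H) (n : nat) (f : pfun A n.+1) :
  exists R : sub A, forall Z (r : Z ~> A), r ∈ R <-> realizes f r.
Proof.
have lim := regular_finlim (heyting_regular (hcatP H)).
have [R1 R1P] := apps_defined_sub A n.
have [E0 [c [p prod]]] := has_products lim (A : H) (pdom f).
pose ys := [seq parg f i | i <- enum 'I_n.+1].
have [E1 [j1 [w [mj1 wP]]]] := apps_representable lim ys c p.
have [E2 [j2 [t [mj2 tl tr tU]]]] :=
  span_preimage lim w (pval f ∘ p ∘ j1) (ole_jointly_monic (opasP A)).
pose S := Span (c ∘ j1 ∘ j2) (p ∘ j1 ∘ j2).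
have prodU Z (a b : Z ~> E0) : c ∘ a = c ∘ b -> p ∘ a = p ∘ b -> a = b.
  move=> ab ab'; have [h [_ hU]] := prod Z (c ∘ b) (p ∘ b).
  by rewrite -(hU a) // -(hU b).
have Sjm : jointly_monic S.
  move=> Z a b /=; rewrite -!compA => ab ab'.
  by apply: mj2; apply: mj1; apply: prodU.
have SP Z (r : Z ~> A) (k : Z ~> pdom f) : ⟨r, k⟩ ∈ S <->
    exists2 v, apps r [seq y ∘ k | y <- ys] v & le v (pval f ∘ k).
  have [z [[zr zk] _]] := prod Z r k; split.
    case=> l [/= lr lk].
    have zE : z = j1 ∘ (j2 ∘ l) by apply: prodU; rewrite ?zr ?zk -?lr -?lk !compA.
    exists (w ∘ (j2 ∘ l)).
      by rewrite -zr -zk; apply/wP; exists (j2 ∘ l).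
    exists (t ∘ l); rewrite !compA tl tr; split=> //.
    by rewrite -zk zE !compA.
  case=> v; rewrite -{1}zr -{1}zk => /wP [l jl <-] [s [sl sr]].
  have [||l' jl' tl'] := tU Z l s; rewrite ?sl ?sr //.
    by rewrite -!compA jl zk.
  by exists l' => /=; rewrite -!compA jl' jl.
have [R2 R2P] := sub_forall Sjm.
have [R RP] := sub_meet lim R1 R2.
exists R => Z r; rewrite RP R1P R2P.
split=> [[r1 r2] Z' h|rf]; last split=> Z' h => [|k].
- split=> [x|y v [k [yk ->]]]; first exact: r1.
  have /SP [u ru uv] := r2 Z' h k; exists u => //.
  suff -> : tval y = [seq z ∘ k | z <- ys] by [].
  rewrite /ys -map_comp -{1}(map_tnth_enum y).
  by apply: eq_map => i /=; rewrite yk.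
- by case: (rf Z' h).
- apply/SP; have [_ rf2] := rf Z' h.
  have [|v rv vk] := rf2 [tuple parg f i ∘ k | i < n.+1] (pval f ∘ k).
    by exists k; split=> // i; rewrite tnth_mktuple.
  exists v => //; congr (apps _ _ _): rv => /=.
  by rewrite /ys -map_comp.
Qed.

Lemma app_sub_exists (H : heyting_category) (A : opas H) (U V : sub A) :
  exists W : sub A, forall Z (z : Z ~> A), z ∈ W <-> below_app U V z.
Proof.
have reg := heyting_regular (hcatP H); have lim := regular_finlim reg.
have [P1 [p1 [q1 [pq1 pb1]]]] := pullback_exists lim (lleg (odom A)) (sub_arr U).
have [P2 [p2 [q2 [pq2 pb2]]]] := pullback_exists lim (rleg (odom A) ∘ p1) (sub_arr V).
have [P3 [p3 [q3 [pq3 pb3]]]] := pullback_exists lim (oapp A ∘ p1 ∘ p2) (rleg (ole A)).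
have [I [e [m [re mm fE]]]] := regular_image reg (lleg (ole A) ∘ q3).
exists (Sub mm) => Z z; split=> [[k /= kz]|].
  have [Z' [k' [e' pb]]] := pullback_exists lim e k.
  exists Z', e'; split; first exact: (regular_stable reg pb re).
  pose d := p1 ∘ p2 ∘ p3 ∘ k'.
  exists (lleg (odom A) ∘ d), (rleg (odom A) ∘ d), (oapp A ∘ d); split.
  - by exists (q1 ∘ p2 ∘ p3 ∘ k'); rewrite /d !compA pq1.
  - by exists (q2 ∘ p3 ∘ k'); rewrite /d !compA pq2.
  - by exists d.
  - exists (q3 ∘ k'); rewrite !compA fE -kz -!compA (proj1 pb) /d; split=> //.
    by rewrite !compA pq3.
case=> Z' [e' [re' [x [y [v [[kU kx] [kV ky] [d [dx dy dv]] [s [sl sr]]]]]]]].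
have [|l1 [[a1 b1] _]] := pb1 Z' d kU; first by rewrite dx.
have [|l2 [[a2 b2] _]] := pb2 Z' l1 kV; first by rewrite -compA a1 dy.
have [|l3 [[a3 b3] _]] := pb3 Z' l2 s; first by rewrite -!compA a2 a1 dv.
apply: (mem_descent re'); exists (e ∘ l3) => /=.
by rewrite compA -fE -compA b3.
Qed.

(** [⟦f⟧] *)
Definition realizers (H : heyting_category) (A : opas H) (n : nat) (f : pfun A n.+1) :
    sub A :=
  sval (cid (realizers_exist f)).

Lemma realizersP (H : heyting_category) (A : opas H) (n : nat) (f : pfun A n.+1)
    (Z : H) (r : Z ~> A) :
  r ∈ realizers f <-> realizes f r.
Proof. by rewrite /realizers; case: cid => R /= RP; apply: RP. Qed.

(** [UV = {z | ∃x∈U, y∈V. z ≤ xy}] *)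
Definition app_sub (H : heyting_category) (A : opas H) (U V : sub A) : sub A :=
  sval (cid (app_sub_exists U V)).

Lemma app_subP (H : heyting_category) (A : opas H) (U V : sub A) (Z : H) (z : Z ~> A) :
  z ∈ app_sub U V <-> below_app U V z.
Proof. by rewrite /app_sub; case: cid => W /= WP; apply: WP. Qed.

Definition down_closed (C : category) (A : opas C) (U : sub A) : Prop :=
  forall Z (x y : Z ~> A), le x y -> y ∈ U -> x ∈ U.

Record external_filter (H : heyting_category) (A : opas H) := ExternalFilter {
  ext :> sub A -> Prop;
  ext_down : forall U, ext U -> down_closed U;
  ext_up : forall U V, ext U -> down_closed V -> subset U V -> ext V;
  ext_app : forall U V, ext U -> ext V -> sub_app_defined U V -> ext (app_sub U V)
}.

Definition combinatory_complete (H : heyting_category) (A : opas H)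
    (phi : external_filter A) : Prop :=
  forall (n : nat) (f : pfun A n.+1), combinatory f -> phi (realizers f).

Lemma identity_realizer (H : heyting_category) (A : opas H) (phi : external_filter A) :
  combinatory_complete phi ->
  exists U, phi U /\ forall Z (u a : Z ~> A), u ∈ U -> exists2 b, app u a b & le b a.
Proof.
move=> cc; have jm (Z : H) (f g : Z ~> A) :
  (forall i : 'I_1, idm (A : H) ∘ f = idm (A : H) ∘ g) -> f = g.
  by move=> /(_ ord0); rewrite !comp1m.
pose f := @Pfun H A 1 A (fun _ => idm (A : H)) (idm (A : H)) jm; exists (realizers f); split.
  apply: cc; apply: (combinatory_proj (i := ord0)) => Z x v.
  split=> [[k [xk ->]]|->]; first by rewrite xk.
  by exists (tnth x ord0); split=> [i|] /=; rewrite ?ord1 comp1m.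
move=> Z u a /realizersP /(_ Z (idm Z)) [_ ru].
have [|b ub ba] := ru [tuple a] a.
  by exists a; split=> [i|] /=; rewrite ?ord1 comp1m ?tnth0.
exists b => //; case: ub => b'; rewrite compm1 => ub /= ->.
by [].
Qed.

Lemma composition_pfun (H : heyting_category) (A : opas H) :
  exists f : pfun A 3, combinatory f /\
    forall Z (x y z w v : Z ~> A), app y z w -> app x w v -> graph f [tuple x; y; z] v.
Proof.
have lim := regular_finlim (heyting_regular (hcatP H)).
pose o0 : 'I_3 := @Ordinal 3 0 isT.
pose o1 : 'I_3 := @Ordinal 3 1 isT.
pose o2 : 'I_3 := @Ordinal 3 2 isT.
have ord3 (i : 'I_3) : [\/ i = o0, i = o1 | i = o2].
  by case: i => [[|[|[|]]] //= lt]; [apply: Or31|apply: Or32|apply: Or33]; apply: val_inj.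
have [B [b1 [b2 prodB]]] := has_products lim (A : H) A.
have [T [t1 [t2 prodT]]] := has_products lim (A : H) B.
have [G [g1 [g2 prodG]]] := has_products lim (A : H) (tip (odom A)).
have [K [k1 [k2 [k12 pbK]]]] := pullback_exists lim (rleg (odom A)) (oapp A).
have prod_jm (X Y P : H) (p : P ~> X) (q : P ~> Y) : is_product p q ->
    forall Z (f g : Z ~> P), p ∘ f = p ∘ g -> q ∘ f = q ∘ g -> f = g.
  move=> pq Z f g pfg qfg; have [h [_ hU]] := pq Z (p ∘ g) (q ∘ g).
  by rewrite -(hU f) // -(hU g).
have jmA := odom_jointly_monic (opasP A).
pose argT (i : 'I_3) : T ~> A := tnth [tuple t1; b1 ∘ t2; b2 ∘ t2] i.
have jmT Z (f g : Z ~> T) : (forall i, argT i ∘ f = argT i ∘ g) -> f = g.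
  move=> fg; apply: (prod_jm _ _ _ _ _ prodT); first exact: (fg o0).
  apply: (prod_jm _ _ _ _ _ prodB); rewrite !compA; [exact: (fg o1)|exact: (fg o2)].
pose argG (i : 'I_3) : G ~> A :=
  tnth [tuple g1; lleg (odom A) ∘ g2; rleg (odom A) ∘ g2] i.
have jmG Z (f g : Z ~> G) : (forall i, argG i ∘ f = argG i ∘ g) -> f = g.
  move=> fg; apply: (prod_jm _ _ _ _ _ prodG); first exact: (fg o0).
  apply: jmA; rewrite !compA; [exact: (fg o1)|exact: (fg o2)].
pose argK (i : 'I_3) : K ~> A :=
  tnth [tuple lleg (odom A) ∘ k1; lleg (odom A) ∘ k2; rleg (odom A) ∘ k2] i.
have jmK Z (f g : Z ~> K) : (forall i, argK i ∘ f = argK i ∘ g) -> f = g.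
  move=> fg.
  have fg2 : k2 ∘ f = k2 ∘ g.
    apply: jmA; rewrite !compA; [exact: (fg o1)|exact: (fg o2)].
  have fg1 : k1 ∘ f = k1 ∘ g.
    apply: jmA; rewrite !compA; first exact: (fg o0).
    by rewrite k12 -!compA fg2.
  have [|k [_ kU]] := pbK Z (k1 ∘ g) (k2 ∘ g); first by rewrite !compA k12.
  by rewrite -(kU f) // -(kU g).
pose fT i := Pfun (argT i) jmT.
pose fG := Pfun (oapp A ∘ g2) jmG.
pose fK := Pfun (oapp A ∘ k1) jmK.
have combT i : combinatory (A := A) (fT i).
  apply: (combinatory_proj (i := i)) => Z x v.
  split=> [[k [xk ->]]|->]; first by rewrite xk.
  have [b [[e1 e2] _]] := prodB Z (tnth x o1) (tnth x o2).
  have [t [[e0 eb] _]] := prodT Z (tnth x o0) b.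
  have xt j : tnth x j = argT j ∘ t.
    by case: (ord3 j) => ->; rewrite /argT /tnth /= -?compA ?eb.
  by exists t.
have combG : combinatory (A := A) fG.
  apply: (combinatory_app (combT o1) (combT o2)) => Z x v; split.
    case=> k [xk ->]; exists (tnth x o1), (tnth x o2).
    have graphT i : graph (fT i) x (tnth x i).
      have [b [[e1 e2] _]] := prodB Z (tnth x o1) (tnth x o2).
      have [t [[e0 eb] _]] := prodT Z (tnth x o0) b.
      exists t; split=> [j|]; first by
        case: (ord3 j) => ->; rewrite /= /argT /tnth /= -?compA ?eb.
      by case: (ord3 i) => ->; rewrite /= /argT /tnth /= -?compA ?eb.
    split; [exact: graphT|exact: graphT|].
    by exists (g2 ∘ k); rewrite !xk /argG /tnth /= !compA.
  case=> u [w [[k [xk uk]] [l [xl wl]] [d [d1 d2 dv]]]].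
  have [g [[e1 e2] _]] := prodG Z (tnth x o0) d.
  exists g; split=> [j|] /=; last by rewrite -compA e2.
  case: (ord3 j) => ->; rewrite /argG /tnth /=.
  - by rewrite e1.
  - by rewrite -compA e2 d1 uk; exact: (xk o1).
  - by rewrite -compA e2 d2 wl; exact: (xl o2).
exists fK; split; last first.
  move=> Z x y z w v [d [d1 d2 dw]] [e [e1 e2 ev]].
  have [|k [[ke kd] _]] := pbK Z e d; first by rewrite e2 dw.
  exists k; split=> [j|] /=; last by rewrite -compA ke ev.
  by case: (ord3 j) => ->; rewrite /argK /tnth /= -compA ?ke ?kd ?e1 ?d1 ?d2.
apply: (combinatory_app (combT o0) combG) => Z x v; split.
  case=> k [xk ->].
  have [b [[e1 e2] _]] := prodB Z (tnth x o1) (tnth x o2).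
  have [t [[e0 eb] _]] := prodT Z (tnth x o0) b.
  have [g [[f1 f2] _]] := prodG Z (tnth x o0) (k2 ∘ k).
  exists (tnth x o0), (oapp A ∘ (k2 ∘ k)); split.
  - exists t; split=> [j|] //=.
    by case: (ord3 j) => ->; rewrite /argT /tnth /= -?compA ?eb.
  - exists g; split=> [j|] /=; last by rewrite -compA f2.
    case: (ord3 j) => ->; rewrite /argG /tnth /= -?compA ?f1 ?f2 //.
      by rewrite compA; exact: (xk o1).
    by rewrite compA; exact: (xk o2).
  - by exists (k1 ∘ k); rewrite (xk o0) /argK /tnth /= !compA k12.
case=> u [w [[k [xk uk]] [l [xl wl]] [d [d1 d2 dv]]]].
have [|m [[m1 m2] _]] := pbK Z d (g2 ∘ l); first by rewrite d2 wl /= compA.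
exists m; split=> [j|] /=; last by rewrite -compA m1.
case: (ord3 j) => ->; rewrite /argK /tnth /= -compA ?m1 ?m2.
- by rewrite d1 uk; exact: (xk o0).
- by rewrite compA; exact: (xl o1).
- by rewrite compA; exact: (xl o2).
Qed.

Lemma composition_realizer (H : heyting_category) (A : opas H) (phi : external_filter A)
    (U V : sub A) : combinatory_complete phi -> phi U -> phi V ->
  exists W, phi W /\ forall Z (w a : Z ~> A), w ∈ W ->
    exists (Z' : H) (e : Z' ~> Z) (u v : Z' ~> A), [/\ regular_epi e, u ∈ U, v ∈ V &
      forall b c, app u (a ∘ e) b -> app v b c -> exists2 d, app (w ∘ e) (a ∘ e) d & le d c].
Proof.
move=> cc phiU phiV; have [f [combf fP]] := composition_pfun A.
have OA := opasP A.
have phiB := cc _ _ combf; set B := realizers f in phiB.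
have BV : sub_app_defined B V.
  move=> Z x y /realizersP /(_ Z (idm Z)) [def _] _.
  have [v /=] := def [tuple y; y]; rewrite compm1 => -[w xy _].
  exact: app_dom xy.
have BVU : sub_app_defined (app_sub B V) U.
  move=> Z x y /app_subP [Z' [e [re [b [v [w [bB vV bv xw]]]]]]] yU.
  have /realizersP /(_ Z' (idm Z')) [def _] := bB.
  have [t /=] := def [tuple v; y ∘ e]; rewrite compm1 => -[w' bv' [t' wt _]].
  rewrite -(app_fun bv bv') in wt.
  apply: (rel_mem_descent (odom_jointly_monic OA) re).
  have [s xs _] := oapp_le OA xw (ole_refl OA (y ∘ e)) wt.
  exact: app_dom xs.
exists (app_sub (app_sub B V) U); split.
  by apply: ext_app => //; apply: ext_app.
move=> Z w a /app_subP [Z1 [e1 [re1 [s [u [su [/app_subP sBV uU su_ wsu]]]]]]].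
have [Z2 [e2 [re2 [b [v [bv [bB vV bv_ sbv]]]]]]] := sBV.
have [Z3 [e [re [k ke]]]] : exists (Z3 : H) (e : Z3 ~> Z), regular_epi e /\
    exists k : Z3 ~> Z2, e = e1 ∘ e2 ∘ k.
  have reg := heyting_regular (hcatP H).
  have [I [q [m [rq mm qm]]]] := regular_image reg (e1 ∘ e2).
  exists Z2, (e1 ∘ e2); split; last by exists (idm _); rewrite compm1.
  have [n mn] : exists n, m ∘ n = idm Z.
    have [k kE] : idm Z ∈ Sub mm.
      apply: (mem_descent re1); apply: (mem_descent re2).
      by exists q => /=; rewrite -qm comp1m.
    by exists k.
  have nm : n ∘ m = idm I by apply: mm; rewrite compA mn comp1m compm1.
  case: rq => W [x [y [xy qU]]]; exists W, x, y; split.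
    by rewrite qm -!compA xy.
  move=> T z zxy; have [t [tq tU]] := qU T z zxy.
  exists (t ∘ n); split; first by rewrite qm -compA (compA n) nm comp1m.
  move=> t' t'E; rewrite (tU (t' ∘ m)) -?compA ?mn ?compm1 //.
  by rewrite compA -compA -qm.
exists Z3, e, (u ∘ (e2 ∘ k)), (v ∘ k); split=> //; try exact: mem_comp.
move=> c d uc vd.
have /realizersP /(_ Z3 k) [_ rf] := bB.
have [r /= [x bx [y xy [z yz ->]]] zd] := rf _ _ (fP _ _ _ _ _ _ uc vd).
rewrite -(app_fun (app_comp k bv_) bx) in xy.
have [y' sy' yy'] := oapp_le OA (rel_mem_comp k sbv) (ole_refl OA (u ∘ (e2 ∘ k))) xy.
have suE := app_comp (e2 ∘ k) su_; rewrite compA in suE.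
have yE := app_fun suE sy'; rewrite -{}yE in yy'.
have wle : le (w ∘ e) y.
  by apply: (ole_trans OA) yy'; have := rel_mem_comp (e2 ∘ k) wsu; rewrite ke !compA.
have [t wt tz] := oapp_le OA wle (ole_refl OA (a ∘ e)) yz.
by exists t => //; apply: (ole_trans OA) zd.
Qed.

Record rel_object (H : heyting_category) (A : opas H) := RelObject {
  robase : H;
  rorel : span A robase;
  rorel_jointly_monic : jointly_monic rorel;
  rorel_down : forall Z (a b : Z ~> A) (x : Z ~> robase),
    le a b -> ⟨b, x⟩ ∈ rorel -> ⟨a, x⟩ ∈ rorel
}.

Definition tracked (H : heyting_category) (A : opas H) (phi : external_filter A)
    (P Q : rel_object A) (f : robase P ~> robase Q) : Prop :=
  exists U, phi U /\
    forall Z (u a : Z ~> A) (x : Z ~> robase P), u ∈ U -> ⟨a, x⟩ ∈ rorel P ->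
      exists2 b, app u a b & ⟨b, f ∘ x⟩ ∈ rorel Q.

Definition rel_hom (H : heyting_category) (A : opas H) (phi : external_filter A)
    (P Q : rel_object A) : Type :=
  {f : robase P ~> robase Q | tracked phi f}.

Lemma rel_hom_eq (H : heyting_category) (A : opas H) (phi : external_filter A)
    (P Q : rel_object A) (f g : rel_hom phi P Q) : sval f = sval g -> f = g.
Proof. by case: f g => [f tf] [g tg] /= fg; apply: eq_exist. Qed.

Lemma tracked_id (H : heyting_category) (A : opas H) (phi : external_filter A)
    (cc : combinatory_complete phi) (P : rel_object A) : tracked phi (idm (robase P)).
Proof.
have [U [phiU UP]] := identity_realizer cc.
exists U; split=> // Z u a x uU ax.
have [b ub ba] := UP Z u a uU; exists b => //.
by rewrite comp1m; apply: rorel_down ba ax.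
Qed.

Lemma tracked_comp (H : heyting_category) (A : opas H) (phi : external_filter A)
    (cc : combinatory_complete phi) (P Q R : rel_object A)
    (g : robase Q ~> robase R) (f : robase P ~> robase Q) :
  tracked phi g -> tracked phi f -> tracked phi (g ∘ f).
Proof.
move=> [V [phiV VP]] [U [phiU UP]].
have [W [phiW WP]] := composition_realizer cc phiU phiV.
exists W; split=> // Z w a x wW ax.
have [Z' [e [u [v [re uU vV uv]]]]] := WP Z w a wW.
have [b ub bfx] := UP _ _ _ _ uU (rel_mem_comp e ax).
have [c vb cgfx] := VP _ _ _ _ vV bfx.
have [d wd dc] := uv b c ub vb.
have /app_definedP [d' wd'] : app_defined w a.
  by apply: (rel_mem_descent (odom_jointly_monic (opasP A)) re); apply: app_dom wd.
exists d' => //; apply: (rel_mem_descent (@rorel_jointly_monic _ _ R) re).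
rewrite (app_fun (app_comp e wd') wd); apply: rorel_down dc _.
by rewrite -!compA.
Qed.

Definition rel_id (H : heyting_category) (A : opas H) (phi : external_filter A)
    (cc : combinatory_complete phi) (P : rel_object A) : rel_hom phi P P :=
  exist _ (idm (robase P)) (tracked_id cc P).

Definition rel_comp (H : heyting_category) (A : opas H) (phi : external_filter A)
    (cc : combinatory_complete phi) (P Q R : rel_object A)
    (g : rel_hom phi Q R) (f : rel_hom phi P Q) : rel_hom phi P R :=
  exist _ (sval g ∘ sval f) (tracked_comp cc (svalP g) (svalP f)).

Lemma rel_comp1m (H : heyting_category) (A : opas H) (phi : external_filter A)
    (cc : combinatory_complete phi) (P Q : rel_object A) (f : rel_hom phi P Q) :
  rel_comp cc (rel_id cc Q) f = f.
Proof. by apply: rel_hom_eq; apply: comp1m. Qed.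

Lemma rel_compm1 (H : heyting_category) (A : opas H) (phi : external_filter A)
    (cc : combinatory_complete phi) (P Q : rel_object A) (f : rel_hom phi P Q) :
  rel_comp cc f (rel_id cc P) = f.
Proof. by apply: rel_hom_eq; apply: compm1. Qed.

Lemma rel_compA (H : heyting_category) (A : opas H) (phi : external_filter A)
    (cc : combinatory_complete phi) (P Q R S : rel_object A)
    (h : rel_hom phi R S) (g : rel_hom phi Q R) (f : rel_hom phi P Q) :
  rel_comp cc h (rel_comp cc g f) = rel_comp cc (rel_comp cc h g) f.
Proof. by apply: rel_hom_eq; apply: compA. Qed.

Definition rel_category (H : heyting_category) (A : opas H) (phi : external_filter A)
    (cc : combinatory_complete phi) : category :=
  Category (rel_comp1m cc) (rel_compm1 cc) (rel_compA cc).

Definition realizability_fibration (H : heyting_category) (A : opas H)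
    (phi : external_filter A) (cc : combinatory_complete phi) :
    functor (rel_category cc) H :=
  @Functor (rel_category cc) H (fun P => robase P) (fun P Q f => sval f)
    (fun P => erefl) (fun P Q R g f => erefl).

Definition supine (E B : category) (p : functor E B) (X Y : E) (s : X ~> Y) : Prop :=
  forall (Z : E) (g : X ~> Z) (h : p Y ~> p Z), h ∘ fmap p s = fmap p g ->
    exists! k : Y ~> Z, fmap p k = h /\ k ∘ s = g.

Definition hom_class (C : category) := forall X Y : C, (X ~> Y) -> Prop.

Inductive loc_term (C : category) (W : hom_class C) : C -> C -> Type :=
| loc_map X Y (f : X ~> Y) : loc_term W X Y
| loc_inv X Y (w : X ~> Y) (Ww : W X Y w) : loc_term W Y X
| loc_cat X Y Z (g : loc_term W Y Z) (f : loc_term W X Y) : loc_term W X Z.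

Inductive loc_eq (C : category) (W : hom_class C) :
    forall X Y : C, loc_term W X Y -> loc_term W X Y -> Prop :=
| loc_refl X Y (t : loc_term W X Y) : loc_eq t t
| loc_sym X Y (s t : loc_term W X Y) : loc_eq s t -> loc_eq t s
| loc_trans X Y (r s t : loc_term W X Y) : loc_eq r s -> loc_eq s t -> loc_eq r t
| loc_congr X Y Z (t t' : loc_term W Y Z) (s s' : loc_term W X Y) :
    loc_eq t t' -> loc_eq s s' -> loc_eq (loc_cat t s) (loc_cat t' s')
| loc_idl X Y (t : loc_term W X Y) : loc_eq (loc_cat (loc_map W (idm Y)) t) t
| loc_idr X Y (t : loc_term W X Y) : loc_eq (loc_cat t (loc_map W (idm X))) t
| loc_assoc X Y Z T (t : loc_term W Z T) (s : loc_term W Y Z) (r : loc_term W X Y) :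
    loc_eq (loc_cat t (loc_cat s r)) (loc_cat (loc_cat t s) r)
| loc_mapM X Y Z (g : Y ~> Z) (f : X ~> Y) :
    loc_eq (loc_map W (g ∘ f)) (loc_cat (loc_map W g) (loc_map W f))
| loc_invl X Y (w : X ~> Y) (Ww : W X Y w) :
    loc_eq (loc_cat (loc_inv Ww) (loc_map W w)) (loc_map W (idm X))
| loc_invr X Y (w : X ~> Y) (Ww : W X Y w) :
    loc_eq (loc_cat (loc_map W w) (loc_inv Ww)) (loc_map W (idm Y)).

Definition loc_hom (C : category) (W : hom_class C) (X Y : C) : Type :=
  {p : loc_term W X Y -> Prop | exists t, p = loc_eq t}.

Definition loc_pi (C : category) (W : hom_class C) (X Y : C) (t : loc_term W X Y) :
    loc_hom W X Y :=
  exist _ (loc_eq t) (ex_intro _ t erefl).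

Definition loc_repr (C : category) (W : hom_class C) (X Y : C) (p : loc_hom W X Y) :
    loc_term W X Y :=
  sval (cid (svalP p)).

Lemma loc_reprK (C : category) (W : hom_class C) (X Y : C) (p : loc_hom W X Y) :
  loc_pi (loc_repr p) = p.
Proof.
rewrite /loc_repr; case: cid => t /=.
by case: p => p ex /= pt; rewrite /loc_pi; apply: eq_exist.
Qed.

Lemma loc_piP (C : category) (W : hom_class C) (X Y : C) (s t : loc_term W X Y) :
  loc_pi s = loc_pi t <-> loc_eq s t.
Proof.
split=> [st|st].
  have -> : loc_eq s = loc_eq t := congr1 sval st.
  exact: loc_refl.
rewrite /loc_pi; apply: eq_exist; apply: funext => r; apply: propext; split=> ?.
  by apply: loc_trans (loc_sym st) _.
by apply: loc_trans st _.
Qed.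

Lemma loc_pi_repr (C : category) (W : hom_class C) (X Y : C) (t : loc_term W X Y) :
  loc_eq (loc_repr (loc_pi t)) t.
Proof. by apply/loc_piP; apply: loc_reprK. Qed.

Definition loc_id (C : category) (W : hom_class C) (X : C) : loc_hom W X X :=
  loc_pi (loc_map W (idm X)).

Definition loc_comp (C : category) (W : hom_class C) (X Y Z : C)
    (g : loc_hom W Y Z) (f : loc_hom W X Y) : loc_hom W X Z :=
  loc_pi (loc_cat (loc_repr g) (loc_repr f)).

Lemma loc_comp_pi (C : category) (W : hom_class C) (X Y Z : C)
    (t : loc_term W Y Z) (s : loc_term W X Y) :
  loc_comp (loc_pi t) (loc_pi s) = loc_pi (loc_cat t s).
Proof. by apply/loc_piP; apply: loc_congr; apply: loc_pi_repr. Qed.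

Lemma loc_comp1m (C : category) (W : hom_class C) (X Y : C) (f : loc_hom W X Y) :
  loc_comp (loc_id W Y) f = f.
Proof.
by rewrite -(loc_reprK f) loc_comp_pi; apply/loc_piP; apply: loc_idl.
Qed.

Lemma loc_compm1 (C : category) (W : hom_class C) (X Y : C) (f : loc_hom W X Y) :
  loc_comp f (loc_id W X) = f.
Proof.
by rewrite -(loc_reprK f) loc_comp_pi; apply/loc_piP; apply: loc_idr.
Qed.

Lemma loc_compA (C : category) (W : hom_class C) (X Y Z T : C) (h : loc_hom W Z T)
    (g : loc_hom W Y Z) (f : loc_hom W X Y) :
  loc_comp h (loc_comp g f) = loc_comp (loc_comp h g) f.
Proof.
rewrite -(loc_reprK f) -(loc_reprK g) -(loc_reprK h) !loc_comp_pi.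
by apply/loc_piP; apply: loc_assoc.
Qed.

(** The localization [C[W^-1]]: formal composites of arrows of [C] and of
    inverses of arrows in [W], modulo the least congruence making [C -> C[W^-1]]
    a functor that inverts [W]. *)
Definition localization (C : category) (W : hom_class C) : category :=
  Category (@loc_comp1m C W) (@loc_compm1 C W) (@loc_compA C W).

Lemma loc_functorM (C : category) (W : hom_class C) (X Y Z : C) (g : Y ~> Z) (f : X ~> Y) :
  loc_pi (loc_map W (g ∘ f)) = loc_comp (loc_pi (loc_map W g)) (loc_pi (loc_map W f)).
Proof. by rewrite loc_comp_pi; apply/loc_piP; apply: loc_mapM. Qed.

Definition loc_functor (C : category) (W : hom_class C) : functor C (localization W) :=
  @Functor C (localization W) (fun X => X) (fun X Y f => loc_pi (loc_map W f))
    (fun X => erefl) (@loc_functorM C W).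

Lemma loc_functor_iso (C : category) (W : hom_class C) (X Y : C) (w : X ~> Y) :
  W X Y w -> is_iso (fmap (loc_functor W) w).
Proof.
move=> Ww; exists (loc_pi (loc_inv Ww)); rewrite /= !loc_comp_pi.
by split; apply/loc_piP; [apply: loc_invl|apply: loc_invr].
Qed.

Fixpoint loc_eval (C D : category) (W : hom_class C) (G : functor C D)
    (inv : forall (X Y : C) (w : X ~> Y), W X Y w -> is_iso (fmap G w))
    (X Y : C) (t : loc_term W X Y) : G X ~> G Y :=
  match t with
  | loc_map _ _ f => fmap G f
  | loc_inv _ _ w Ww => sval (cid (inv _ _ w Ww))
  | loc_cat _ _ _ g f => loc_eval inv g ∘ loc_eval inv f
  end.

Lemma loc_eval_eq (C D : category) (W : hom_class C) (G : functor C D)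
    (inv : forall (X Y : C) (w : X ~> Y), W X Y w -> is_iso (fmap G w))
    (X Y : C) (s t : loc_term W X Y) :
  loc_eq s t -> loc_eval inv s = loc_eval inv t.
Proof.
elim=> //= {X Y s t}.
- by move=> X Y r s t _ -> _ ->.
- by move=> X Y Z t t' s s' _ -> _ ->.
- by move=> X Y t; rewrite fmap1 comp1m.
- by move=> X Y t; rewrite fmap1 compm1.
- by move=> *; rewrite compA.
- by move=> *; rewrite fmapM.
- by move=> X Y w Ww; case: cid => v /= [-> _]; rewrite fmap1.
- by move=> X Y w Ww; case: cid => v /= [_ ->]; rewrite fmap1.
Qed.

Lemma loc_lift1 (C D : category) (W : hom_class C) (G : functor C D)
    (inv : forall (X Y : C) (w : X ~> Y), W X Y w -> is_iso (fmap G w))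
    (X : localization W) :
  loc_eval inv (loc_repr (idm X)) = idm (G X).
Proof. by rewrite (loc_eval_eq inv (loc_pi_repr _)) /= fmap1. Qed.

Lemma loc_liftM (C D : category) (W : hom_class C) (G : functor C D)
    (inv : forall (X Y : C) (w : X ~> Y), W X Y w -> is_iso (fmap G w))
    (X Y Z : localization W) (g : Y ~> Z) (f : X ~> Y) :
  loc_eval inv (loc_repr (g ∘ f)) = loc_eval inv (loc_repr g) ∘ loc_eval inv (loc_repr f).
Proof. by rewrite (loc_eval_eq inv (loc_pi_repr _)). Qed.

(** This functor, [loc_liftE] and [localization_unique] are the universal
    property of the localization. *)
Definition loc_lift (C D : category) (W : hom_class C) (G : functor C D)
    (inv : forall (X Y : C) (w : X ~> Y), W X Y w -> is_iso (fmap G w)) :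
    functor (localization W) D :=
  @Functor (localization W) D (fun X => G X) (fun X Y f => loc_eval inv (loc_repr f))
    (loc_lift1 inv) (loc_liftM inv).

Lemma loc_liftE (C D : category) (W : hom_class C) (G : functor C D)
    (inv : forall (X Y : C) (w : X ~> Y), W X Y w -> is_iso (fmap G w))
    (X Y : C) (f : X ~> Y) :
  fmap (loc_lift inv) (fmap (loc_functor W) f) = fmap G f.
Proof. by rewrite /= (loc_eval_eq inv (loc_pi_repr _)). Qed.

Lemma localization_unique (C D : category) (W : hom_class C)
    (K L : functor (localization W) D) (eta : forall X : C, K X ~> L X) :
  (forall (X Y : C) (f : X ~> Y), eta Y ∘ fmap K (fmap (loc_functor W) f) =
     fmap L (fmap (loc_functor W) f) ∘ eta X) ->
  forall (X Y : localization W) (f : X ~> Y), eta Y ∘ fmap K f = fmap L f ∘ eta X.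
Proof.
move=> nat X Y f; rewrite -(loc_reprK f).
elim: (loc_repr f) => {X Y f} [X Y f|X Y w Ww|X Y Z g IHg f IHf]; first exact: nat.
  have wl : fmap L (loc_pi (loc_inv Ww) : hom (c := localization W) Y X) ∘ fmap L (fmap (loc_functor W) w) = idm _.
    rewrite -fmapM -fmap1; congr (fmap L _) => /=; rewrite loc_comp_pi.
    by apply/loc_piP; apply: loc_invl.
  have wr : fmap K (fmap (loc_functor W) w) ∘ fmap K (loc_pi (loc_inv Ww) : hom (c := localization W) Y X) = idm _.
    rewrite -fmapM -fmap1; congr (fmap K _) => /=; rewrite loc_comp_pi.
    by apply/loc_piP; apply: loc_invr.
  rewrite -[LHS]comp1m -wl -compA (compA _ (eta X)) -nat -(compA (eta Y)) wr.
  by rewrite compm1.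
rewrite -loc_comp_pi.
have -> : loc_comp (loc_pi g) (loc_pi f) =
  comp (c := localization W) (loc_pi g) (loc_pi f) by [].
by rewrite !fmapM compA IHg -compA IHf compA.
Qed.

Definition supine_mono (H : heyting_category) (A : opas H) (phi : external_filter A)
    (cc : combinatory_complete phi) : hom_class (rel_category cc) :=
  fun P Q s => mono s /\ supine (realizability_fibration cc) s.
Arguments supine_mono {H A phi} _ _ _ _.

Definition asm (H : heyting_category) (A : opas H) (phi : external_filter A)
    (cc : combinatory_complete phi) : category :=
  localization (supine_mono cc).

Lemma full_span_exists (H : heyting_category) (X Y : H) :
  exists S : span X Y, is_product (lleg S) (rleg S).
Proof.
have [P [p [q pq]]] := has_products (regular_finlim (heyting_regular (hcatP H))) X Y.
by exists (Span p q).
Qed.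

Definition full_span (H : heyting_category) (X Y : H) : span X Y :=
  sval (cid (full_span_exists X Y)).

Lemma full_spanP (H : heyting_category) (X Y : H) :
  is_product (lleg (full_span X Y)) (rleg (full_span X Y)).
Proof. exact: svalP (cid (full_span_exists X Y)). Qed.

Lemma full_span_jointly_monic (H : heyting_category) (X Y : H) :
  jointly_monic (full_span X Y).
Proof.
move=> Z f g fg fg'.
have [h [_ hU]] := full_spanP (lleg (full_span X Y) ∘ g) (rleg (full_span X Y) ∘ g).
by rewrite -(hU f) // -(hU g).
Qed.

Lemma full_span_mem (H : heyting_category) (X Y Z : H) (x : Z ~> X) (y : Z ~> Y) :
  ⟨x, y⟩ ∈ full_span X Y.
Proof. by have [h [? _]] := full_spanP x y; exists h. Qed.

Definition nabla_object (H : heyting_category) (A : opas H) (X : H) : rel_object A :=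
  RelObject (@full_span_jointly_monic H A X)
    (fun Z a b x _ _ => full_span_mem a x).

Lemma nabla_tracked (H : heyting_category) (A : opas H) (phi : external_filter A)
    (cc : combinatory_complete phi) (P : rel_object A) (X : H) (f : robase P ~> X) :
  tracked phi (Q := nabla_object A X) f.
Proof.
have [U [phiU UP]] := identity_realizer cc.
exists U; split=> // Z u a x uU _.
by have [b ub _] := UP Z u a uU; exists b => //; apply: full_span_mem.
Qed.

Definition nabla_hom (H : heyting_category) (A : opas H) (phi : external_filter A)
    (cc : combinatory_complete phi) (P : rel_object A) (X : H) (f : robase P ~> X) :
    rel_hom phi P (nabla_object A X) :=
  exist _ f (nabla_tracked cc f).

Lemma nabla1 (H : heyting_category) (A : opas H) (phi : external_filter A)
    (cc : combinatory_complete phi) (X : H) :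
  nabla_hom cc (P := nabla_object A X) (idm X) = rel_id cc (nabla_object A X).
Proof. exact: rel_hom_eq. Qed.

Lemma nablaM (H : heyting_category) (A : opas H) (phi : external_filter A)
    (cc : combinatory_complete phi) (X Y Z : H) (g : Y ~> Z) (f : X ~> Y) :
  nabla_hom cc (P := nabla_object A X) (g ∘ f) =
  rel_comp cc (nabla_hom cc (P := nabla_object A Y) g)
    (nabla_hom cc (P := nabla_object A X) f).
Proof. exact: rel_hom_eq. Qed.

Definition rel_nabla (H : heyting_category) (A : opas H) (phi : external_filter A)
    (cc : combinatory_complete phi) : functor H (rel_category cc) :=
  @Functor H (rel_category cc) (@nabla_object H A)
    (fun X Y f => nabla_hom cc (P := nabla_object A X) f) (nabla1 cc) (nablaM cc).

Definition nabla (H : heyting_category) (A : opas H) (phi : external_filter A)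
    (cc : combinatory_complete phi) : functor H (asm cc) :=
  comp_functor (loc_functor (supine_mono cc)) (rel_nabla cc).

(** [Å = (A, {(a, b) | a ≤ b})] *)
Definition ring_object (H : heyting_category) (A : opas H) : rel_object A :=
  RelObject (ole_jointly_monic (opasP A)) (ole_trans (opasP A)).

(** The inclusion [Å -> ∇A], carried by the identity of [A]. *)
Definition ring_incl (H : heyting_category) (A : opas H) (phi : external_filter A)
    (cc : combinatory_complete phi) :
    hom (c := asm cc) (ring_object A) (nabla cc A) :=
  fmap (loc_functor (supine_mono cc))
    (nabla_hom cc (P := ring_object A) (idm (A : H)) :
       hom (c := rel_category cc) (ring_object A) (rel_nabla cc A)).

Definition inhabited_object (R : category) (X : R) : Prop :=
  forall (T : R) (t : X ~> T), is_terminal T -> regular_epi t.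

Record model_data (H : category) (A : opas_data H) := ModelData {
  model_cat : category;
  model_functor : functor H model_cat;
  model_filter : model_cat;
  model_incl : model_filter ~> model_functor A
}.

Record is_regular_model (H : heyting_category) (A : opas H) (phi : external_filter A)
    (M : model_data A) : Prop := IsRegularModel {
  model_regular : is_regular (model_cat M);
  model_functor_regular : regular_functor (model_functor M);
  model_is_filter : @is_filter (model_cat M) (map_opas (model_functor M) A)
    (model_filter M) (model_incl M);
  model_inhabited : forall U, phi U ->
    forall (P : model_cat M) (p : P ~> model_filter M)
      (q : P ~> model_functor M (sub_dom U)),
      is_pullback (model_incl M) (fmap (model_functor M) (sub_arr U)) p q ->
      inhabited_object P
}.

Record model_morphism (H : category) (A : opas_data H) (M N : model_data A) :=
  ModelMorphism {
  mor_functor : functor (model_cat M) (model_cat N);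
  mor_regular : regular_functor mor_functor;
  mor_iso : nat_iso (comp_functor mor_functor (model_functor M)) (model_functor N);
  mor_filter : exists i : mor_functor (model_filter M) ~> model_filter N,
    is_iso i /\ model_incl N ∘ i = mor_iso A ∘ fmap mor_functor (model_incl M)
}.

Record model_2morphism (H : category) (A : opas_data H) (M N : model_data A)
    (f g : model_morphism M N) := Model2Morphism {
  cell :> nat_iso (mor_functor f) (mor_functor g);
  cell_iso : forall X : H, mor_iso g X ∘ cell (model_functor M X) = mor_iso f X
}.

Definition pseudoinitial_regular_model (H : heyting_category) (A : opas H)
    (phi : external_filter A) (M : model_data A) : Prop :=
  is_regular_model phi M /\
  forall N : model_data A, is_regular_model phi N ->
    exists f : model_morphism M N,
      forall g : model_morphism M N, inhabited (model_2morphism f g).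

Definition asm_model (H : heyting_category) (A : opas H) (phi : external_filter A)
    (cc : combinatory_complete phi) : model_data A :=
  @ModelData H A (asm cc) (nabla cc) (ring_object A) (ring_incl cc).

(* Main.v *)
(** The localization of the realizability fibration at supine monomorphisms has
    a right calculus of fractions, so that assemblies can be handled as spans
    [P <- P' -> Q] of honest realizability morphisms. A supine morphism becomes a
    regular epimorphism, and every morphism of assemblies is a supine one followed
    by a monomorphism, whence regularity. A regular model [(R, F, C)] induces the
    functor [(X, Y) |-> {x ∈ FX | ∃a∈C. (a, x) ∈ FY}]. It is the only one up to
    isomorphism, because [(X, Y)] is the image in [∇X] of [∇Y] restricted to codes
    in [Å], and regular functors preserve this presentation. *)

From mathcomp Require Import all_boot.
From mathcomp Require Import boolp.
Require Import Defs.

Set Implicit Arguments.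
Unset Strict Implicit.
Unset Printing Implicit Defensive.

Local Open Scope cat_scope.

(** Two features of the setting shape the arguments. A member [U] of [phi] is a subobject of [A]
    that need not be inhabited in [H], and a relation need not reach every point of its base. So a
    supine morphism, or an equation between assemblies, says something in [H] only about points that
    carry a code, and only at stages where suitable members of [phi] have elements. The remedy is to
    collect those points in a subobject of the base: restricting the base to it is a supine
    monomorphism ([cov_restrict]), hence invertible for assemblies. Models are compatible with this
    because [C] meets [F U] for every [U] in [phi], so that elements of [U] exist locally. Moreover,
    application of subobjects is defined by an existential quantifier, so an element of [U V] is
    only locally below a product. Realizers therefore act on regular epimorphic covers, and
    definedness and membership, which are given by jointly monic spans, are descended afterwards. *)

Section CategoryFacts.
Variable C : category.

(** * Limits, monomorphisms and regular epimorphisms in an arbitrary category *)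

Lemma iso_id (X : C) : is_iso (idm X).
Proof. by exists (idm X); rewrite comp1m. Qed.

Lemma iso_inv (X Y : C) (f : X ~> Y) (g : Y ~> X) :
  g ∘ f = idm X -> f ∘ g = idm Y -> is_iso g.
Proof. by move=> gf fg; exists f. Qed.

Lemma iso_mono (X Y : C) (f : X ~> Y) : is_iso f -> mono f.
Proof.
move=> [g [gf _]] Z a b ab.
by rewrite -(comp1m a) -(comp1m b) -gf -!compA ab.
Qed.

Lemma mono_id (X : C) : mono (idm X).
Proof. exact: iso_mono (iso_id X). Qed.

Lemma mono_comp (X Y Z : C) (g : Y ~> Z) (f : X ~> Y) : mono g -> mono f -> mono (g ∘ f).
Proof. by move=> mg mf T a b; rewrite -!compA => /mg /mf. Qed.

Lemma mono_of_comp (X Y Z : C) (g : Y ~> Z) (f : X ~> Y) : mono (g ∘ f) -> mono f.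
Proof. by move=> mgf T a b ab; apply: mgf; rewrite -!compA ab. Qed.

Lemma mono_split_iso (X Y : C) (m : X ~> Y) (n : Y ~> X) :
  mono m -> m ∘ n = idm Y -> is_iso m.
Proof.
move=> mm mn; exists n; split=> //.
by apply: mm; rewrite compA mn comp1m compm1.
Qed.

Lemma terminal_unique (T Z : C) (f g : Z ~> T) : is_terminal T -> f = g.
Proof. by move=> /(_ Z) [h [_ hU]]; rewrite -(hU f) // -(hU g). Qed.

Lemma product_jointly_monic (X Y P : C) (p : P ~> X) (q : P ~> Y) :
  is_product p q -> jointly_monic (Span p q).
Proof.
move=> pq Z f g /= pfg qfg; have [h [_ hU]] := pq Z (p ∘ g) (q ∘ g).
by rewrite -(hU f) // -(hU g).
Qed.

Lemma product_pair (X Y P Z : C) (p : P ~> X) (q : P ~> Y) (f : Z ~> X) (g : Z ~> Y) :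
  is_product p q -> exists h : Z ~> P, p ∘ h = f /\ q ∘ h = g.
Proof. by move=> /(_ Z f g) [h [? _]]; exists h. Qed.

Lemma productP (X Y P : C) (p : P ~> X) (q : P ~> Y) :
  (forall Z (f : Z ~> X) (g : Z ~> Y), exists h : Z ~> P, p ∘ h = f /\ q ∘ h = g) ->
  jointly_monic (Span p q) -> is_product p q.
Proof.
move=> ex jm Z f g; have [h [<- <-]] := ex Z f g.
by exists h; split=> // h' [eqp eqq]; apply: jm.
Qed.

Lemma pullback_jointly_monic (X Y B P : C) (f : X ~> B) (g : Y ~> B) (p : P ~> X)
    (q : P ~> Y) : is_pullback f g p q -> jointly_monic (Span p q).
Proof.
move=> [fg pb] Z a b /= pab qab; have [|h [_ hU]] := pb Z (p ∘ b) (q ∘ b).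
  by rewrite !compA fg.
by rewrite -(hU a) // -(hU b).
Qed.

Lemma pullback_pair (X Y B P Z : C) (f : X ~> B) (g : Y ~> B) (p : P ~> X) (q : P ~> Y)
    (x : Z ~> X) (y : Z ~> Y) : is_pullback f g p q -> f ∘ x = g ∘ y ->
  exists h : Z ~> P, p ∘ h = x /\ q ∘ h = y.
Proof. by move=> [_ pb] /pb [h [? _]]; exists h. Qed.

Lemma pullbackP (X Y B P : C) (f : X ~> B) (g : Y ~> B) (p : P ~> X) (q : P ~> Y) :
  f ∘ p = g ∘ q ->
  (forall Z (x : Z ~> X) (y : Z ~> Y), f ∘ x = g ∘ y ->
     exists h : Z ~> P, p ∘ h = x /\ q ∘ h = y) ->
  jointly_monic (Span p q) -> is_pullback f g p q.
Proof.
move=> fg ex jm; split=> // Z x y xy; have [h [<- <-]] := ex Z x y xy.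
by exists h; split=> // h' [eqp eqq]; apply: jm.
Qed.

Lemma equalizer_mono (X Y E : C) (f g : X ~> Y) (e : E ~> X) :
  is_equalizer f g e -> mono e.
Proof.
move=> [fg eq] Z a b ab; have [|h [_ hU]] := eq Z (e ∘ b); first by rewrite !compA fg.
by rewrite -(hU a) // -(hU b).
Qed.

Lemma equalizer_fact (X Y E Z : C) (f g : X ~> Y) (e : E ~> X) (z : Z ~> X) :
  is_equalizer f g e -> f ∘ z = g ∘ z -> exists h : Z ~> E, e ∘ h = z.
Proof. by move=> [_ eq] /eq [h [? _]]; exists h. Qed.

Lemma equalizerP (X Y E : C) (f g : X ~> Y) (e : E ~> X) :
  f ∘ e = g ∘ e -> mono e ->
  (forall Z (z : Z ~> X), f ∘ z = g ∘ z -> exists h : Z ~> E, e ∘ h = z) ->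
  is_equalizer f g e.
Proof.
move=> fg me ex; split=> // Z z zfg; have [h <-] := ex Z z zfg.
by exists h; split=> // h' eh; apply: me.
Qed.

Lemma product_iso (X Y P Q : C) (p : P ~> X) (q : P ~> Y) (p' : Q ~> X) (q' : Q ~> Y) :
  is_product p q -> is_product p' q' ->
  exists i : Q ~> P, [/\ is_iso i, p' = p ∘ i & q' = q ∘ i].
Proof.
move=> pq pq'.
have [i [pi qi]] := product_pair p' q' pq; have [j [pj qj]] := product_pair p q pq'.
exists i; split=> //; exists j; split.
  by apply: (product_jointly_monic pq'); rewrite /= !compA ?pj ?qj ?pi ?qi compm1.
by apply: (product_jointly_monic pq); rewrite /= !compA ?pi ?qi ?pj ?qj compm1.
Qed.

Lemma product_comp_iso (X Y P Q : C) (p : P ~> X) (q : P ~> Y) (i : Q ~> P) :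
  is_product p q -> is_iso i -> is_product (p ∘ i) (q ∘ i).
Proof.
move=> pq [j [ji ij]]; apply: productP => [Z f g|Z f g /=].
  have [h [hf hg]] := product_pair f g pq; exists (j ∘ h).
  by rewrite -!compA !(compA i) ij comp1m.
rewrite -!compA => fp fq; apply: (iso_mono (f := i)); first by exists j.
exact: (product_jointly_monic pq).
Qed.

Lemma equalizer_iso (X Y E E' : C) (f g : X ~> Y) (e : E ~> X) (e' : E' ~> X) :
  is_equalizer f g e -> is_equalizer f g e' ->
  exists2 i : E' ~> E, is_iso i & e' = e ∘ i.
Proof.
move=> eq eq'.
have [i ei] := equalizer_fact eq (proj1 eq'); have [j ej] := equalizer_fact eq' (proj1 eq).
exists i => //; exists j; split.
  by apply: (equalizer_mono eq'); rewrite compA ej compm1.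
by apply: (equalizer_mono eq); rewrite compA ei compm1.
Qed.

Lemma equalizer_comp_iso (X Y E E' : C) (f g : X ~> Y) (e : E ~> X) (i : E' ~> E) :
  is_equalizer f g e -> is_iso i -> is_equalizer f g (e ∘ i).
Proof.
move=> eq iI; apply: equalizerP; first by rewrite !compA (proj1 eq).
  exact: mono_comp (equalizer_mono eq) (iso_mono iI).
move=> Z z zfg; have [h <-] := equalizer_fact eq zfg; have [j [_ ij]] := iI.
by exists (j ∘ h); rewrite -compA (compA i) ij comp1m.
Qed.

Lemma mono_pullback (X Y : C) (m : X ~> Y) : mono m <-> is_pullback m m (idm X) (idm X).
Proof.
split=> [mm|[_ pb] Z f g fg]; last first.
  by have [h [[<- <-] _]] := pb Z f g fg.
apply: pullbackP => // [Z x y /mm <-|Z f g /=]; last by rewrite !comp1m.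
by exists x; rewrite comp1m.
Qed.

(** Preservation of finite limits is defined through terminal objects, products and equalizers only;
    this equivalence, read in both directions, extends it to pullbacks. *)
Lemma pullback_equalizer (X Y B P Q : C) (f : X ~> B) (g : Y ~> B) (p : P ~> X)
    (q : P ~> Y) (r : Q ~> X) (s : Q ~> Y) (e : P ~> Q) :
  is_product r s -> r ∘ e = p -> s ∘ e = q ->
  (is_pullback f g p q <-> is_equalizer (f ∘ r) (g ∘ s) e).
Proof.
move=> rs re se; split=> [pb|eq].
  apply: equalizerP; first by rewrite -!compA re se; case: pb.
    move=> Z a b ab; apply: (pullback_jointly_monic pb) => /=.
      by rewrite -re -!compA ab.
    by rewrite -se -!compA ab.
  move=> Z z; rewrite -!compA => zfg; have [h [hr hs]] := pullback_pair pb zfg.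
  by exists h; apply: (product_jointly_monic rs); rewrite /= !compA ?re ?se.
apply: pullbackP; first by rewrite -re -se !compA; case: eq.
  move=> Z x y xy; have [z [zr zs]] := product_pair x y rs.
  have [|h hz] := @equalizer_fact _ _ _ _ _ _ _ z eq; first by rewrite -!compA zr zs.
  by exists h; rewrite -re -se -!compA hz.
move=> Z a b /=; rewrite -re -se -!compA => ra sa; apply: (equalizer_mono eq).
exact: (product_jointly_monic rs).
Qed.

Lemma regular_epi_comp_isol (X Y Z : C) (e : X ~> Y) (i : Y ~> Z) :
  regular_epi e -> is_iso i -> regular_epi (i ∘ e).
Proof.
move=> [W [a [b [ab eU]]]] [j [ji ij]]; exists W, a, b; split.
  by rewrite -!compA ab.
move=> T z zab; have [k [ke kU]] := eU T z zab.
exists (k ∘ j); split; first by rewrite -compA (compA j) ji comp1m.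
move=> k' k'E; rewrite (kU (k' ∘ i)) -?compA ?ij ?compm1 //.
Qed.

Lemma regular_epi_comp_isor (X Y Z : C) (e : Y ~> Z) (i : X ~> Y) :
  regular_epi e -> is_iso i -> regular_epi (e ∘ i).
Proof.
move=> [W [a [b [ab eU]]]] [j [ji ij]]; exists W, (j ∘ a), (j ∘ b); split.
  by rewrite -!compA !(compA i) ij !comp1m.
move=> T z; rewrite !compA => zab; have [k [ke kU]] := eU T (z ∘ j) zab.
exists k; split; first by rewrite compA ke -compA ji compm1.
by move=> k' k'E; apply: kU; rewrite -k'E -!compA ij compm1.
Qed.

Lemma regular_epi_id (X : C) : regular_epi (idm X).
Proof.
exists X, (idm X), (idm X); split=> // Z z _; exists z; split=> [|k]; rewrite compm1 //.
Qed.

(** After restriction along [m] the identity of [Y] factors through [m]; by descent it already does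
    so before, and [m] splits. *)
Lemma mono_regular_epi_iso (X Y : C) (m : X ~> Y) : mono m -> regular_epi m -> is_iso m.
Proof.
move=> mm re.
have [n mn] : idm Y ∈ Sub mm.
  by apply: (mem_descent re); exists (idm X); rewrite /= comp1m compm1.
exact: mono_split_iso mm mn.
Qed.

Lemma regular_epi_descent (X Y Z : C) (e : X ~> Y) (g : X ~> Z) : regular_epi e ->
  (forall T (a b : T ~> X), e ∘ a = e ∘ b -> g ∘ a = g ∘ b) ->
  exists h : Y ~> Z, h ∘ e = g.
Proof.
by move=> [W [a [b [ab eU]]]] /(_ W a b ab) gab; have [h [<- _]] := eU Z g gab; exists h.
Qed.

End CategoryFacts.

Lemma fmap_iso (C D : category) (F : functor C D) (X Y : C) (f : X ~> Y) :
  is_iso f -> is_iso (fmap F f).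
Proof. by move=> [g [gf fg]]; exists (fmap F g); rewrite -!fmapM gf fg !fmap1. Qed.

(** * Images and regular epimorphisms in a regular category *)

Section RegularCategory.
Variables (R : category) (reg : is_regular R).

(** Stated for a bare image factorization of [f], because it is applied to prove
    stability of regular epimorphisms. *)
Lemma regular_epi_of_comp_image (X Y Z : R) (f : Y ~> Z) (g : X ~> Y) :
  (exists (I : R) (e : Y ~> I) (m : I ~> Z), [/\ regular_epi e, mono m & f = m ∘ e]) ->
  regular_epi (f ∘ g) -> regular_epi f.
Proof.
move=> [I [e [m [re mm ->]]]] rfg.
have [n mn] : idm Z ∈ Sub mm.
  by apply: (mem_descent rfg); exists (e ∘ g); rewrite /= comp1m compA.
exact: regular_epi_comp_isol re (mono_split_iso mm mn).
Qed.

Lemma regular_epi_of_comp (X Y Z : R) (f : Y ~> Z) (g : X ~> Y) :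
  regular_epi (f ∘ g) -> regular_epi f.
Proof. exact: regular_epi_of_comp_image (regular_image reg f). Qed.

(** The identity of [Z], restricted along [f] and then [g], lies in the image of [f ∘ g]; two
    descents split the monomorphic part. *)
Lemma regular_epi_comp (X Y Z : R) (f : Y ~> Z) (g : X ~> Y) :
  regular_epi f -> regular_epi g -> regular_epi (f ∘ g).
Proof.
move=> rf rg; have [I [e [m [re mm fg]]]] := regular_image reg (f ∘ g).
have [n mn] : idm Z ∈ Sub mm.
  apply: (mem_descent rf); apply: (mem_descent rg).
  by exists e; rewrite /= comp1m.
by rewrite fg; apply: regular_epi_comp_isol re (mono_split_iso mm mn).
Qed.

(** Stability in Kripke-Joyal form: a regular epimorphism is locally surjective on generalized
    elements. *)
Lemma regular_epi_lift (X Y Z : R) (e : X ~> Y) (y : Z ~> Y) : regular_epi e ->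
  exists (Z' : R) (d : Z' ~> Z) (x : Z' ~> X), regular_epi d /\ e ∘ x = y ∘ d.
Proof.
move=> re; have [P [p [q pb]]] := pullback_exists (regular_finlim reg) e y.
by exists P, q, p; split; [apply: (regular_stable reg pb)|case: pb].
Qed.

Lemma image_exists (X Y : R) (f : X ~> Y) :
  exists (I : sub Y) (e : X ~> sub_dom I), regular_epi e /\ f = sub_arr I ∘ e.
Proof.
have [I [e [m [re mm fE]]]] := regular_image reg f.
by exists (Sub mm), e.
Qed.

Lemma image_mem (X Y : R) (f : X ~> Y) (I : sub Y) (e : X ~> sub_dom I) :
  regular_epi e -> f = sub_arr I ∘ e ->
  forall Z (y : Z ~> Y), y ∈ I <->
    exists (Z' : R) (d : Z' ~> Z) (x : Z' ~> X), regular_epi d /\ f ∘ x = y ∘ d.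
Proof.
move=> re fE Z y; split=> [[k <-]|[Z' [d [x [rd fx]]]]].
  have [Z' [d [x [rd ex]]]] := regular_epi_lift k re.
  by exists Z', d, x; rewrite fE -!compA ex.
by apply: (mem_descent rd); rewrite -fx fE -compA; exists (e ∘ x).
Qed.

End RegularCategory.

(** * Functors that preserve finite limits *)

Section FiniteLimits.
Variables (C D : category) (F : functor C D) (limC : has_finite_limits C).

Lemma preserves_pullback (X Y B P : C) (f : X ~> B) (g : Y ~> B) (p : P ~> X) (q : P ~> Y) :
  preserves_finite_limits F -> is_pullback f g p q ->
  is_pullback (fmap F f) (fmap F g) (fmap F p) (fmap F q).
Proof.
move=> limF pb; have [Q [r [s rs]]] := has_products limC X Y.
have [e [re se]] := product_pair p q rs.
apply/(pullback_equalizer _ _ (preserves_product limF rs) (e := fmap F e));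
  rewrite -?fmapM ?re ?se //.
by apply: preserves_equalizer => //; apply/(pullback_equalizer _ _ rs re se).
Qed.

Lemma preserves_mono (X Y : C) (m : X ~> Y) :
  preserves_finite_limits F -> mono m -> mono (fmap F m).
Proof.
move=> limF /mono_pullback /(preserves_pullback limF).
by rewrite fmap1 => /mono_pullback.
Qed.

(** Any two limits of a diagram are isomorphic, so one limit per diagram is enough. Below, limits of
    assemblies and of relations are known only in a particular presentation. *)
Lemma preserves_chosen_limits :
  (exists2 T : C, is_terminal T & is_terminal (F T)) ->
  (forall X Y : C, exists (P : C) (p : P ~> X) (q : P ~> Y),
    is_product p q /\ is_product (fmap F p) (fmap F q)) ->
  (forall (X Y : C) (f g : X ~> Y), exists (E : C) (e : E ~> X),
    is_equalizer f g e /\ is_equalizer (fmap F f) (fmap F g) (fmap F e)) ->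
  preserves_finite_limits F.
Proof.
move=> [T tT tFT] prod equ; split.
- move=> T' tT' Z.
  have [i _] := tT' T; have [h _] := tFT Z.
  exists (fmap F i ∘ h); split=> // k _.
  have [j _] := tT T'.
  have ij : i ∘ j = idm T' by apply: terminal_unique.
  rewrite -[k]comp1m -fmap1 -ij fmapM -compA; congr (_ ∘ _).
  exact: terminal_unique.
- move=> X Y P' p' q' pq'; have [P [p [q [pq Fpq]]]] := prod X Y.
  have [i [iI -> ->]] := product_iso pq pq'; rewrite !fmapM.
  exact: product_comp_iso (fmap_iso F iI).
- move=> X Y E' f g e' eq'; have [E [e [eq Feq]]] := equ X Y f g.
  have [i iI ->] := equalizer_iso eq eq'; rewrite fmapM.
  exact: equalizer_comp_iso (fmap_iso F iI).
Qed.

End FiniteLimits.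

(** * Right calculus of fractions for a class of monomorphisms *)

(** The usual cancellation axiom, that [w ∘ f = w ∘ g] implies [f ∘ v = g ∘ v] for some [v] in the
    class, follows from [fractions_mono], which gives [f = g] outright. *)
Record right_fractions (C : category) (W : hom_class C) : Prop := RightFractions {
  fractions_id : forall X : C, W _ _ (idm X);
  fractions_comp : forall (X Y Z : C) (g : Y ~> Z) (f : X ~> Y),
    W _ _ g -> W _ _ f -> W _ _ (g ∘ f);
  fractions_mono : forall (X Y : C) (w : X ~> Y), W _ _ w -> mono w;
  fractions_ore : forall (X Y Z : C) (w : X ~> Y) (f : Z ~> Y), W _ _ w ->
    exists (V : C) (v : V ~> Z) (g : V ~> X), W _ _ v /\ f ∘ v = w ∘ g
}.

Section Fractions.
Variables (C : category) (W : hom_class C) (fr : right_fractions W).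
Local Notation L := (loc_functor W).
Local Notation CW := (localization W).

Lemma common_refinement (X Y Z : C) (v : X ~> Z) (w : Y ~> Z) : W v -> W w ->
  exists (V : C) (a : V ~> X) (b : V ~> Y), v ∘ a = w ∘ b /\ W (v ∘ a).
Proof.
move=> Wv Ww; have [V [a [b [Wa ab]]]] := fractions_ore fr v Ww.
by exists V, a, b; split=> //; apply: fractions_comp fr _ _ _ _ _ Wv Wa.
Qed.

(** [loc_sem t f g] means that [t ∘ L f = L g] holds in the localization. *)
Fixpoint loc_sem (X Y : C) (t : loc_term W X Y) : forall T : C, (T ~> X) -> (T ~> Y) -> Prop :=
  match t with
  | loc_map _ _ h => fun T f g => exists (V : C) (v : V ~> T), W v /\ h ∘ f ∘ v = g ∘ v
  | loc_inv _ _ w _ => fun T f g => exists (V : C) (v : V ~> T), W v /\ f ∘ v = w ∘ g ∘ v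
  | loc_cat _ _ _ t s => fun T f g => exists (V : C) (v : V ~> T) k,
      [/\ W v, loc_sem s (f ∘ v) k & loc_sem t k (g ∘ v)]
  end.

Lemma loc_sem_comp (X Y : C) (t : loc_term W X Y) (T T' : C) (f : T ~> X) (g : T ~> Y)
    (a : T' ~> T) : loc_sem t f g -> loc_sem t (f ∘ a) (g ∘ a).
Proof.
elim: t T T' f g a => {X Y} /= [X Y h|X Y w _|X Y Z t IHt s IHs] T T' f g a.
- move=> [V [v [Wv hv]]]; have [V' [v' [a' [Wv' va]]]] := fractions_ore fr a Wv.
  by exists V', v'; split=> //; rewrite -!compA va !compA hv.
- move=> [V [v [Wv hv]]]; have [V' [v' [a' [Wv' va]]]] := fractions_ore fr a Wv.
  by exists V', v'; split=> //; rewrite -!compA va !compA hv.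
- move=> [V [v [k [Wv sk tk]]]]; have [V' [v' [a' [Wv' va]]]] := fractions_ore fr a Wv.
  exists V', v', (k ∘ a'); split=> //; rewrite -compA va compA; [exact: IHs|exact: IHt].
Qed.

Lemma loc_sem_local (X Y : C) (t : loc_term W X Y) (T V : C) (f : T ~> X) (g : T ~> Y)
    (v : V ~> T) : W v -> loc_sem t (f ∘ v) (g ∘ v) -> loc_sem t f g.
Proof.
case: t T V f g v => {X Y} /= [X Y h|X Y w _|X Y Z t s] T V f g v Wv.
- move=> [V' [v' [Wv' hv]]]; exists V', (v ∘ v'); split; last by rewrite !compA in hv *.
  exact: (fractions_comp fr).
- move=> [V' [v' [Wv' hv]]]; exists V', (v ∘ v'); split; last by rewrite !compA in hv *.
  exact: (fractions_comp fr).
- move=> [V' [v' [k [Wv' sk tk]]]]; exists V', (v ∘ v'), k; rewrite !compA; split=> //.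
  exact: (fractions_comp fr).
Qed.

(** Soundness of [loc_sem], the invariant through which an equation in the localization gives
    information about [C]. Monicity of [w] enters at [loc_invl], an Ore square against [w] at
    [loc_invr]. *)
Lemma loc_sem_eq (X Y : C) (s t : loc_term W X Y) : loc_eq s t ->
  forall T (f : T ~> X) (g : T ~> Y), loc_sem s f g <-> loc_sem t f g.
Proof.
have Wid := fractions_id fr; have Wcomp := fractions_comp fr.
elim=> {X Y s t}.
- by [].
- by move=> X Y s t _ IH T f g; rewrite IH.
- by move=> X Y r s t _ IH _ IH' T f g; rewrite IH IH'.
- move=> X Y Z t t' s s' _ IHt _ IHs T f g /=.
  by split=> -[V [v [k [Wv sk tk]]]]; exists V, v, k; split=> //; apply/IHs || apply/IHt.
- move=> X Y t T f g /=; split=> [[V [v [k [Wv tk [V' [v' [Wv' kv]]]]]]]|tfg].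
    rewrite comp1m in kv; apply: (loc_sem_local Wv); apply: (loc_sem_local Wv').
    by rewrite -kv; apply: loc_sem_comp.
  exists T, (idm T), g; rewrite !compm1; split=> //.
  by exists T, (idm T); rewrite comp1m.
- move=> X Y t T f g /=; split=> [[V [v [k [Wv [V' [v' [Wv' kv]]] tk]]]]|tfg].
    rewrite comp1m in kv; apply: (loc_sem_local Wv); apply: (loc_sem_local Wv').
    by rewrite kv; apply: loc_sem_comp.
  exists T, (idm T), f; rewrite !compm1; split=> //.
  by exists T, (idm T); rewrite comp1m.
- move=> X Y Z U t s r T f g /=; split.
    move=> [V [v [k [Wv [V' [v' [k' [Wv' rk sk]]]] tk]]]].
    exists V', (v ∘ v'), k'; rewrite compA; split=> //; first exact: Wcomp.
    exists V', (idm V'), (k ∘ v'); rewrite !compm1; split=> //.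
    by rewrite compA; apply: loc_sem_comp.
  move=> [V [v [k [Wv rk [V' [v' [k' [Wv' sk tk]]]]]]]].
  exists V', (v ∘ v'), k'; split; [exact: Wcomp| |by rewrite compA].
  exists V', (idm V'), (k ∘ v'); rewrite !compm1; split=> //.
  by rewrite compA; apply: loc_sem_comp.
- move=> X Y Z h h' T f g /=; split.
    move=> [V [v [Wv gv]]]; exists V, v, (h' ∘ f ∘ v); split=> //.
      by exists V, (idm V); split; rewrite ?compA.
    by exists V, (idm V); split; rewrite // !compm1 -gv !compA.
  move=> [V [v [k [Wv [V1 [v1 [Wv1 e1]]] [V2 [v2 [Wv2 e2]]]]]]].
  have [V3 [a [b [ab Wab]]]] := common_refinement Wv1 Wv2.
  exists V3, (v ∘ (v1 ∘ a)); split; first exact: Wcomp.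
  have e1' : h' ∘ f ∘ v ∘ (v1 ∘ a) = k ∘ (v1 ∘ a) by rewrite !compA in e1 *; rewrite e1.
  have e2' : h ∘ k ∘ (v1 ∘ a) = g ∘ v ∘ (v1 ∘ a) by rewrite ab !compA in e2 *; rewrite e2.
  by move: e1' e2'; rewrite -!compA => -> ->.
- move=> X Y w Ww T f g /=; have mw := fractions_mono fr Ww; split.
    move=> [V [v [k [Wv [V1 [v1 [Wv1 e1]]] [V2 [v2 [Wv2 e2]]]]]]].
    have [V3 [a [b [ab Wab]]]] := common_refinement Wv1 Wv2.
    exists V3, (v ∘ (v1 ∘ a)); split; first exact: Wcomp.
    have e1' : w ∘ f ∘ v ∘ (v1 ∘ a) = k ∘ (v1 ∘ a) by rewrite !compA in e1 *; rewrite e1.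
    have e2' : k ∘ (v1 ∘ a) = w ∘ g ∘ v ∘ (v1 ∘ a) by rewrite ab !compA in e2 *; rewrite e2.
    by rewrite comp1m; apply: mw; move: e1' e2'; rewrite -!compA => -> ->.
  rewrite comp1m => -[V [v [Wv fg]]]; exists V, v, (w ∘ f ∘ v); split=> //.
    by exists V, (idm V); split; rewrite ?compA.
  by exists V, (idm V); split; rewrite // !compm1 -!compA fg.
- move=> X Y w Ww T f g /=; split.
    move=> [V [v [k [Wv [V1 [v1 [Wv1 e1]]] [V2 [v2 [Wv2 e2]]]]]]].
    have [V3 [a [b [ab Wab]]]] := common_refinement Wv1 Wv2.
    exists V3, (v ∘ (v1 ∘ a)); split; first exact: Wcomp.
    have e1' : f ∘ v ∘ (v1 ∘ a) = w ∘ k ∘ (v1 ∘ a) by rewrite !compA in e1 *; rewrite e1.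
    have e2' : w ∘ k ∘ (v1 ∘ a) = g ∘ v ∘ (v1 ∘ a) by rewrite ab !compA in e2 *; rewrite e2.
    by rewrite comp1m; move: e1' e2'; rewrite -!compA => -> ->.
  rewrite comp1m => -[V [v [Wv fg]]].
  have [V' [v' [k [Wv' kE]]]] := fractions_ore fr (f ∘ v) Ww.
  exists V', (v ∘ v'), k; split; first exact: Wcomp.
    by exists V', (idm V'); split; rewrite // !compm1 -kE compA.
  by exists V', (idm V'); split; rewrite // !compm1 -kE fg compA.
Qed.

(** [loc_sem] relates [idm X] to [g] along the term of [g], hence also along the term of [f];
    unfolding the latter gives the equalizing [v]. *)
Lemma loc_map_eq (X Y : C) (f g : X ~> Y) :
  fmap L f = fmap L g -> exists (V : C) (v : V ~> X), W v /\ f ∘ v = g ∘ v.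
Proof.
move=> /loc_piP /loc_sem_eq /(_ X (idm X) g) [_ []] /=.
  by exists X, (idm X); split; [exact: fractions_id|rewrite compm1].
by move=> V [v]; rewrite compm1; exists V, v.
Qed.

(** The inverse of [w] is the roof with legs [w] and the identity, and roofs compose by an Ore
    square. *)
Lemma loc_roof (X Y : C) (f : hom (c := CW) X Y) :
  exists (V : C) (v : V ~> X) (g : V ~> Y), W v /\ f ∘ fmap L v = fmap L g.
Proof.
rewrite -(loc_reprK f); elim: (loc_repr f) => {X Y f} [X Y f|X Y w Ww|X Y Z g IHg f IHf].
- by exists X, (idm X), f; split; [exact: fractions_id|rewrite fmap1 compm1].
- exists X, w, (idm X); split=> //=; rewrite loc_comp_pi.
  by apply/loc_piP; apply: loc_invl.
have [V [v [f' [Wv fv]]]] := IHf; have [V' [v' [g' [Wv' gv]]]] := IHg.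
have [T [t [f'' [Wt ft]]]] := fractions_ore fr f' Wv'.
exists T, (v ∘ t), (g' ∘ f''); split; first exact: (fractions_comp fr).
have -> : loc_pi (loc_cat g f) = comp (c := CW) (loc_pi g) (loc_pi f).
  by rewrite /= loc_comp_pi.
rewrite (fmapM L v) (fmapM L g') -gv -!compA; congr (_ ∘ _).
by rewrite compA fv -!fmapM ft.
Qed.

Lemma loc_iso (X Y : C) (w : X ~> Y) : W w -> is_iso (fmap L w).
Proof. exact: loc_functor_iso. Qed.

Lemma loc_iso_cancel (X Y Z : C) (w : X ~> Y) (f g : hom (c := CW) Y Z) :
  W w -> f ∘ fmap L w = g ∘ fmap L w -> f = g.
Proof.
move=> /loc_iso [i [_ wi]] fg.
by rewrite -(compm1 f) -(compm1 g) -wi !compA fg.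
Qed.

Lemma loc_roof2 (X Y Z : C) (f : hom (c := CW) X Y) (g : hom (c := CW) X Z) :
  exists (V : C) (v : V ~> X) f' g',
    [/\ W v, f ∘ fmap L v = fmap L f' & g ∘ fmap L v = fmap L g'].
Proof.
have [V1 [v1 [f' [Wv1 fv]]]] := loc_roof f; have [V2 [v2 [g' [Wv2 gv]]]] := loc_roof g.
have [V [a [b [ab Wab]]]] := common_refinement Wv1 Wv2.
exists V, (v1 ∘ a), (f' ∘ a), (g' ∘ b); split=> //.
  by rewrite !fmapM compA fv.
by rewrite ab !fmapM compA gv.
Qed.

(** Two parallel morphisms have roofs with a common left leg, so that the equation becomes one
    between arrows of [C], up to one more refinement. *)
Lemma loc_mono (X Y : C) (m : X ~> Y) : mono m -> mono (fmap L m).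
Proof.
move=> mm Z f g fg; have [V [v [f' [g' [Wv fv gv]]]]] := loc_roof2 f g.
have : fmap L (m ∘ f') = fmap L (m ∘ g') by rewrite !fmapM -fv -gv !compA fg.
move=> /loc_map_eq [V' [v' [Wv']]]; rewrite -!compA => /mm fgv.
apply: (loc_iso_cancel Wv); rewrite fv gv; apply: (loc_iso_cancel Wv').
by rewrite -!fmapM fgv.
Qed.

Lemma loc_jointly_monic (X Y P : C) (p : P ~> X) (q : P ~> Y) :
  jointly_monic (Span p q) -> jointly_monic (Span (fmap L p) (fmap L q)).
Proof.
move=> jm Z f g; rewrite ![lleg _]/(fmap L p) ![rleg _]/(fmap L q) => pfg qfg.
have [V [v [f' [g' [Wv fv gv]]]]] := loc_roof2 f g.
have : fmap L (p ∘ f') = fmap L (p ∘ g') by rewrite !fmapM -fv -gv !compA pfg.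
have : fmap L (q ∘ f') = fmap L (q ∘ g') by rewrite !fmapM -fv -gv !compA qfg.
move=> /loc_map_eq [V1 [v1 [Wv1 e1]]] /loc_map_eq [V2 [v2 [Wv2 e2]]].
have [V' [a [b [ab Wab]]]] := common_refinement Wv1 Wv2.
have fgv : f' ∘ (v1 ∘ a) = g' ∘ (v1 ∘ a).
  by apply: jm => /=; [rewrite ab !compA e2|rewrite !compA e1].
apply: (loc_iso_cancel Wv); rewrite fv gv; apply: (loc_iso_cancel Wab).
by rewrite -!fmapM fgv.
Qed.

Lemma loc_terminal (T : C) : is_terminal T -> is_terminal (L T).
Proof.
move=> tT Z; have [h _] := tT Z; exists (fmap L h); split=> // k _.
have [V [v [k' [Wv kv]]]] := loc_roof k.
apply: (loc_iso_cancel Wv); rewrite -fmapM kv; congr (fmap L _).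
exact: terminal_unique.
Qed.

Lemma loc_fill (Z V X : C) (v : V ~> Z) (k : V ~> X) : W v ->
  exists h : hom (c := CW) Z X, h ∘ fmap L v = fmap L k.
Proof.
move=> /loc_iso [i [iv _]]; exists (fmap L k ∘ i).
by rewrite -compA iv compm1.
Qed.

Lemma loc_product (X Y P : C) (p : P ~> X) (q : P ~> Y) :
  is_product p q -> is_product (fmap L p) (fmap L q).
Proof.
move=> pq; apply: productP; last exact/loc_jointly_monic/product_jointly_monic.
move=> Z f g; have [V [v [f' [g' [Wv fv gv]]]]] := loc_roof2 f g.
have [k [pk qk]] := product_pair f' g' pq; have [h hv] := loc_fill k Wv.
exists h; split; apply: (loc_iso_cancel Wv); rewrite -compA hv -fmapM.
  by rewrite pk.
by rewrite qk.
Qed.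

Lemma loc_equalizer (X Y E : C) (f g : X ~> Y) (e : E ~> X) :
  is_equalizer f g e -> is_equalizer (fmap L f) (fmap L g) (fmap L e).
Proof.
move=> eq; apply: equalizerP; first by rewrite -!fmapM (proj1 eq).
  exact: loc_mono (equalizer_mono eq).
move=> Z z zfg; have [V [v [z' [Wv zv]]]] := loc_roof z.
have : fmap L (f ∘ z') = fmap L (g ∘ z') by rewrite !fmapM -zv !compA zfg.
move=> /loc_map_eq [V' [v' [Wv']]]; rewrite -!compA => fgz.
have [k ek] := equalizer_fact eq fgz.
have [h hv] := loc_fill k (fractions_comp fr Wv Wv'); exists h.
apply: (loc_iso_cancel (fractions_comp fr Wv Wv')).
by rewrite -compA hv -fmapM ek !fmapM compA zv.
Qed.

Lemma loc_preserves_finite_limits : preserves_finite_limits L.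
Proof.
split; [exact: loc_terminal|exact: loc_product|exact: loc_equalizer].
Qed.

(** A parallel pair in the localization comes from [C] only after composition with an isomorphism,
    the common left leg of two roofs. *)
Lemma equalizer_transport (D : category) (X' X Y E : D) (i : X' ~> X) (f g : X ~> Y)
    (f' g' : X' ~> Y) (e : E ~> X') : is_iso i -> f ∘ i = f' -> g ∘ i = g' ->
  is_equalizer f' g' e -> is_equalizer f g (i ∘ e).
Proof.
move=> iI fi gi eq; have [j [ji ij]] := iI; apply: equalizerP.
- by rewrite !compA fi gi (proj1 eq).
- exact: mono_comp (iso_mono iI) (equalizer_mono eq).
move=> Z z fgz; have [|h hz] := @equalizer_fact _ _ _ _ _ _ _ _ (j ∘ z) eq.
  by rewrite -fi -gi -!compA !(compA i) ij comp1m.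
by exists h; rewrite -compA hz compA ij comp1m.
Qed.

Hypothesis limC : has_finite_limits C.

Lemma localization_has_finite_limits : has_finite_limits CW.
Proof.
split.
- by have [T tT] := has_terminal limC; exists T; apply: loc_terminal.
- move=> X Y; have [P [p [q pq]]] := has_products limC X Y.
  by exists P, (fmap L p), (fmap L q); apply: loc_product.
- move=> X Y f g; have [V [v [f' [g' [Wv fv gv]]]]] := loc_roof2 f g.
  have [E [e eq]] := has_equalizers limC f' g'.
  exists E, (fmap L v ∘ fmap L e).
  exact: equalizer_transport (loc_iso Wv) fv gv (loc_equalizer eq).
Qed.

Lemma loc_lift_preserves_finite_limits (D : category) (G : functor C D)
    (inv : forall (X Y : C) (w : X ~> Y), W w -> is_iso (fmap G w)) :
  preserves_finite_limits G -> preserves_finite_limits (loc_lift inv).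
Proof.
move=> limG; apply: preserves_chosen_limits.
- have [T tT] := has_terminal limC; exists T; first exact: loc_terminal.
  exact: (preserves_terminal limG).
- move=> X Y; have [P [p [q pq]]] := has_products limC X Y.
  exists P, (fmap L p), (fmap L q); split; first exact: loc_product.
  by rewrite !loc_liftE; exact: (preserves_product limG).
- move=> X Y f g; have [V [v [f' [g' [Wv fv gv]]]]] := loc_roof2 f g.
  have [E [e eq]] := has_equalizers limC f' g'.
  exists E, (fmap L v ∘ fmap L e); split.
    exact: equalizer_transport (loc_iso Wv) fv gv (loc_equalizer eq).
  have tr h h' : h ∘ fmap L v = fmap L h' ->
      fmap (loc_lift inv) h ∘ fmap (loc_lift inv) (fmap L v) = fmap (loc_lift inv) (fmap L h').
    by rewrite -fmapM => ->.
  rewrite fmapM; apply: (equalizer_transport _ (tr _ _ _ fv) (tr _ _ _ gv)).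
    exact/fmap_iso/loc_iso.
  by rewrite !loc_liftE; exact: (preserves_equalizer limG).
Qed.

End Fractions.

(** * Combinatory terms and their realizers *)

(** Syntax for combinatory functions: by [cterm_pfun] a realizer can be specified by a term, with no
    construction of domains as in [composition_pfun]. *)
Inductive cterm := CVar of nat | CApp of cterm & cterm.

Fixpoint cclosed (n : nat) (t : cterm) : bool :=
  match t with
  | CVar i => (i < n)%N
  | CApp s t => cclosed n s && cclosed n t
  end.

Fixpoint ceval (C : category) (A : opas_data C) (Z : C) (t : cterm) (env : seq (Z ~> A))
    (v : Z ~> A) : Prop :=
  match t with
  | CVar i => onth env i = Some v
  | CApp s t => exists u w, [/\ ceval s env u, ceval t env w & app u w v]
  end.

Section Terms.
Variables (H : heyting_category) (A : opas H).
Let reg := heyting_regular (hcatP H).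
Let lim := regular_finlim reg.

(** The object [A^n]: it is the domain of the projections, and the domains of two partial functions
    are compared over it. *)
Lemma power_exists (n : nat) : exists (P : H) (pi : 'I_n -> (P ~> A)),
  (forall Z (x : n.-tuple (Z ~> A)), exists k, forall i, pi i ∘ k = tnth x i) /\
  (forall Z (f g : Z ~> P), (forall i, pi i ∘ f = pi i ∘ g) -> f = g).
Proof.
elim: n => [|n [P [pi [piP piU]]]].
  have [T tT] := has_terminal lim.
  exists T, (fun i : 'I_0 => match i with Ordinal _ lt => False_rect _ (notF lt) end).
  split=> [Z x|Z f g _]; last exact: terminal_unique.
  by have [k _] := tT Z; exists k => -[].
have [Q [a [p ap]]] := has_products lim (A : H) P.
exists Q, (fun i => if unlift ord0 i is Some j then pi j ∘ p else a).
split=> [Z x|Z f g fg].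
  case/tupleP: x => x xs; have [k kx] := piP Z xs.
  have [h [ha hp]] := product_pair x k ap; exists h => i.
  case: unliftP => [j|] ->; last by rewrite tnth0.
  by rewrite tnthS -compA hp kx.
apply: (product_jointly_monic ap) => /=.
  by have := fg ord0; rewrite unlift_none.
apply: piU => i; have := fg (lift ord0 i).
by rewrite liftK !compA.
Qed.

(** For an application the domain is the pullback over [A^n] of the two domains, cut down to the
    points where the two values can be applied. *)
Lemma cterm_pfun (n : nat) (t : cterm) : cclosed n t ->
  exists f : pfun A n, combinatory f /\
    forall Z (x : n.-tuple (Z ~> A)) (v : Z ~> A), graph f x v <-> ceval t x v.
Proof.
have [P [pi [piP piU]]] := power_exists n.
elim: t => [i lt_in|s IHs t IHt /= /andP[/IHs [f [cf fP]] /IHt [g [cg gP]]]].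
  have ev Z (x : n.-tuple (Z ~> A)) v :
      ceval (CVar i) x v <-> v = tnth x (Ordinal lt_in).
    rewrite /= (tnth_nth v) /=; have lt : (i < size x)%N by rewrite size_tuple.
    rewrite onthE (nth_map v) //.
    by split=> [[vE]|vE]; [rewrite vE|rewrite -vE].
  have gr Z (x : n.-tuple (Z ~> A)) v :
      graph (Pfun (pi (Ordinal lt_in)) piU) x v <-> v = tnth x (Ordinal lt_in).
    split=> [[k [xk ->]]|->] /=; first by rewrite xk.
    by have [k kx] := piP Z x; exists k; split=> [j|]; rewrite /= kx.
  exists (Pfun (pi (Ordinal lt_in)) piU); split; first exact: combinatory_proj gr.
  by move=> Z x v; rewrite gr ev.
have [kf kfP] := piP _ [tuple parg f i | i < n].
have [kg kgP] := piP _ [tuple parg g i | i < n].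
have [Q [q1 [q2 pb]]] := pullback_exists lim kf kg.
have [E [j [d [mj dl dr dU]]]] :=
  span_preimage lim (pval f ∘ q1) (pval g ∘ q2) (odom_jointly_monic (opasP A)).
have q12 i : parg f i ∘ q1 = parg g i ∘ q2.
  have := kfP i; have := kgP i; rewrite !tnth_mktuple => <- <-.
  by rewrite -!compA (proj1 pb).
have jm Z (a b : Z ~> E) :
    (forall i, parg f i ∘ q1 ∘ j ∘ a = parg f i ∘ q1 ∘ j ∘ b) -> a = b.
  move=> ab; apply: mj; apply: (pullback_jointly_monic pb) => /=.
    by apply: parg_jointly_monic => i; rewrite !compA ab.
  by apply: parg_jointly_monic => i; rewrite !compA -q12 ab.
pose h := Pfun (oapp A ∘ d) jm.
have hP Z (x : n.-tuple (Z ~> A)) (v : Z ~> A) :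
    graph h x v <-> exists u w, [/\ graph f x u, graph g x w & app u w v].
  split=> [[k [xk ->]]|[u [w [[k [xk ->]] [l [xl ->]] [c [cu cw cv]]]]]].
    exists (pval f ∘ (q1 ∘ j ∘ k)), (pval g ∘ (q2 ∘ j ∘ k)); split.
    - by exists (q1 ∘ j ∘ k); split=> // i; rewrite xk /= !compA.
    - by exists (q2 ∘ j ∘ k); split=> // i; rewrite xk /= q12 !compA.
    - by exists (d ∘ k); rewrite !compA dl dr.
  have [|z [zk zl]] := @pullback_pair _ _ _ _ _ _ _ _ _ _ k l pb.
    apply: piU => i; have := kfP i; have := kgP i; rewrite !tnth_mktuple !compA => -> ->.
    by rewrite -xk -xl.
  have [||m mz dm] := dU Z z c; rewrite -?compA ?zk ?zl //.
  exists m; split=> [i|] /=; last by rewrite -compA dm.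
  by rewrite -!compA mz zk.
exists h; split; first exact: combinatory_app cf cg hP.
move=> Z x v; rewrite hP; split=> -[u [w [su tw uwv]]];
  by exists u, w; split=> //; apply/fP || apply/gP.
Qed.

Lemma apps_cat (Z : H) (r v : Z ~> A) (s s' : seq (Z ~> A)) :
  apps r (s ++ s') v <-> exists2 w, apps r s w & apps w s' v.
Proof.
elim: s r => [|x s IH] r /=; first by split=> [?|[w ->]] //; exists r.
split=> [[w rw /IH [w' ww' wv]]|[w [w' rw' ww'] wv]].
  by exists w' => //; exists w.
by exists w' => //; apply/IH; exists w.
Qed.

Lemma apps_fun (Z : H) (r v w : Z ~> A) (s : seq (Z ~> A)) :
  apps r s v -> apps r s w -> v = w.
Proof.
elim: s r => [|x s IH] r /=; first by move=> -> ->.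
move=> [u ru uv] [u' ru' uw]; rewrite (app_fun ru' ru) in uw.
exact: IH uv uw.
Qed.

Lemma apps_comp (Z Z' : H) (h : Z' ~> Z) (r v : Z ~> A) (s : seq (Z ~> A)) :
  apps r s v -> apps (r ∘ h) [seq x ∘ h | x <- s] (v ∘ h).
Proof.
elim: s r => [|x s IH] r /=; first by move=> ->.
by move=> [u ru /IH uv]; exists (u ∘ h) => //; apply: app_comp.
Qed.

Lemma realizes_apps (n : nat) (f : pfun A n.+1) (Z : H) (r : Z ~> A) (s : seq (Z ~> A)) :
  realizes f r -> (size s <= n)%N -> exists v, apps r s v.
Proof.
move=> /(_ Z (idm Z)) [def _] le_sn.
(* [realizes] promises definedness for exactly [n] arguments. The list is padded with copies of [r],
   an element of [A] that is at hand, and the result is cut back with [apps_cat]. *)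
have sz : size (s ++ nseq (n - size s) r) == n by rewrite size_cat size_nseq subnKC.
have [v] := def (Tuple sz); rewrite compm1 /= => /apps_cat [w rw _].
by exists w.
Qed.

Fixpoint all_mem (Z : H) (us : seq (Z ~> A)) (Us : seq (sub A)) : Prop :=
  match us, Us with
  | u :: us, U :: Us => u ∈ U /\ all_mem us Us
  | [::], [::] => True
  | _, _ => False
  end.

Lemma all_mem_size (Z : H) (us : seq (Z ~> A)) (Us : seq (sub A)) :
  all_mem us Us -> size us = size Us.
Proof. by elim: us Us => [|u us IH] [|U Us] //= [_ /IH ->]. Qed.

Lemma all_mem_rcons (Z : H) (us : seq (Z ~> A)) (Us : seq (sub A)) (u : Z ~> A) (U : sub A) :
  all_mem us Us -> u ∈ U -> all_mem (rcons us u) (rcons Us U).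
Proof. by elim: us Us => [|v us IH] [|V Us] //= [? /IH uU] /uU. Qed.

Lemma all_mem1 (Z : H) (us : seq (Z ~> A)) (U : sub A) :
  all_mem us [:: U] -> exists2 u, us = [:: u] & u ∈ U.
Proof. by case: us => [|u [|? ?]] //= [] // uU _; exists u. Qed.

Lemma all_mem2 (Z : H) (us : seq (Z ~> A)) (U V : sub A) :
  all_mem us [:: U; V] -> exists u v, [/\ us = [:: u; v], u ∈ U & v ∈ V].
Proof. by case: us => [|u us] //= [uU /all_mem1 [v -> vV]]; exists u, v. Qed.

Lemma all_mem3 (Z : H) (us : seq (Z ~> A)) (U V W : sub A) :
  all_mem us [:: U; V; W] ->
  exists u v w, [/\ us = [:: u; v; w], u ∈ U, v ∈ V & w ∈ W].
Proof. by case: us => [|u us] //= [uU /all_mem2 [v [w [-> vV wW]]]]; exists u, v, w. Qed.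

End Terms.

(** * Members of the external filter that realize combinatory terms *)

Section ExternalFilter.
Variables (H : heyting_category) (A : opas H) (phi : external_filter A).
Hypothesis cc : combinatory_complete phi.
Let reg := heyting_regular (hcatP H).
Let OA := opasP A.

Fixpoint all_ext (Us : seq (sub A)) : Prop :=
  if Us is U :: Us then phi U /\ all_ext Us else True.

Lemma all_ext_rcons (Us : seq (sub A)) (U : sub A) :
  all_ext (rcons Us U) -> all_ext Us /\ phi U.
Proof. by elim: Us => [[]|V Us IH] //= [pV /IH []]. Qed.

(** [W] is the application of [realizers f] to the members of [Us], associated to the left, whence
    the induction from the end of the list. It is defined because a realizer of an [n.+1]-ary
    function accepts [n] arguments unconditionally. *)
Lemma partial_realizers (n : nat) (f : pfun A n.+1) (Us : seq (sub A)) :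
  combinatory f -> all_ext Us -> (size Us <= n)%N ->
  exists W, phi W /\ forall Z (w : Z ~> A), w ∈ W ->
    exists (Z' : H) (e : Z' ~> Z) us r v,
      [/\ regular_epi e, all_mem us Us, realizes f r, apps r us v & le (w ∘ e) v].
Proof.
move=> cf; elim/last_ind: Us => [_ _|Us U IH /all_ext_rcons [pUs pU]].
  exists (realizers f); split; first exact: cc.
  move=> Z w /realizersP wf; exists Z, (idm Z), [::], w, w; rewrite compm1.
  by split=> //; [exact: regular_epi_id|exact: ole_refl].
rewrite size_rcons => lt_n; have [W [phiW WP]] := IH pUs (ltnW lt_n).
have def Z us r v y : all_mem us Us -> realizes f r -> @apps _ A Z r us v ->
    exists2 t, app v y t & apps r (rcons us y) t.
  move=> /all_mem_size sz rf rv; have [|t] := realizes_apps (s := rcons us y) rf.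
    by rewrite size_rcons sz.
  rewrite -cats1 => /[dup] rt /apps_cat [v' /(apps_fun rv) <- [t' vt' tE]].
  rewrite tE in rt; exists t'; rewrite -?cats1 //.
exists (app_sub W U); split.
  apply: ext_app => // Z x y xW yU.
  have [Z' [e [us [r [v [re usUs rf rv xv]]]]]] := WP Z x xW.
  apply: (rel_mem_descent (odom_jointly_monic OA) re).
  have [t vt _] := def _ _ _ _ (y ∘ e) usUs rf rv.
  have [s xs _] := oapp_le OA xv (ole_refl OA (y ∘ e)) vt.
  exact: app_dom xs.
move=> Z w /app_subP [Z1 [e1 [re1 [x [y [s [xW yU xys ws]]]]]]].
have [Z2 [e2 [us [r [v [re2 usUs rf rv xv]]]]]] := WP Z1 x xW.
have [t vt rt] := def _ _ _ _ (y ∘ e2) usUs rf rv.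
have [s' xs' st] := oapp_le OA xv (ole_refl OA (y ∘ e2)) vt.
exists Z2, (e1 ∘ e2), (rcons us (y ∘ e2)), r, t; split=> //.
- exact: (regular_epi_comp reg).
- by apply: all_mem_rcons => //; apply: mem_comp.
apply: (ole_trans OA) st; rewrite compA.
by rewrite -(app_fun (app_comp e2 xys) xs'); apply: rel_mem_comp.
Qed.

(** The elements of [W] locally act as [λa. t(u_1, ..., u_n, a)] for some
    [u_i ∈ U_i]. *)
Lemma term_realizers (Us : seq (sub A)) (t : cterm) :
  all_ext Us -> cclosed (size Us).+1 t ->
  exists W, phi W /\ forall Z (w a : Z ~> A), w ∈ W ->
    exists (Z' : H) (e : Z' ~> Z) us, [/\ regular_epi e, all_mem us Us &
      forall (Z'' : H) (h : Z'' ~> Z') v,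
        ceval t (rcons [seq u ∘ h | u <- us] (a ∘ e ∘ h)) v ->
        exists2 d, app (w ∘ e ∘ h) (a ∘ e ∘ h) d & le d v].
Proof.
move=> pUs ct; have [f [cf fP]] := cterm_pfun A ct.
have [W [phiW WP]] := partial_realizers cf pUs (leqnn _).
exists W; split=> // Z w a wW.
have [Z' [e [us [r [v [re usUs rf rv wv]]]]]] := WP Z w wW.
exists Z', e, us; split=> // Z'' h z tz.
have sz : size (rcons [seq u ∘ h | u <- us] (a ∘ e ∘ h)) == (size Us).+1.
  by rewrite size_rcons size_map (all_mem_size usUs).
have [z'] := proj2 (rf Z'' h) (Tuple sz) z (proj2 (fP _ (Tuple sz) _) tz).
rewrite /= -cats1 => /apps_cat [v' /(apps_fun (apps_comp h rv)) <- [z'' vz ->]] zz.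
have [d wd dz] := oapp_le OA (rel_mem_comp h wv) (ole_refl OA _) vz.
by exists d => //; apply: (ole_trans OA) zz.
Qed.

(** Since [tracked] descends along regular epimorphisms, a term may be evaluated
    locally. *)
Lemma tracked_local_term (P Q : rel_object A) (f : robase P ~> robase Q)
    (Us : seq (sub A)) (t : cterm) :
  all_ext Us -> cclosed (size Us).+1 t ->
  (forall Z us (a : Z ~> A) (x : Z ~> robase P), all_mem us Us -> ⟨a, x⟩ ∈ rorel P ->
     exists (Z' : H) (e : Z' ~> Z) v, [/\ regular_epi e,
       ceval t (rcons [seq u ∘ e | u <- us] (a ∘ e)) v &
       ⟨v, f ∘ x ∘ e⟩ ∈ rorel Q]) ->
  tracked phi f.
Proof.
move=> pUs ct tP; have [W [phiW WP]] := term_realizers pUs ct.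
exists W; split=> // Z w a x wW ax.
have [Z' [e [us [re usUs wt]]]] := WP Z w a wW.
have [Z'' [e' [v [re' tv vf]]]] := tP _ _ _ _ usUs (rel_mem_comp e ax).
have [d wd dv] := wt _ _ _ tv.
have ree : regular_epi (e ∘ e') by apply: (regular_epi_comp reg).
rewrite -!compA in wd.
have /app_definedP [d' wd'] : app_defined w a.
  by apply: (rel_mem_descent (odom_jointly_monic OA) ree); apply: app_dom wd.
exists d' => //; apply: (rel_mem_descent (@rorel_jointly_monic _ _ Q) ree).
rewrite (app_fun (app_comp (e ∘ e') wd') wd); apply: rorel_down dv _.
by rewrite -!compA in vf *.
Qed.

(** In [t] the variables below [size Us] stand for elements of the members of [Us], in order, and
    the variable [size Us] for the code [a]. *)
Lemma tracked_term (P Q : rel_object A) (f : robase P ~> robase Q)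
    (Us : seq (sub A)) (t : cterm) :
  all_ext Us -> cclosed (size Us).+1 t ->
  (forall Z us (a : Z ~> A) (x : Z ~> robase P), all_mem us Us -> ⟨a, x⟩ ∈ rorel P ->
     exists2 v, ceval t (rcons us a) v & ⟨v, f ∘ x⟩ ∈ rorel Q) ->
  tracked phi f.
Proof.
move=> pUs ct tP; apply: (tracked_local_term pUs ct) => Z us a x usUs ax.
have [v tv vf] := tP _ _ _ _ usUs ax; exists Z, (idm Z), v.
rewrite !compm1; split=> //; first exact: regular_epi_id.
by rewrite (eq_map (g := id)) ?map_id // => u; rewrite compm1.
Qed.

(** Pairing [c = r a b] with projections [c k1 ≤ a] and [c k2 ≤ b]. *)
Lemma pairing_exists : exists R K1 K2, [/\ phi R, phi K1, phi K2 &
  forall Z (r a b : Z ~> A), r ∈ R -> exists w c, [/\ app r a w, app w b c,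
    forall k, k ∈ K1 -> exists2 d, app c k d & le d a &
    forall k, k ∈ K2 -> exists2 d, app c k d & le d b]].
Proof.
(* Church pairs: [k1] and [k2] are the two binary projections and [r] sends [a], [b], [k] to
   [k a b]. *)
have [k1 [ck1 k1P]] := @cterm_pfun H A 2 (CVar 0) isT.
have [k2 [ck2 k2P]] := @cterm_pfun H A 2 (CVar 1) isT.
have [r [cr rP]] := @cterm_pfun H A 3 (CApp (CApp (CVar 2) (CVar 0)) (CVar 1)) isT.
exists (realizers r), (realizers k1), (realizers k2); split; try exact: cc.
move=> Z q a b /realizersP qr.
have [v [w qw [c wc _]]] := realizes_apps (s := [:: a; b]) qr isT.
have main k d d' : app k a d -> app d b d' -> exists2 d, app c k d & le d d'.
  move=> kd dd; have [_ def] := qr Z (idm Z).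
  have /def [t] : graph r [tuple a; b; k] d'.
    by apply/rP => /=; exists d, b; split=> //; exists k, a.
  rewrite compm1 => -[w' /(app_fun qw) <- [c' /(app_fun wc) <- [t' ct ->]]].
  by exists t'.
exists w, c; split=> // k /realizersP kk.
  have [_ def] := kk Z (idm Z).
  have /def [t] : graph k1 [tuple a; b] a by apply/k1P.
  rewrite compm1 => -[d kd [d' dd ->]] da.
  have [e ce ed] := main k d d' kd dd; exists e => //.
  exact: (ole_trans OA) da.
have [_ def] := kk Z (idm Z).
have /def [t] : graph k2 [tuple a; b] b by apply/k2P.
rewrite compm1 => -[d kd [d' dd ->]] db.
have [e ce ed] := main k d d' kd dd; exists e => //.
exact: (ole_trans OA) db.
Qed.

End ExternalFilter.

(** * The realizability fibration as a regular fibration *)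

Section Spans.
Variable (H : heyting_category).
Let reg := heyting_regular (hcatP H).
Let lim := regular_finlim reg.

Lemma image_span_exists (E X Y : H) (f : E ~> X) (g : E ~> Y) :
  exists (S : span X Y) (q : E ~> tip S),
    [/\ jointly_monic S, regular_epi q, lleg S ∘ q = f & rleg S ∘ q = g].
Proof.
have [P [p1 [p2 p12]]] := has_products lim X Y.
have [h [hf hg]] := product_pair f g p12.
have [I [q [m [rq mm hE]]]] := regular_image reg h.
exists (Span (p1 ∘ m) (p2 ∘ m)), q; split=> //=; rewrite -?compA -?hE //.
move=> Z a b /=; rewrite -!compA => e1 e2; apply: mm.
exact: (product_jointly_monic p12).
Qed.

Lemma image_span_mem (E X Y : H) (S : span X Y) (q : E ~> tip S) : jointly_monic S ->
  regular_epi q -> forall Z (x : Z ~> X) (y : Z ~> Y), ⟨x, y⟩ ∈ S <->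
    exists (Z' : H) (d : Z' ~> Z) (k : Z' ~> E),
      [/\ regular_epi d, lleg S ∘ q ∘ k = x ∘ d & rleg S ∘ q ∘ k = y ∘ d].
Proof.
move=> jm rq Z x y; split=> [[k [<- <-]]|[Z' [d [k [rd kx ky]]]]].
  have [Z' [d [l [rd qd]]]] := regular_epi_lift reg k rq.
  by exists Z', d, l; rewrite -!compA qd.
by apply: (rel_mem_descent jm rd); exists (q ∘ k); rewrite !compA.
Qed.

Lemma pull_span_exists (A X Y : H) (f : X ~> Y) (S : span A Y) : jointly_monic S ->
  exists T : span A X, jointly_monic T /\
    forall Z (a : Z ~> A) (x : Z ~> X), ⟨a, x⟩ ∈ T <-> ⟨a, f ∘ x⟩ ∈ S.
Proof.
move=> jm; have [P [p [q pb]]] := pullback_exists lim f (rleg S).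
exists (Span (lleg S ∘ q) p); split=> [Z g h|Z a x] /=.
  rewrite -!compA => e1 e2; apply: (pullback_jointly_monic pb) => //=.
  by apply: jm => //; rewrite !compA -(proj1 pb) -!compA e2.
split=> [[k [/= <- <-]]|[k [<- kx]]].
  by exists (q ∘ k); rewrite !compA (proj1 pb).
by have [l [<- <-]] := pullback_pair pb (esym kx); exists l; rewrite /= compA.
Qed.

(** The fibrewise version of [app_sub], for families of subobjects of [A] indexed by [X]: the image
    of the object of composable codes together with a bound for their product. *)
Lemma app_span_exists (A : opas H) (X : H) (S T : span A X) :
  exists V : span A X, jointly_monic V /\
    forall Z (c : Z ~> A) (x : Z ~> X), ⟨c, x⟩ ∈ V <->
      exists (Z' : H) (e : Z' ~> Z) a b v, [/\ regular_epi e, ⟨a, x ∘ e⟩ ∈ S,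
        ⟨b, x ∘ e⟩ ∈ T, app a b v & le (c ∘ e) v].
Proof.
have [P [s [t pb]]] := pullback_exists lim (rleg S) (rleg T).
have [E [j [d [mj dl dr dU]]]] :=
  span_preimage lim (lleg S ∘ s) (lleg T ∘ t) (odom_jointly_monic (opasP A)).
have [Q [k [o pb']]] := pullback_exists lim (oapp A ∘ d) (rleg (ole A)).
have [V [q [jm rq ql qr]]] := image_span_exists (lleg (ole A) ∘ o) (rleg S ∘ s ∘ j ∘ k).
exists V; split=> // Z c x; rewrite (image_span_mem jm rq) ql qr; split.
  move=> [Z' [e [z [re zc zx]]]]; exists Z', e, (lleg S ∘ s ∘ j ∘ k ∘ z).
  exists (lleg T ∘ t ∘ j ∘ k ∘ z), (oapp A ∘ d ∘ k ∘ z); rewrite -zc -zx; split=> //.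
  - by exists (s ∘ j ∘ k ∘ z); rewrite !compA.
  - by exists (t ∘ j ∘ k ∘ z); rewrite !compA (proj1 pb).
  - by exists (d ∘ k ∘ z); rewrite !compA dl dr.
  - by exists (o ∘ z); rewrite (proj1 pb') !compA.
move=> [Z' [e [a [b [v [re [s' [s1 s2]] [t' [t1 t2]] [d' [d1 d2 dv]] [o' [o1 o2]]]]]]]].
exists Z', e.
have [|p' [ps pt]] := @pullback_pair _ _ _ _ _ _ _ _ _ _ s' t' pb; first by rewrite s2 t2.
have [||e' je de] := dU _ p' d'; rewrite -?compA ?ps ?pt ?s1 ?t1 //.
have [|z [kz oz]] := @pullback_pair _ _ _ _ _ _ _ _ _ _ e' o' pb'.
  by rewrite -compA de dv o2.
by exists z; split; rewrite // -!compA ?oz ?kz ?je ?ps.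
Qed.

End Spans.

(** * Reindexing, direct images, meets and covers of relations *)

Section RelObjects.
Variables (H : heyting_category) (A : opas H).
Let reg := heyting_regular (hcatP H).
Let OA := opasP A.

(** Limits and images are only known to exist, so spans are picked by [cid] and used through their
    membership lemmas. *)
Definition pull_span (X : H) (Q : rel_object A) (f : X ~> robase Q) : span A X :=
  sval (cid (pull_span_exists f (@rorel_jointly_monic _ _ Q))).

Lemma pull_spanP (X : H) (Q : rel_object A) (f : X ~> robase Q) :
  jointly_monic (pull_span f) /\
    forall Z (a : Z ~> A) (x : Z ~> X), ⟨a, x⟩ ∈ pull_span f <-> ⟨a, f ∘ x⟩ ∈ rorel Q.
Proof. exact: svalP (cid (pull_span_exists f (@rorel_jointly_monic _ _ Q))). Qed.

Lemma pull_down (X : H) (Q : rel_object A) (f : X ~> robase Q) (Z : H) (a b : Z ~> A)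
    (x : Z ~> X) : le a b -> ⟨b, x⟩ ∈ pull_span f -> ⟨a, x⟩ ∈ pull_span f.
Proof.
move=> ab /(proj2 (pull_spanP f)) bx; apply/(proj2 (pull_spanP f)).
exact: rorel_down ab bx.
Qed.

(** The Cartesian lift of [f]; [tracked_pull] is its universal property. *)
Definition pull (X : H) (Q : rel_object A) (f : X ~> robase Q) : rel_object A :=
  RelObject (proj1 (pull_spanP f)) (@pull_down X Q f).

Lemma pull_mem (X : H) (Q : rel_object A) (f : X ~> robase Q) (Z : H) (a : Z ~> A)
    (x : Z ~> X) : ⟨a, x⟩ ∈ rorel (pull f) <-> ⟨a, f ∘ x⟩ ∈ rorel Q.
Proof. exact: (proj2 (pull_spanP f)). Qed.

Definition push_span (P : rel_object A) (Y : H) (f : robase P ~> Y) : span A Y :=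
  sval (cid (image_span_exists (lleg (rorel P)) (f ∘ rleg (rorel P)))).

Lemma push_spanP (P : rel_object A) (Y : H) (f : robase P ~> Y) :
  exists q : tip (rorel P) ~> tip (push_span f), [/\ jointly_monic (push_span f), regular_epi q,
    lleg (push_span f) ∘ q = lleg (rorel P) & rleg (push_span f) ∘ q = f ∘ rleg (rorel P)].
Proof. exact: svalP (cid (image_span_exists (lleg (rorel P)) (f ∘ rleg (rorel P)))). Qed.

Lemma push_span_mem (P : rel_object A) (Y : H) (f : robase P ~> Y) (Z : H) (a : Z ~> A)
    (y : Z ~> Y) : ⟨a, y⟩ ∈ push_span f <->
  exists (Z' : H) (e : Z' ~> Z) x, [/\ regular_epi e, ⟨a ∘ e, x⟩ ∈ rorel P & f ∘ x = y ∘ e].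
Proof.
have [q [jm rq ql qr]] := push_spanP f.
rewrite (image_span_mem jm rq) ql qr; split=> [[Z' [e [k [re ka ky]]]]|].
  by exists Z', e, (rleg (rorel P) ∘ k); split=> //; [exists k|rewrite compA].
by move=> [Z' [e [x [re [k [ka kx]] fx]]]]; exists Z', e, k; rewrite -compA kx.
Qed.

Lemma push_jointly_monic (P : rel_object A) (Y : H) (f : robase P ~> Y) :
  jointly_monic (push_span f).
Proof. by have [q []] := push_spanP f. Qed.

Lemma push_down (P : rel_object A) (Y : H) (f : robase P ~> Y) (Z : H) (a b : Z ~> A)
    (y : Z ~> Y) : le a b -> ⟨b, y⟩ ∈ push_span f -> ⟨a, y⟩ ∈ push_span f.
Proof.
move=> ab /push_span_mem [Z' [e [x [re bx fx]]]]; apply/push_span_mem; exists Z', e, x.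
by split=> //; apply: rorel_down bx; apply: rel_mem_comp.
Qed.

(** The coCartesian lift of [f]: a code of [y] is, locally, a code of some preimage. [tracked_push]
    is its universal property. *)
Definition push (P : rel_object A) (Y : H) (f : robase P ~> Y) : rel_object A :=
  RelObject (@push_jointly_monic P Y f) (@push_down P Y f).

Lemma push_mem (P : rel_object A) (Y : H) (f : robase P ~> Y) (Z : H) (a : Z ~> A)
    (y : Z ~> Y) : ⟨a, y⟩ ∈ rorel (push f) <->
  exists (Z' : H) (e : Z' ~> Z) x, [/\ regular_epi e, ⟨a ∘ e, x⟩ ∈ rorel P & f ∘ x = y ∘ e].
Proof. exact: push_span_mem. Qed.

Lemma push_intro (P : rel_object A) (Y : H) (f : robase P ~> Y) (Z : H) (a : Z ~> A)
    (x : Z ~> robase P) : ⟨a, x⟩ ∈ rorel P -> ⟨a, f ∘ x⟩ ∈ rorel (push f).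
Proof.
move=> ax; apply/push_mem; exists Z, (idm Z), x; rewrite !compm1; split=> //.
exact: regular_epi_id.
Qed.

Definition app_span (X : H) (S T : span A X) : span A X := sval (cid (app_span_exists S T)).

Lemma app_spanP (X : H) (S T : span A X) : jointly_monic (app_span S T) /\
  forall Z (c : Z ~> A) (x : Z ~> X), ⟨c, x⟩ ∈ app_span S T <->
    exists (Z' : H) (e : Z' ~> Z) a b v, [/\ regular_epi e, ⟨a, x ∘ e⟩ ∈ S,
      ⟨b, x ∘ e⟩ ∈ T, app a b v & le (c ∘ e) v].
Proof. exact: svalP (cid (app_span_exists S T)). Qed.

Definition const_span (X : H) (U : sub A) : span A X :=
  Span (sub_arr U ∘ lleg (full_span (sub_dom U) X)) (rleg (full_span (sub_dom U) X)).

Lemma const_span_mem (X : H) (U : sub A) (Z : H) (a : Z ~> A) (x : Z ~> X) :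
  ⟨a, x⟩ ∈ const_span X U <-> a ∈ U.
Proof.
split=> [[k [<- _]]|[k <-]]; first by rewrite -compA; exists (lleg (full_span (sub_dom U) X) ∘ k).
have [h [hl hr]] := product_pair k x (@full_spanP H (sub_dom U) X).
by exists h; rewrite /= -compA hl.
Qed.

Variables (phi : external_filter A) (cc : combinatory_complete phi).

Definition pair_codes : sub A := sval (cid (pairing_exists cc)).

Lemma pair_codesP : exists K1 K2, [/\ phi pair_codes, phi K1, phi K2 &
  forall Z (r a b : Z ~> A), r ∈ pair_codes -> exists w c, [/\ app r a w, app w b c,
    forall k, k ∈ K1 -> exists2 d, app c k d & le d a &
    forall k, k ∈ K2 -> exists2 d, app c k d & le d b]].
Proof. exact: svalP (cid (pairing_exists cc)). Qed.

Lemma pair_app (Z : H) (r a b : Z ~> A) : r ∈ pair_codes ->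
  exists w c, app r a w /\ app w b c.
Proof.
have [K1 [K2 [_ _ _ rP]]] := pair_codesP.
by move=> /(rP _ _ a b) [w [c [? ? _ _]]]; exists w, c.
Qed.

Section Meet.
Variables (X : H) (P Q : rel_object A) (p : X ~> robase P) (q : X ~> robase Q).

(** The fibrewise meet of the reindexed [P] and [Q]: codes below [r a b], with [r] ranging over all
    of [pair_codes] since no single pairing element need exist. Over a product or pullback of bases
    it carries the product or pullback of relations. *)
Definition meet_span : span A X :=
  app_span (app_span (const_span X pair_codes) (pull_span p)) (pull_span q).

Lemma meet_down (Z : H) (a b : Z ~> A) (x : Z ~> X) :
  le a b -> ⟨b, x⟩ ∈ meet_span -> ⟨a, x⟩ ∈ meet_span.
Proof.
move=> ab /(proj2 (app_spanP _ _)) [Z' [e [s [t [v [re s1 t1 st bv]]]]]].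
apply/(proj2 (app_spanP _ _)); exists Z', e, s, t, v; split=> //.
by apply: (ole_trans OA) bv; apply: rel_mem_comp.
Qed.

Definition meet : rel_object A := RelObject (proj1 (app_spanP _ _)) meet_down.

Lemma meet_mem (Z : H) (r a b w c : Z ~> A) (x : Z ~> X) : r ∈ pair_codes ->
  ⟨a, p ∘ x⟩ ∈ rorel P -> ⟨b, q ∘ x⟩ ∈ rorel Q -> app r a w -> app w b c ->
  ⟨c, x⟩ ∈ rorel meet.
Proof.
move=> rR ax bx ra wb; apply/(proj2 (app_spanP _ _)).
exists Z, (idm Z), w, b, c; rewrite !compm1; split=> //; last exact: (ole_refl OA).
- exact: regular_epi_id.
- apply/(proj2 (app_spanP _ _)); exists Z, (idm Z), r, a, w; rewrite !compm1.
  split=> //; [exact: regular_epi_id| | |exact: (ole_refl OA)].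
  + exact/const_span_mem.
  + exact/pull_mem.
- exact/pull_mem.
Qed.

(** A code in the meet is below an actual pair only on a cover. The projections are computed there,
    and their definedness and membership descend. *)
Lemma meet_proj : exists K1 K2, [/\ phi K1, phi K2 &
  forall Z (c : Z ~> A) (x : Z ~> X), ⟨c, x⟩ ∈ rorel meet ->
    (forall k, k ∈ K1 -> exists2 d, app c k d & ⟨d, p ∘ x⟩ ∈ rorel P) /\
    (forall k, k ∈ K2 -> exists2 d, app c k d & ⟨d, q ∘ x⟩ ∈ rorel Q)].
Proof.
have [K1 [K2 [_ pK1 pK2 rP]]] := pair_codesP; exists K1, K2; split=> // Z c x.
move=> /(proj2 (app_spanP _ _)) [Z1 [e1 [w [b [v [re1 /(proj2 (app_spanP _ _))
  [Z2 [e2 [r [a [w' [re2 /const_span_mem rR /pull_mem ax ra ww]]]]]]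
  /pull_mem bx wb cv]]]]]].
have [w2 [v2 [ra' wb' P1 P2]]] := rP _ _ a (b ∘ e2) rR.
have re : regular_epi (e1 ∘ e2) by apply: (regular_epi_comp reg).
rewrite -(app_fun ra ra') in wb'.
have [v3 wb3 vv] := oapp_le OA ww (ole_refl OA (b ∘ e2)) wb'.
have cv2 : le (c ∘ (e1 ∘ e2)) v2.
  apply: (ole_trans OA) vv; rewrite -(app_fun (app_comp e2 wb) wb3) compA.
  exact: rel_mem_comp.
have loc (k : Z ~> A) (T : rel_object A) (t : X ~> robase T) (a' : Z2 ~> A) :
    (exists2 d, app v2 (k ∘ (e1 ∘ e2)) d & le d a') ->
    ⟨a', t ∘ x ∘ (e1 ∘ e2)⟩ ∈ rorel T ->
    exists2 d, app c k d & ⟨d, t ∘ x⟩ ∈ rorel T.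
  move=> [d vd da] at_; have [d' cd dd] := oapp_le OA cv2 (ole_refl OA (k ∘ (e1 ∘ e2))) vd.
  have /app_definedP [d2 ckd] : app_defined c k.
    by apply: (rel_mem_descent (odom_jointly_monic OA) re); apply: app_dom cd.
  exists d2 => //; apply: (rel_mem_descent (@rorel_jointly_monic _ _ T) re).
  rewrite (app_fun (app_comp (e1 ∘ e2) ckd) cd).
  by apply: rorel_down at_; apply: (ole_trans OA) da.
split=> k kK.
  by apply: (loc k P p a); [apply: P1; apply: mem_comp|rewrite -!compA in ax *].
apply: (loc k Q q (b ∘ e2)); first by apply: P2; apply: mem_comp.
by have := rel_mem_comp e2 bx; rewrite !compA.
Qed.

End Meet.

Local Notation "P ⊢[ f ] Q" := (tracked phi (P := P) (Q := Q) f)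
  (at level 70, f at level 200, no associativity).

Lemma tracked_sub (P Q : rel_object A) (f : robase P ~> robase Q) :
  (forall Z (a : Z ~> A) (x : Z ~> robase P),
     ⟨a, x⟩ ∈ rorel P -> ⟨a, f ∘ x⟩ ∈ rorel Q) -> P ⊢[f] Q.
Proof.
move=> PQ; apply: (tracked_term (Us := [::]) (t := CVar 0) cc) => // Z us a x usUs ax.
by exists a; [case: us usUs|apply: PQ].
Qed.

Lemma tracked_pull (T Q : rel_object A) (X : H) (f : X ~> robase Q) (g : robase T ~> X) :
  T ⊢[g] pull f <-> T ⊢[f ∘ g] Q.
Proof.
split=> -[U [pU UP]]; exists U; split=> // Z u a x uU ax.
  by have [b ub /pull_mem bx] := UP _ _ _ _ uU ax; exists b; rewrite -?compA.
have [b ub bx] := UP _ _ _ _ uU ax; exists b => //.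
by apply/pull_mem; rewrite compA.
Qed.

(** The same [U] tracks both maps: a preimage of the given point exists on a cover, and the
    conclusion descends along it. *)
Lemma tracked_push (P Q : rel_object A) (Y : H) (f : robase P ~> Y) (g : Y ~> robase Q) :
  push f ⊢[g] Q <-> P ⊢[g ∘ f] Q.
Proof.
split=> -[U [pU UP]]; exists U; split=> // Z u a x uU.
  move=> /(push_intro f) ax; have [b ub bx] := UP _ _ _ _ uU ax.
  by exists b; rewrite -?compA.
move=> /push_mem [Z' [e [y [re ay fy]]]].
have [b ub bx] := UP _ _ _ _ (mem_comp e uU) ay.
have /app_definedP [c uc] : app_defined u a.
  by apply: (rel_mem_descent (odom_jointly_monic OA) re); apply: app_dom ub.
exists c => //; apply: (rel_mem_descent (@rorel_jointly_monic _ _ Q) re).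
by rewrite (app_fun (app_comp e uc) ub) -compA -fy compA.
Qed.

Lemma tracked_meetl (X : H) (P Q : rel_object A) (p : X ~> robase P) (q : X ~> robase Q) :
  meet p q ⊢[p] P.
Proof.
have [K1 [K2 [pK1 _ KP]]] := meet_proj p q.
apply: (tracked_term (Us := [:: K1]) (t := CApp (CVar 1) (CVar 0)) cc) => //.
move=> Z us c x /all_mem1 [k -> kK] /KP [cP _]; have [d ckd dx] := cP _ kK.
by exists d => //; exists c, k.
Qed.

Lemma tracked_meetr (X : H) (P Q : rel_object A) (p : X ~> robase P) (q : X ~> robase Q) :
  meet p q ⊢[q] Q.
Proof.
have [K1 [K2 [_ pK2 KP]]] := meet_proj p q.
apply: (tracked_term (Us := [:: K2]) (t := CApp (CVar 1) (CVar 0)) cc) => //.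
move=> Z us c x /all_mem1 [k -> kK] /KP [_ cP]; have [d ckd dx] := cP _ kK.
by exists d => //; exists c, k.
Qed.

Lemma phi_pair_codes : phi pair_codes.
Proof. by have [K1 [K2 []]] := pair_codesP. Qed.

Lemma tracked_meet (T : rel_object A) (X : H) (P Q : rel_object A) (p : X ~> robase P)
    (q : X ~> robase Q) (h : robase T ~> X) :
  T ⊢[p ∘ h] P -> T ⊢[q ∘ h] Q -> T ⊢[h] meet p q.
Proof.
move=> [U [pU UP]] [V [pV VP]].
(* The term is [r (u a) (v a)]. *)
apply: (tracked_term (Us := [:: pair_codes; U; V]) (t := CApp
  (CApp (CVar 0) (CApp (CVar 1) (CVar 3))) (CApp (CVar 2) (CVar 3))) cc) => //.
  by split=> //; exact: phi_pair_codes.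
move=> Z us a x /all_mem3 [r [u [v [-> rR uU vV]]]] ax.
have [b ub bx] := UP _ _ _ _ uU ax; have [c vc cx] := VP _ _ _ _ vV ax.
have [w [d [rw wd]]] := pair_app b c rR.
exists d.
  exists w, c; split=> //; last by exists v, a.
  by exists r, b; split=> //; exists u, a.
by apply: meet_mem rw wd; rewrite // compA.
Qed.

(** Supineness of [s] (see [supineP]): a code of a point of [Q] is turned uniformly into a code of a
    local preimage. Points of [Q] without codes may fail to have preimages, so [s] need not be a
    regular epimorphism in [H]. *)
Definition cov (P Q : rel_object A) (s : robase P ~> robase Q) : Prop :=
  Q ⊢[idm (robase Q)] push s.

Lemma push_unit (P : rel_object A) (Y : H) (f : robase P ~> Y) : P ⊢[f] push f.
Proof. by apply: tracked_sub => Z a x; apply: push_intro. Qed.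

Lemma cov_push (P : rel_object A) (Y : H) (f : robase P ~> Y) : cov (Q := push f) f.
Proof. exact: (tracked_id cc (push f)). Qed.

Lemma cov_id (P : rel_object A) : cov (idm (robase P)).
Proof. exact: push_unit. Qed.

Lemma cov_comp (P Q R : rel_object A) (t : robase Q ~> robase R) (s : robase P ~> robase Q) :
  cov t -> cov s -> cov (t ∘ s).
Proof.
move=> ct cs; have QtR : push t ⊢[idm _] push (t ∘ s).
  apply/tracked_push; rewrite comp1m -(compm1 t).
  apply: (tracked_comp cc) cs; rewrite compm1; apply/tracked_push.
  exact: push_unit.
by rewrite /cov -(comp1m (idm _)); apply: (tracked_comp cc) QtR ct.
Qed.

(** Beck-Chevalley and Frobenius reciprocity. *)
Lemma cov_pullback (P Q T : rel_object A) (X : H) (s : robase P ~> robase Q)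
    (f : robase T ~> robase Q) (p : X ~> robase P) (q : X ~> robase T) :
  is_pullback s f p q -> T ⊢[f] Q -> cov s -> cov (P := meet p q) q.
Proof.
move=> pb Tf cs; have [V [pV VP]] := tracked_comp cc cs Tf.
apply: (tracked_local_term (Us := [:: pair_codes; V]) (t := CApp (CApp
  (CVar 0) (CApp (CVar 1) (CVar 2))) (CVar 2)) cc) => //.
  by split=> //; exact: phi_pair_codes.
move=> Z us b y /all_mem2 [r [v [-> rR vV]]] yT.
have [c vc /push_mem [Z' [e [x [re cx sx]]]]] := VP _ _ _ _ vV yT.
have [w [d [rw wd]]] := pair_app c b rR.
exists Z', e, (d ∘ e); split=> //.
  exists (w ∘ e), (b ∘ e); split=> //; last exact: app_comp.
  exists (r ∘ e), (c ∘ e); split=> //; last exact: app_comp.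
  by exists (v ∘ e), (b ∘ e); split=> //; apply: app_comp.
rewrite comp1m in sx; rewrite -compA in sx.
have [z [pz qz]] := pullback_pair pb sx.
rewrite comp1m -qz; apply: push_intro.
apply: (meet_mem (r := r ∘ e) (a := c ∘ e) (b := b ∘ e) (w := w ∘ e)).
- exact: mem_comp.
- by rewrite pz.
- by rewrite qz; apply: rel_mem_comp.
- exact: app_comp.
- exact: app_comp.
Qed.

(** The term returns the code itself. Its parameters put elements of the members of [Us] at the
    current stage, and these force the point into [S]. *)
Lemma cov_restrict (P : rel_object A) (S : sub (robase P)) (Us : seq (sub A)) :
  all_ext phi Us ->
  (forall Z (us : seq (Z ~> A)) (a : Z ~> A) (x : Z ~> robase P), all_mem us Us ->
     ⟨a, x⟩ ∈ rorel P -> x ∈ S) ->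
  cov (P := pull (sub_arr S)) (sub_arr S).
Proof.
move=> pU US; apply: (tracked_term (Us := Us) (t := CVar (size Us)) cc) => //=.
move=> Z us a x usUs ax; have [k kx] := US _ _ _ _ usUs ax.
exists a.
  rewrite -(all_mem_size usUs) onthE (nth_map a) ?size_rcons //.
  by rewrite nth_rcons ltnn eqxx.
by rewrite comp1m -kx; apply: push_intro; apply/pull_mem; rewrite kx.
Qed.

End RelObjects.

(** * The category of assemblies is regular *)

Section Assemblies.
Variables (H : heyting_category) (A : opas H) (phi : external_filter A).
Variable cc : combinatory_complete phi.
Let reg := heyting_regular (hcatP H).
Let lim := regular_finlim reg.
Local Notation RC := (rel_category cc).
Local Notation W := (supine_mono cc).
Local Notation L := (loc_functor W).
Local Notation "P ⊢[ f ] Q" := (tracked phi (P := P) (Q := Q) f)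
  (at level 70, f at level 200, no associativity).

Definition rel_mor (P Q : rel_object A) (f : robase P ~> robase Q) (Pf : P ⊢[f] Q) :
  hom (c := RC) P Q := exist _ f Pf.

Lemma rel_terminal (T : H) : is_terminal T -> is_terminal (C := RC) (nabla_object A T).
Proof.
move=> tT P; have [f [_ fU]] := tT (robase P).
exists (nabla_hom cc f); split=> // g _; apply: rel_hom_eq; exact: fU.
Qed.

Lemma rel_pair (X : H) (P Q T : RC) (p : X ~> robase P) (q : X ~> robase Q)
    (f : T ~> P) (g : T ~> Q) (h : robase T ~> X) :
  p ∘ h = sval f -> q ∘ h = sval g -> exists k : hom (c := RC) T (meet cc p q),
    sval k = h.
Proof.
move=> ph qh; have Th : T ⊢[h] meet cc p q.
  by apply: tracked_meet; rewrite ?ph ?qh; apply: svalP.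
by exists (rel_mor Th).
Qed.

Lemma rel_product (P Q : RC) (X : H) (p : X ~> robase P) (q : X ~> robase Q) :
  is_product p q ->
  is_product (rel_mor (tracked_meetl cc p q)) (rel_mor (tracked_meetr cc p q)).
Proof.
move=> pq; apply: productP => [T f g|T f g /=].
  have [h [ph qh]] := product_pair (sval f) (sval g) pq.
  have [k kh] := rel_pair ph qh; exists k.
  by split; apply: rel_hom_eq; rewrite /= kh.
move=> /(congr1 sval) /= e1 /(congr1 sval) /= e2; apply: rel_hom_eq.
exact: (product_jointly_monic pq).
Qed.

Lemma rel_restrict_tracked (P : RC) (X : H) (e : X ~> robase P) : pull e ⊢[e] P.
Proof. by have /tracked_pull := tracked_id cc (pull e); rewrite compm1. Qed.

Definition rel_restrict (P : RC) (X : H) (e : X ~> robase P) : hom (c := RC) (pull e) P :=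
  rel_mor (rel_restrict_tracked e).

Lemma rel_equalizer (P Q : RC) (f g : P ~> Q) (X : H) (e : X ~> robase P) :
  is_equalizer (sval f) (sval g) e -> is_equalizer f g (rel_restrict e).
Proof.
move=> eq; apply: equalizerP; first by apply: rel_hom_eq; exact: (proj1 eq).
  move=> T a b /(congr1 sval) /= ab; apply: rel_hom_eq.
  exact: (equalizer_mono eq).
move=> T z /(congr1 sval) /= zfg; have [h hz] := equalizer_fact eq zfg.
have Th : T ⊢[h] pull e by apply/tracked_pull; rewrite hz; apply: svalP.
by exists (rel_mor Th); apply: rel_hom_eq.
Qed.

Lemma rel_has_finite_limits : has_finite_limits RC.
Proof.
split.
- by have [T tT] := has_terminal lim; exists (nabla_object A T); apply: rel_terminal.
- move=> P Q; have [X [p [q pq]]] := has_products lim (robase P) (robase Q).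
  by exists (meet cc p q); do 2!eexists; apply: rel_product pq.
- move=> P Q f g; have [X [e eq]] := has_equalizers lim (sval f) (sval g).
  by exists (pull e), (rel_restrict e); apply: rel_equalizer.
Qed.

(** Two arbitrary maps [g] and [h] of [H] into the base become morphisms of relations once their
    domain carries [meet g h]. *)
Lemma rel_monoP (P Q : RC) (f : P ~> Q) : mono f <-> mono (sval f).
Proof.
split=> [mf Z g h fgh|mf T g h /(congr1 sval) /mf]; last exact: rel_hom_eq.
have /mf /(congr1 sval) // : f ∘ rel_mor (tracked_meetl cc g h) =
  f ∘ rel_mor (tracked_meetr cc g h) :> hom (c := RC) _ _.
exact: rel_hom_eq.
Qed.

(** Since [push] is the coCartesian lift, [s] is supine when the comparison with it, the identity
    from [Q] to the direct image, is tracked. *)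
Lemma supineP (P Q : RC) (s : P ~> Q) :
  supine (realizability_fibration cc) s <-> cov phi (sval s).
Proof.
split=> [sup|cs Z g h hs].
  have [|k [[ks _] _]] := sup (push (sval s)) (rel_mor (push_unit cc (sval s))) (idm (robase Q)).
    by rewrite /= comp1m.
  by rewrite /cov -ks; apply: (svalP k).
have Qh : Q ⊢[h] Z.
  rewrite -(compm1 h); apply: (tracked_comp cc) cs; apply/tracked_push.
  by rewrite [h ∘ _]hs; apply: (svalP g).
exists (rel_mor Qh); split; first by split=> //; apply: rel_hom_eq.
by move=> k [kh _]; apply: rel_hom_eq.
Qed.

Lemma supine_monoP (P Q : RC) (s : P ~> Q) :
  W _ _ s <-> mono (sval s) /\ cov phi (sval s).
Proof. by rewrite /supine_mono supineP rel_monoP. Qed.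

(** The pullback of the bases with paired codes on top; [cov_pullback] gives supineness. For monic
    [s] this is the Ore condition. *)
Lemma cov_base_change (P Q T : RC) (s : P ~> Q) (f : T ~> Q) : cov phi (sval s) ->
  exists (M : RC) (p : M ~> P) (q : M ~> T),
    [/\ s ∘ p = f ∘ q, cov phi (sval q) & mono (sval s) -> mono (sval q)].
Proof.
move=> cs; have [X [p [q pb]]] := pullback_exists lim (sval s) (sval f).
exists (meet cc p q), (rel_mor (tracked_meetl cc p q)), (rel_mor (tracked_meetr cc p q)).
split; first by apply: rel_hom_eq; exact: (proj1 pb).
  by apply: cov_pullback pb _ cs; apply: (svalP f).
move=> ms Z a b /= qab; apply: (pullback_jointly_monic pb) => //=.
by apply: ms; rewrite !compA (proj1 pb) -!compA qab.
Qed.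

Lemma supine_mono_fractions : right_fractions W.
Proof.
split.
- move=> P; apply/supine_monoP; split; first exact: mono_id.
  exact: (cov_id cc).
- move=> P Q R g f /supine_monoP [mg cg] /supine_monoP [mf cf]; apply/supine_monoP.
  by split; [exact: mono_comp|exact: (cov_comp cc)].
- by move=> P Q w [].
- move=> P Q T w f /supine_monoP [mw cw].
  have [M [p [q [pq cq mq]]]] := cov_base_change f cw.
  by exists M, q, p; split=> //; apply/supine_monoP; split=> //; apply: mq.
Qed.

(** The device for discarding points without codes: the base may be shrunk to any subobject that
    contains all points with codes as soon as the members of [Us] have elements. *)
Lemma restrict_supine_mono (P : RC) (S : sub (robase P)) (Us : seq (sub A)) :
  all_ext phi Us ->
  (forall Z (us : seq (Z ~> A)) (a : Z ~> A) (x : Z ~> robase P), all_mem us Us ->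
     ⟨a, x⟩ ∈ rorel P -> x ∈ S) ->
  W _ _ (rel_restrict (sub_arr S)).
Proof.
move=> pUs US; apply/supine_monoP; split; first exact: sub_mono.
exact: (cov_restrict cc pUs US).
Qed.

(** Represent [k] and [k'] by [c] and [c'] over a common roof. They agree on the points that have a
    code when [U] has an element, so the equalizer of [c] and [c'] in [H] contains those points and
    its inclusion is inverted. *)
Lemma loc_cov_epi (P Q R : RC) (s : P ~> Q) (k k' : hom (c := asm cc) Q R) :
  cov phi (sval s) -> k ∘ fmap L s = k' ∘ fmap L s -> k = k'.
Proof.
have fr := supine_mono_fractions; move=> cs ks.
have [Q' [w [c [c' [Ww kw kw']]]]] := loc_roof2 fr k k'.
have [M [p [t [spt ct _]]]] := cov_base_change w cs.
have : fmap L (c ∘ t) = fmap L (c' ∘ t).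
  by rewrite !fmapM -kw -kw' -!compA -fmapM -spt fmapM !compA ks.
move=> /(loc_map_eq fr) [V [v [/supine_monoP [_ cv] ctv]]].
have [E [e eq]] := has_equalizers lim (sval c) (sval c').
have [U [pU UP]] := cov_comp cc ct cv.
have We : W _ _ (rel_restrict e).
  apply: (@restrict_supine_mono Q' (Sub (equalizer_mono eq)) [:: U]) => //.
  move=> Z us a x /all_mem1 [u _ uU] ax.
  have [b _ /push_mem [Z' [d [y [rd _ yx]]]]] := UP _ _ _ _ uU ax.
  apply: (mem_descent rd); apply: (equalizer_fact eq).
  rewrite comp1m in yx; rewrite -yx !compA.
  by have /= -> := congr1 sval ctv.
apply: (loc_iso_cancel Ww); rewrite kw kw'; apply: (loc_iso_cancel We).
by rewrite -!fmapM; congr (fmap L _); apply: rel_hom_eq; exact: (proj1 eq).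
Qed.

(** In [H] itself, [z] descends along [s] only over the points of [Q] above which
    [P] has a realizer while [U] has an element. These form a subobject whose
    inclusion is inverted by the localization. *)
Lemma cov_descent (P Q R : RC) (s : P ~> Q) (z : P ~> R) (U : sub A) :
  cov phi (sval s) -> phi U ->
  (forall Z (u a a' : Z ~> A) (x x' : Z ~> robase P), u ∈ U ->
     ⟨a, x⟩ ∈ rorel P -> ⟨a', x'⟩ ∈ rorel P -> sval s ∘ x = sval s ∘ x' ->
     sval z ∘ x = sval z ∘ x') ->
  exists k : hom (c := asm cc) Q R, k ∘ fmap L s = fmap L z.
Proof.
move=> cs pU sep.
(* [E] consists of an element of [U] and a coded point of [P]. The image [I] of its points under [s]
   is the part of [Q] over which [z] descends in [H]. *)
have [E [e1 [e2 prod]]] := has_products lim (sub_dom U) (tip (rorel P)).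
pose xE := rleg (rorel P) ∘ e2.
have [I [q [rq fE]]] := image_exists reg (sval s ∘ xE).
have EP Z (l : Z ~> E) : ⟨lleg (rorel P) ∘ e2 ∘ l, xE ∘ l⟩ ∈ rorel P.
  by exists (e2 ∘ l); rewrite !compA.
have El Z (u a : Z ~> A) (x : Z ~> robase P) : u ∈ U -> ⟨a, x⟩ ∈ rorel P ->
    exists l, xE ∘ l = x.
  move=> [k _] [t [_ <-]]; have [l [_ <-]] := product_pair k t prod.
  by exists l; rewrite compA.
clearbody xE.
have UE Z (l : Z ~> E) : sub_arr U ∘ e1 ∘ l ∈ U by exists (e1 ∘ l); rewrite compA.
have [c cq] : exists c : sub_dom I ~> robase R, c ∘ q = sval z ∘ xE.
  apply: (regular_epi_descent rq) => T a b qab.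
  rewrite -!compA; apply: sep (UE _ a) (EP _ a) (EP _ b) _.
  by rewrite !compA fE -!compA qab.
have IE Z (u a : Z ~> A) (x : Z ~> robase P) : u ∈ U -> ⟨a, x⟩ ∈ rorel P ->
    exists y, sub_arr I ∘ y = sval s ∘ x /\ c ∘ y = sval z ∘ x.
  move=> uU ax; have [l xl] := El _ _ _ _ uU ax.
  by exists (q ∘ l); rewrite !compA -fE cq -!compA xl.
have [V [pV VP]] := cs.
have w0W : W _ _ (rel_restrict (sub_arr I)).
  apply: (@restrict_supine_mono Q I [:: U; V]) => // Z us b y /all_mem2 [u [v [_ uU vV]]] yb.
  have [d _ /push_mem [Z' [e [x [re dx sx]]]]] := VP _ _ _ _ vV yb.
  have [y' [Iy _]] := IE _ _ _ _ (mem_comp e uU) dx.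
  by apply: (mem_descent re); exists y'; rewrite Iy sx comp1m.
have [T [pT TP]] := svalP z.
have ct : pull (sub_arr I) ⊢[c] R.
  apply: (tracked_local_term cc (Us := [:: T; V])
    (t := CApp (CVar 0) (CApp (CVar 1) (CVar 2)))) => //.
  move=> Z us b y /all_mem2 [t [v [-> tT vV]]] /pull_mem yb.
  have [d vd /push_mem [Z' [e [x [re dx sx]]]]] := VP _ _ _ _ vV yb.
  have [r tr rz] := TP _ _ _ _ (mem_comp e tT) dx.
  exists Z', e, r; split=> //.
    exists (t ∘ e), (d ∘ e); split=> //.
    by exists (v ∘ e), (b ∘ e); split=> //; apply: app_comp.
  have [Z2 [e' [l [re' ql]]]] := regular_epi_lift reg (y ∘ e) rq.
  suff -> : c ∘ y ∘ e = sval z ∘ x by [].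
  apply: (regular_epi_epi re').
  rewrite -[LHS]compA -[in LHS]compA (compA y) -ql compA cq -!compA.
  apply: sep (UE _ l) (EP _ l) (rel_mem_comp e' dx) _.
  by rewrite !compA fE -compA ql sx comp1m -!compA.
have [k kw] := loc_fill (rel_mor ct) w0W.
exists k.
(* The equation [k ∘ L s = L z] is checked on the subobject [Y'] of points of [P] that [s] sends
   into [I] and at which [c] gives the value of [z]. It contains every coded point once [U] has an
   element. *)
have [Y [y [x pb]]] := pullback_exists lim (sub_arr I) (sval s).
have [Y' [e eq]] := has_equalizers lim (c ∘ y) (sval z ∘ x).
have mx : mono (x ∘ e).
  apply: mono_comp (equalizer_mono eq) => Z a b ab; apply: (pullback_jointly_monic pb) => //=.
  by apply: (sub_mono (s := I)); rewrite !compA (proj1 pb) -!compA ab.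
have w1W : W _ _ (rel_restrict (x ∘ e)).
  apply: (@restrict_supine_mono P (Sub mx) [:: U]) => // Z us a p /all_mem1 [u _ uU] ap.
  have [y' [Iy cy]] := IE _ _ _ _ uU ap.
  have [h [yh xh]] := pullback_pair pb Iy.
  have [|h' eh] := @equalizer_fact _ _ _ _ _ _ _ _ h eq; first by rewrite -!compA yh xh.
  by exists h'; rewrite /= -compA eh.
have yt : pull (x ∘ e) ⊢[y ∘ e] pull (sub_arr I).
  apply/tracked_pull; rewrite compA (proj1 pb) -compA.
  apply: (tracked_comp cc); first exact: (svalP s).
  exact: rel_restrict_tracked.
apply: (loc_iso_cancel w1W).
have sw : s ∘ rel_restrict (x ∘ e) = rel_restrict (sub_arr I) ∘ rel_mor yt.
  by apply: rel_hom_eq; rewrite /= !compA (proj1 pb).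
rewrite -compA -fmapM sw fmapM compA kw -!fmapM; congr (fmap L _).
by apply: rel_hom_eq; rewrite /= !compA (proj1 eq).
Qed.

(** The localized [s] is the coequalizer of its localized kernel pair. A test map [z] is only a
    roof, so its left leg [w] is absorbed into the cover: equality on the kernel pair of [s ∘ w]
    holds on coded pairs wherever realizers exist, as [cov_descent] requires. *)
Lemma loc_cov_regular_epi (P Q : RC) (s : P ~> Q) :
  cov phi (sval s) -> regular_epi (fmap L s).
Proof.
have fr := supine_mono_fractions; move=> cs.
have [K [k1 [k2 kp]]] := pullback_exists rel_has_finite_limits s s.
exists (L K), (fmap L k1), (fmap L k2); split; first by rewrite -!fmapM (proj1 kp).
move=> R z zk.
suff [k ks] : exists k : hom (c := asm cc) Q R, k ∘ fmap L s = z.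
  by exists k; split=> // k' k's; apply: (loc_cov_epi cs); rewrite ks k's.
have [P' [w [z' [Ww zw]]]] := loc_roof fr z.
have csw : cov phi (sval (s ∘ w)).
  by case/supine_monoP: Ww => _; apply: (cov_comp cc).
have [B [p1 [p2 pb]]] := pullback_exists lim (sval (s ∘ w)) (sval (s ∘ w)).
pose m1 : hom (c := RC) _ _ := rel_mor (tracked_meetl cc p1 p2).
pose m2 : hom (c := RC) _ _ := rel_mor (tracked_meetr cc p1 p2).
have sm : s ∘ (w ∘ m1) = s ∘ (w ∘ m2).
  by apply: rel_hom_eq; rewrite /= !compA; exact: (proj1 pb).
have [h [kh1 kh2]] := pullback_pair kp sm.
have : fmap L (z' ∘ m1) = fmap L (z' ∘ m2).
  rewrite !fmapM -zw -!compA -!fmapM -kh1 -kh2 !fmapM.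
  by rewrite !compA zk.
move=> /(loc_map_eq fr) [V [v [/supine_monoP [_ [U [pU UP]]] mv]]].
have phiR := phi_pair_codes cc.
(* [cov_descent] takes a single member of [phi]. This [S] merges two: an element of it locally
   yields one of [pair_codes], to code a pair of points, and one of [U]. The term [CVar 0] is a
   placeholder. *)
have [S [pS SP]] := @term_realizers _ _ _ cc [:: pair_codes cc; U] (CVar 0)
  (conj phiR (conj pU I)) isT.
have [k kE] : exists k : hom (c := asm cc) Q R, k ∘ fmap L (s ∘ w) = fmap L z'.
  apply: (cov_descent csw pS) => Z u a a' x x' uS ax ax' sx.
  have [Z' [e [us [re /all_mem2 [r [u' [_ rR uU]]] _]]]] := SP _ _ a uS.
  apply: (regular_epi_epi re).
  have [t [t1 t2]] := pullback_pair pb sx.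
  have [w' [c [rw wc]]] := pair_app (a ∘ e) (a' ∘ e) rR.
  have cM : ⟨c, t ∘ e⟩ ∈ rorel (meet cc p1 p2).
    apply: meet_mem rR _ _ rw wc; rewrite compA ?t1 ?t2; exact: rel_mem_comp.
  have [d _ /push_mem [Z2 [e' [y [re' _ yt]]]]] := UP _ _ _ _ uU cM.
  apply: (regular_epi_epi re'); rewrite -t1 -t2.
  rewrite comp1m -!compA in yt; rewrite -!compA -yt !compA.
  by have /= -> := congr1 sval mv.
exists k; apply: (loc_iso_cancel Ww).
by rewrite zw -kE fmapM compA.
Qed.

Lemma rel_factorization (P Q : RC) (f : P ~> Q) :
  exists (I : RC) (s : P ~> I) (m : I ~> Q), [/\ cov phi (sval s), mono m & f = m ∘ s].
Proof.
have [I [q [rq fE]]] := image_exists reg (sval f).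
have It : push q ⊢[sub_arr I] Q by apply/tracked_push; rewrite -fE; apply: (svalP f).
exists (push q), (rel_mor (push_unit cc q)), (rel_mor It); split.
- exact: (cov_push cc).
- by apply/rel_monoP; apply: sub_mono.
- exact: rel_hom_eq.
Qed.

Lemma asm_factorization (P Q : RC) (f : hom (c := asm cc) P Q) :
  exists (P' I : RC) (w : P' ~> P) (s : P' ~> I) (m : I ~> Q),
    [/\ W _ _ w, cov phi (sval s), mono m & f ∘ fmap L w = fmap L m ∘ fmap L s].
Proof.
have [P' [w [f' [Ww fw]]]] := loc_roof supine_mono_fractions f.
have [I [s [m [cs mm fE]]]] := rel_factorization f'.
by exists P', I, w, s, m; rewrite fw fE fmapM.
Qed.

Lemma asm_image (P Q : asm cc) (f : P ~> Q) :
  exists (I : asm cc) (e : P ~> I) (m : I ~> Q), [/\ regular_epi e, mono m & f = m ∘ e].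
Proof.
have [P' [I [w [s [m [Ww cs mm fw]]]]]] := asm_factorization f.
have [w' [ww w'w]] := loc_iso Ww.
exists (L I), (fmap L s ∘ w'), (fmap L m); split.
- apply: regular_epi_comp_isor; first exact: loc_cov_regular_epi.
  exact: iso_inv ww w'w.
- exact: (loc_mono supine_mono_fractions).
- by rewrite compA -fw -compA w'w compm1.
Qed.

(** The monomorphic part of the factorization is also a regular epimorphism, hence invertible.
    Stability and preservation of regular epimorphisms thus reduce to supine morphisms. *)
Lemma asm_regular_epi (P Q : RC) (f : hom (c := asm cc) P Q) : regular_epi f ->
  exists (P' I : RC) (w : P' ~> P) (s : P' ~> I) (i : hom (c := asm cc) I Q),
    [/\ W _ _ w, cov phi (sval s), is_iso i & f ∘ fmap L w = i ∘ fmap L s].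
Proof.
move=> rf; have [P' [I [w [s [m [Ww cs mm fw]]]]]] := asm_factorization f.
exists P', I, w, s, (fmap L m); split=> //.
have mLm := loc_mono supine_mono_fractions mm; apply: mono_regular_epi_iso => //.
have [w' [ww w'w]] := loc_iso Ww.
apply: (@regular_epi_of_comp_image _ _ _ _ _ (fmap L s ∘ w') (asm_image _)).
by rewrite compA -fw -compA w'w compm1.
Qed.

(** For stability, base change of the supine part of [f] along a roof of [g] gives a commuting
    square. Its comparison [h] with the given pullback makes [q] the last factor of a regular
    epimorphism. *)
Lemma asm_regular : is_regular (asm cc).
Proof.
have fr := supine_mono_fractions; split.
- exact: (localization_has_finite_limits fr rel_has_finite_limits).
- exact: asm_image.
move=> P Q B T f g p q pb rf.
have [P' [I [w [s [i [Ww cs iI fw]]]]]] := asm_regular_epi rf.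
have [j [ji ij]] := iI.
have [Q' [v [g' [Wv gv]]]] := loc_roof fr (j ∘ g).
have [M [m [t [smt ct _]]]] := cov_base_change g' cs.
have fm : f ∘ (fmap L w ∘ fmap L m) = g ∘ (fmap L v ∘ fmap L t).
  rewrite !compA fw -compA -fmapM smt fmapM -gv !compA.
  by rewrite ij comp1m.
have [h [_ qh]] := pullback_pair pb fm.
apply: (@regular_epi_of_comp_image _ _ _ _ q h (asm_image q)).
rewrite qh; apply: regular_epi_comp_isol (loc_iso Wv).
exact: loc_cov_regular_epi.
Qed.

End Assemblies.

Lemma preserves_finite_limits_comp (C D E : category) (G : functor D E) (F : functor C D) :
  preserves_finite_limits G -> preserves_finite_limits F ->
  preserves_finite_limits (comp_functor G F).
Proof.
move=> limG limF; split.
- by move=> T /(preserves_terminal limF) /(preserves_terminal limG).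
- by move=> X Y P p q /(preserves_product limF) /(preserves_product limG).
- by move=> X Y E' f g e /(preserves_equalizer limF) /(preserves_equalizer limG).
Qed.

(** * Assemblies as a regular model *)

Section AssemblyModel.
Variables (H : heyting_category) (A : opas H) (phi : external_filter A).
Variable cc : combinatory_complete phi.
Let reg := heyting_regular (hcatP H).
Let lim := regular_finlim reg.
Let OA := opasP A.
Local Notation RC := (rel_category cc).
Local Notation W := (supine_mono cc).
Local Notation L := (loc_functor W).
Local Notation "P ⊢[ f ] Q" := (tracked phi (P := P) (Q := Q) f)
  (at level 70, f at level 200, no associativity).
Let fr : right_fractions W := supine_mono_fractions cc.

(** Every map of bases into [X] is tracked as a map into [nabla_object A X]: the functor is right
    adjoint to the realizability fibration. *)
Lemma rel_nabla_finite_limits : preserves_finite_limits (rel_nabla cc).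
Proof.
split; first exact: rel_terminal.
- move=> X Y P p q pq; apply: productP => [T f g|T f g /=].
    have [h [ph qh]] := product_pair (sval f) (sval g) pq.
    by exists (nabla_hom cc h); split; apply: rel_hom_eq.
  move=> /(congr1 sval) /= e1 /(congr1 sval) /= e2; apply: rel_hom_eq.
  exact: (product_jointly_monic pq).
- move=> X Y E f g e eq; apply: equalizerP.
  + by apply: rel_hom_eq; exact: (proj1 eq).
  + move=> T a b /(congr1 sval) /= ab; apply: rel_hom_eq.
    exact: (equalizer_mono eq).
  + move=> T z /(congr1 sval) /= zfg; have [h hz] := equalizer_fact eq zfg.
    by exists (nabla_hom cc h); apply: rel_hom_eq.
Qed.

Lemma nabla_regular : regular_functor (nabla cc).
Proof.
split.
  exact: preserves_finite_limits_comp (loc_preserves_finite_limits fr) rel_nabla_finite_limits.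
move=> X Y e re; apply: (@loc_cov_regular_epi _ _ _ cc).
apply: (tracked_sub cc) => Z a y _; apply/push_mem.
have [Z' [d [x [rd ex]]]] := regular_epi_lift reg y re.
exists Z', d, x; rewrite comp1m; split=> //; exact: full_span_mem.
Qed.

Local Notation incl := (nabla_hom cc (P := ring_object A) (idm (A : H)) :
  hom (c := RC) (ring_object A) (rel_nabla cc A)).

Lemma ring_incl_mono : mono (ring_incl cc).
Proof. by apply: (loc_mono fr); apply/rel_monoP; apply: mono_id. Qed.

(** On a common refinement [V] of all roofs the data are honest maps. If [u c] is below the first
    argument and [u' c] below the second, then [(u c) (u' c)] is defined and below the product, so
    it codes the product in [ring_object A]. *)
Lemma ring_incl_app (Z : asm cc) (x y : Z ~> ring_object A) (v : Z ~> nabla cc A) :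
  app (A := map_opas (nabla cc) A) (ring_incl cc ∘ x) (ring_incl cc ∘ y) v ->
  exists z : Z ~> ring_object A, ring_incl cc ∘ z = v.
Proof.
move=> [k [kx ky <-]].
have [V1 [w1 [x1 [y1 [Ww1 xw1 yw1]]]]] := loc_roof2 fr x y.
have [V2 [w2 [k2 [Ww2 kw2]]]] := loc_roof fr (k ∘ fmap L w1).
have : fmap L (incl ∘ x1 ∘ w2) = fmap L (fmap (rel_nabla cc) (lleg (odom A)) ∘ k2).
  by rewrite !fmapM -xw1 -kw2 -!compA -/(ring_incl cc) !compA -kx.
have : fmap L (incl ∘ y1 ∘ w2) = fmap L (fmap (rel_nabla cc) (rleg (odom A)) ∘ k2).
  by rewrite !fmapM -yw1 -kw2 -!compA -/(ring_incl cc) !compA -ky.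
move=> /(loc_map_eq fr) [V3 [w3 [Ww3 e3]]] /(loc_map_eq fr) [V4 [w4 [Ww4 e4]]].
have [V [a [b [ab Wab]]]] := common_refinement fr Ww3 Ww4.
pose w : hom (c := RC) V Z := w1 ∘ (w2 ∘ (w3 ∘ a)).
have Ww : W _ _ w by apply: (fractions_comp fr) => //; apply: (fractions_comp fr).
pose x' : hom (c := RC) V (ring_object A) := x1 ∘ (w2 ∘ (w3 ∘ a)).
pose y' : hom (c := RC) V (ring_object A) := y1 ∘ (w2 ∘ (w3 ∘ a)).
pose k' : robase V ~> tip (odom A) := sval (k2 ∘ (w3 ∘ a)).
have kx' : lleg (odom A) ∘ k' = sval x'.
  have /= := congr1 sval e4; rewrite comp1m /k' /x' /=.
  rewrite (congr1 sval ab : sval w3 ∘ sval a = sval w4 ∘ sval b) => e.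
  by rewrite !compA -e.
have ky' : rleg (odom A) ∘ k' = sval y'.
  have /= := congr1 sval e3; rewrite comp1m /k' /y' /= => e.
  by rewrite !compA -e.
have k'E : k' = sval (k2 ∘ (w3 ∘ a)) by [].
clearbody k' x' y'.
have [U [pU UP]] := svalP x'; have [U' [pU' UP']] := svalP y'.
have tr : V ⊢[oapp A ∘ k'] ring_object A.
  apply: (tracked_term cc (Us := [:: U; U'])
    (t := CApp (CApp (CVar 0) (CVar 2)) (CApp (CVar 1) (CVar 2)))) => //.
  move=> T us c z /all_mem2 [u [u' [-> uU uU']]] cz.
  have [b1 ub bx] := UP _ _ _ _ uU cz; have [b2 ub' by_] := UP' _ _ _ _ uU' cz.
  have xyk : app (sval x' ∘ z) (sval y' ∘ z) (oapp A ∘ k' ∘ z).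
    by exists (k' ∘ z); rewrite !compA kx' ky'.
  have [d bd dk] := oapp_le OA bx by_ xyk; exists d => //.
  by exists b1, b2; split=> //; [exists u, c|exists u', c].
have [z zw] := loc_fill (rel_mor cc tr) Ww; exists z.
apply: (loc_iso_cancel Ww); rewrite -compA zw.
rewrite /w !(fmapM L w1) -compA (compA k) !(fmapM L w2) (compA _ (fmap L w2)) kw2.
rewrite -!fmapM; congr (fmap L _); apply: rel_hom_eq.
by rewrite /= comp1m k'E.
Qed.

Lemma ring_incl_up (Z : asm cc) (x : Z ~> ring_object A) (y : Z ~> nabla cc A) :
  le (A := map_opas (nabla cc) A) (ring_incl cc ∘ x) y ->
  exists z : Z ~> ring_object A, ring_incl cc ∘ z = y.
Proof.
move=> [k [kx <-]].
have [V1 [w1 [x1 [k1 [Ww1 xw1 kw1]]]]] := loc_roof2 fr x k.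
have : fmap L (incl ∘ x1) = fmap L (fmap (rel_nabla cc) (lleg (ole A)) ∘ k1).
  by rewrite !fmapM -xw1 -kw1 -/(ring_incl cc) !compA -kx.
move=> /(loc_map_eq fr) [V [w2 [Ww2 e2]]].
have Ww := fractions_comp fr Ww1 Ww2.
pose x' : hom (c := RC) V (ring_object A) := x1 ∘ w2.
pose k' : robase V ~> tip (ole A) := sval (k1 ∘ w2).
have kx' : lleg (ole A) ∘ k' = sval x'.
  have /= := congr1 sval e2; rewrite comp1m /k' /x' /= => e.
  by rewrite !compA -e.
have k'E : k' = sval (k1 ∘ w2) by [].
clearbody k' x'.
have [U [pU UP]] := svalP x'.
have tr : V ⊢[rleg (ole A) ∘ k'] ring_object A.
  apply: (tracked_term cc (Us := [:: U]) (t := CApp (CVar 0) (CVar 1))) => //.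
  move=> T us c z /all_mem1 [u -> uU] cz.
  have [b ub bx] := UP _ _ _ _ uU cz; exists b; first by exists u, c.
  apply: (ole_trans OA) bx _; exists (k' ∘ z).
  by rewrite !compA kx'.
have [z zw] := loc_fill (rel_mor cc tr) Ww; exists z.
apply: (loc_iso_cancel Ww); rewrite -compA zw.
rewrite (fmapM L w1) -compA (compA k) kw1 -!fmapM; congr (fmap L _); apply: rel_hom_eq.
by rewrite /= comp1m k'E.
Qed.

(** An element of [U] codes itself in the restriction of [ring_object A] to [U], so the constant
    term makes this restriction cover the terminal object. It maps into [P], which is therefore
    inhabited too. *)
Lemma ring_inhabited (U : sub A) (P : asm cc) (p : P ~> ring_object A)
    (q : P ~> nabla cc (sub_dom U)) : phi U ->
  is_pullback (ring_incl cc) (fmap (nabla cc) (sub_arr U)) p q -> inhabited_object P.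
Proof.
move=> pU pb T t tT.
pose f1 := rel_restrict (P := ring_object A : RC) (sub_arr U).
pose f2 : hom (c := RC) _ _ :=
  nabla_hom cc (P := pull (Q := ring_object A) (sub_arr U)) (idm (sub_dom U)).
have f12 : ring_incl cc ∘ fmap L f1 = fmap (nabla cc) (sub_arr U) ∘ fmap L f2.
  rewrite /ring_incl /nabla [fmap (comp_functor _ _) _]/(fmap L _) -!fmapM.
  by congr (fmap L _); apply: rel_hom_eq; rewrite /= comp1m compm1.
have [h _] := pullback_pair pb f12.
have [I tI] := has_terminal lim.
have [s _] := tI (sub_dom U).
pose s' : hom (c := RC) _ _ := nabla_hom cc (P := pull (Q := ring_object A) (sub_arr U)) s.
have cs : cov phi (sval s').
  apply: (tracked_term cc (Us := [:: U]) (t := CVar 0)) => //.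
  move=> Z us a x /all_mem1 [u -> uU] _; exists u => //.
  rewrite comp1m; have [k ku] := uU.
  have -> : x = s ∘ k by apply: terminal_unique.
  apply: push_intro; apply/pull_mem; rewrite ku; exact: (ole_refl OA).
have tI' := loc_terminal fr (rel_terminal tI : is_terminal (C := RC) _).
have [i _] := tI' T; have [j _] := tT (L (nabla_object A I)).
have jI : is_iso j by exists i; split; apply: terminal_unique.
apply: (@regular_epi_of_comp _ (asm_regular cc) _ _ _ t h).
have -> : t ∘ h = j ∘ fmap L s' by apply: terminal_unique.
exact: regular_epi_comp_isol (loc_cov_regular_epi cs) jI.
Qed.

Lemma asm_model_regular : is_regular_model phi (asm_model cc).
Proof.
split.
- exact: asm_regular.
- exact: nabla_regular.
- split; [exact: ring_incl_mono|exact: ring_incl_app|exact: ring_incl_up].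
- by move=> U pU P p q; apply: ring_inhabited.
Qed.

End AssemblyModel.

Lemma same_sub_iso (C : category) (X : C) (S T : sub X) :
  (forall Z (z : Z ~> X), z ∈ S <-> z ∈ T) ->
  exists2 i : sub_dom S ~> sub_dom T, is_iso i & sub_arr T ∘ i = sub_arr S.
Proof.
move=> ST; have [i iE] : sub_arr S ∈ T by apply/ST; exists (idm _); rewrite compm1.
have [j jE] : sub_arr T ∈ S by apply/ST; exists (idm _); rewrite compm1.
exists i => //; exists j; split.
  by apply: (sub_mono (s := S)); rewrite compA jE iE compm1.
by apply: (sub_mono (s := T)); rewrite compA iE jE compm1.
Qed.

(** * The functor induced by a regular model *)

Section InducedFunctor.
Variables (H : heyting_category) (A : opas H) (phi : external_filter A).
Variable cc : combinatory_complete phi.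
Variables (N : category) (regN : is_regular N) (F : functor H N) (regF : regular_functor F).
Variables (C : N) (c : C ~> F A).
Hypothesis filt : @is_filter N (map_opas F A) C c.
Hypothesis inh : forall U, phi U ->
  forall (P : N) (p : P ~> C) (q : P ~> F (sub_dom U)),
    is_pullback c (fmap F (sub_arr U)) p q -> inhabited_object P.
Let reg := heyting_regular (hcatP H).
Let lim := regular_finlim reg.
Let OA := opasP A.
Let limF := regular_functor_finlim regF.
Local Notation RC := (rel_category cc).
Local Notation W := (supine_mono cc).
Local Notation L := (loc_functor W).
Local Notation "P ⊢[ f ] Q" := (tracked phi (P := P) (Q := Q) f)
  (at level 70, f at level 200, no associativity).

(** Pulling back the regular epimorphism to the terminal object along [Z] gives local elements of
    [C] that lie in [F U]. *)
Lemma filter_inhabited (U : sub A) (Z : N) : phi U ->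
  exists (Z' : N) (e : Z' ~> Z) (u : Z' ~> C) k,
    regular_epi e /\ c ∘ u = fmap F (sub_arr U) ∘ k.
Proof.
move=> pU; have limN := regular_finlim regN.
have [P [p [q pb]]] := pullback_exists limN c (fmap F (sub_arr U)).
have [T tT] := has_terminal limN; have [t _] := tT P; have [z _] := tT Z.
have [Z' [e [x [re _]]]] := regular_epi_lift regN z (inh pU pb t tT).
by exists Z', e, (p ∘ x), (q ∘ x); rewrite !compA (proj1 pb).
Qed.

Lemma realized_sub_exists (P : rel_object A) : exists S : sub (F (robase P)),
  forall Z (z : Z ~> F (robase P)), z ∈ S <->
    exists (Z' : N) (e : Z' ~> Z) (a : Z' ~> C) k, [/\ regular_epi e,
      fmap F (lleg (rorel P)) ∘ k = c ∘ a & fmap F (rleg (rorel P)) ∘ k = z ∘ e].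
Proof.
have [T [t1 [t2 pb]]] := pullback_exists (regular_finlim regN) (fmap F (lleg (rorel P))) c.
have [S [q [rq qE]]] := image_exists regN (fmap F (rleg (rorel P)) ∘ t1).
exists S => Z z; rewrite (image_mem regN rq qE); split.
  move=> [Z' [e [x [re xz]]]]; exists Z', e, (t2 ∘ x), (t1 ∘ x).
  by rewrite !compA (proj1 pb).
move=> [Z' [e [a [k [re ka kz]]]]]; have [x [x1 x2]] := pullback_pair pb ka.
by exists Z', e, x; rewrite -compA x1.
Qed.

Definition realized_sub (P : rel_object A) : sub (F (robase P)) :=
  sval (cid (realized_sub_exists P)).

Lemma realized_mem (P : rel_object A) (Z : N) (z : Z ~> F (robase P)) :
  z ∈ realized_sub P <->
    exists (Z' : N) (e : Z' ~> Z) (a : Z' ~> C) k, [/\ regular_epi e,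
      fmap F (lleg (rorel P)) ∘ k = c ∘ a & fmap F (rleg (rorel P)) ∘ k = z ∘ e].
Proof. by rewrite /realized_sub; case: cid => S /= SP; apply: SP. Qed.

(** Transfers closure of [C] under application to stages of [N] lying over some [F E], where the
    application was computed in [H]. *)
Lemma filter_app_image (E : H) (x y v : E ~> A) (Z : N) (h : Z ~> F E) (a b : Z ~> C) :
  app x y v -> fmap F x ∘ h = c ∘ a -> fmap F y ∘ h = c ∘ b ->
  exists d, fmap F v ∘ h = c ∘ d.
Proof.
move=> [k [kx ky kv]] xa yb.
have [|d dE] := filter_app filt (x := a) (y := b) (v := fmap F v ∘ h).
  exists (fmap F k ∘ h) => /=; rewrite !compA -!fmapM kx ky kv.
  by split.
by exists d.
Qed.

(** Tracking concerns stages of [H] only. It is used once, at the generic pair of an element of [U]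
    and a coded point, and carried along [F], which preserves the product that classifies such
    pairs. *)
Lemma realized_tracked (P Q : rel_object A) (f : robase P ~> robase Q) (Z : N)
    (z : Z ~> F (robase P)) :
  P ⊢[f] Q -> z ∈ realized_sub P -> fmap F f ∘ z ∈ realized_sub Q.
Proof.
move=> [U [pU UP]] /realized_mem [Z1 [e1 [a [k [re1 ka kz]]]]]; apply/realized_mem.
have [E [u [t prod]]] := has_products lim (sub_dom U) (tip (rorel P)).
have uU : sub_arr U ∘ u ∈ U by exists u.
have tP : ⟨lleg (rorel P) ∘ t, rleg (rorel P) ∘ t⟩ ∈ rorel P by exists t.
have [b ub [l [lb lx]]] := UP _ _ _ _ uU tP.
have [Z2 [e2 [u' [k' [re2 uk]]]]] := filter_inhabited Z1 pU.
have [h [hu ht]] := product_pair k' (k ∘ e2) (preserves_product limF prod).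
have [||d dE] := filter_app_image (h := h) (a := u') (b := a ∘ e2) ub.
- by rewrite fmapM -compA hu.
- by rewrite fmapM -compA ht compA ka -compA.
exists Z2, (e1 ∘ e2), d, (fmap F l ∘ h); split.
- exact: (regular_epi_comp regN).
- by rewrite compA -fmapM lb.
- by rewrite compA -fmapM lx !fmapM -!compA ht !(compA _ k) kz -!compA.
Qed.

(** The chosen span is known through its members only; these suffice to recognize it as a pullback
    in [H], which [F] preserves. *)
Lemma realized_pull (X : H) (Q : rel_object A) (f : X ~> robase Q) (Z : N)
    (z : Z ~> F X) :
  fmap F f ∘ z ∈ realized_sub Q -> z ∈ realized_sub (pull f).
Proof.
move=> /realized_mem [Z' [e [a [k [re ka kz]]]]]; apply/realized_mem.
have /pull_mem [t [tl tr]] : ⟨lleg (rorel (pull f)), rleg (rorel (pull f))⟩ ∈ rorel (pull f).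
  by exists (idm _); rewrite !compm1.
have pb : is_pullback (rleg (rorel Q)) f t (rleg (rorel (pull f))).
  apply: pullbackP => // [T s x sx|T s s' /= ts xs].
    have /pull_mem [l [ll lx]] : ⟨lleg (rorel Q) ∘ s, f ∘ x⟩ ∈ rorel Q by exists s.
    exists l; split=> //; apply: (@rorel_jointly_monic _ _ Q).
      by rewrite compA tl.
    by rewrite compA tr -compA lx.
  by apply: (@rorel_jointly_monic _ _ (pull f)); rewrite // -tl -!compA ts.
have [h [ht hx]] := pullback_pair (preserves_pullback lim limF pb) (etrans kz (esym (compA _ _ _))).
by exists Z', e, a, h; rewrite -tl fmapM -compA ht.
Qed.

(** The direct image is a quotient of the span of [P], and [F] keeps the quotient map a regular
    epimorphism. *)
Lemma realized_push (P : rel_object A) (Y : H) (f : robase P ~> Y) (Z : N) (y : Z ~> F Y) :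
  y ∈ realized_sub (push f) ->
  exists (Z' : N) (e : Z' ~> Z) x, [/\ regular_epi e, x ∈ realized_sub P &
    fmap F f ∘ x = y ∘ e].
Proof.
move=> /realized_mem [Z1 [e1 [a [k [re1 ka kz]]]]].
have [q [_ rq ql qr]] := push_spanP f.
have [Z2 [e2 [t [re2 qt]]]] := regular_epi_lift regN k (regular_functor_epi regF rq).
exists Z2, (e1 ∘ e2), (fmap F (rleg (rorel P)) ∘ t); split.
- exact: (regular_epi_comp regN).
- apply/realized_mem; exists Z2, (idm Z2), (a ∘ e2), t; rewrite compm1; split=> //.
    exact: regular_epi_id.
  by rewrite -ql fmapM -compA qt !compA ka.
- by rewrite compA -fmapM -qr fmapM -compA qt !compA kz.
Qed.

Lemma realized_nabla (X : H) (Z : N) (z : Z ~> F X) : z ∈ realized_sub (nabla_object A X).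
Proof.
(* Only a local element of [C] is wanted here; [pair_codes] is a convenient member of [phi]. *)
have [Z' [e [u [k [re uk]]]]] := filter_inhabited Z (phi_pair_codes cc).
have [h [hl hr]] := product_pair (c ∘ u) (z ∘ e) (preserves_product limF (@full_spanP H A X)).
by apply/realized_mem; exists Z', e, u, h.
Qed.

(** As for [realized_tracked], the pair is formed in [H] for a generic [r] and generic codes over a
    common point, then carried along [F]; two uses of the closure of [C] keep the result in [C]. *)
Lemma realized_meet (X : H) (P Q : rel_object A) (p : X ~> robase P) (q : X ~> robase Q)
    (Z : N) (z : Z ~> F X) :
  fmap F p ∘ z ∈ realized_sub P -> fmap F q ∘ z ∈ realized_sub Q ->
  z ∈ realized_sub (meet cc p q).
Proof.
move=> /realized_pull /realized_mem [Z1 [e1 [a [k [re1 ka kz]]]]].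
move=> /realized_pull zq; apply: (mem_descent re1); move/(mem_comp e1): zq.
move=> /realized_mem [Z2 [e2 [b [l [re2 lb lz]]]]]; apply: (mem_descent re2).
have [Z3 [e3 [r [m [re3 rm]]]]] := filter_inhabited Z2 (phi_pair_codes cc).
apply/realized_mem; exists Z3, e3.
have [E1 [s [t pb]]] := pullback_exists lim (rleg (rorel (pull p))) (rleg (rorel (pull q))).
have [E [rE [st prod]]] := has_products lim (sub_dom (pair_codes cc)) E1.
have rR : sub_arr (pair_codes cc) ∘ rE ∈ pair_codes cc by exists rE.
have [w [v [rw wv]]] := pair_app (lleg (rorel (pull p)) ∘ (s ∘ st))
  (lleg (rorel (pull q)) ∘ (t ∘ st)) rR.
have [n [nv nx]] : ⟨v, rleg (rorel (pull p)) ∘ (s ∘ st)⟩ ∈ rorel (meet cc p q).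
  apply: meet_mem rR _ _ rw wv; apply/pull_mem; first by exists (s ∘ st).
  by exists (t ∘ st); split=> //; rewrite !compA (proj1 pb).
have [|h1 [hs ht]] := @pullback_pair _ _ _ _ _ _ _ _ _ _ (k ∘ e2) l
    (preserves_pullback lim limF pb); first by rewrite compA kz lz.
have [h [hr hst]] := product_pair m (h1 ∘ e3) (preserves_product limF prod).
have [||d dE] := filter_app_image (h := h) (a := r) (b := a ∘ e2 ∘ e3) rw.
- by rewrite fmapM -compA hr.
- by rewrite !fmapM -!compA hst (compA (fmap F s)) hs !compA ka.
have [||g gE] := filter_app_image (h := h) (a := d) (b := b ∘ e3) wv => //.
- by rewrite !fmapM -!compA hst (compA (fmap F t)) ht !compA lb.
exists g, (fmap F n ∘ h); split=> //.
- by rewrite compA -fmapM nv.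
- by rewrite compA -fmapM nx !fmapM -!compA hst (compA (fmap F s)) hs !compA kz.
Qed.

Lemma realized_map_exists (P Q : RC) (f : P ~> Q) :
  fmap F (sval f) ∘ sub_arr (realized_sub P) ∈ realized_sub Q.
Proof.
apply: realized_tracked; first exact: (svalP f).
by exists (idm _); rewrite compm1.
Qed.

Definition realized_map (P Q : RC) (f : P ~> Q) :
    sub_dom (realized_sub P) ~> sub_dom (realized_sub Q) :=
  sval (cid (realized_map_exists f)).

Lemma realized_mapE (P Q : RC) (f : P ~> Q) :
  sub_arr (realized_sub Q) ∘ realized_map f = fmap F (sval f) ∘ sub_arr (realized_sub P).
Proof. exact: svalP (cid (realized_map_exists f)). Qed.

Lemma realized_map1 (P : RC) : realized_map (idm P) = idm (sub_dom (realized_sub P)).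
Proof.
by apply: (sub_mono (s := realized_sub P)); rewrite realized_mapE fmap1 comp1m compm1.
Qed.

Lemma realized_mapM (P Q T : RC) (g : Q ~> T) (f : P ~> Q) :
  realized_map (g ∘ f) = realized_map g ∘ realized_map f.
Proof.
apply: (sub_mono (s := realized_sub T)).
by rewrite realized_mapE compA realized_mapE -compA realized_mapE fmapM compA.
Qed.

Definition realized_functor : functor RC N :=
  @Functor RC N (fun P => sub_dom (realized_sub P)) realized_map realized_map1 realized_mapM.
Local Notation Phi := realized_functor.

Lemma realized_finite_limits : preserves_finite_limits Phi.
Proof.
apply: preserves_chosen_limits.
- have [T tT] := has_terminal lim; exists (nabla_object A T); first exact: rel_terminal.
  move=> Z; have [z _] := preserves_terminal limF tT Z.
  have [k _] := realized_nabla z; exists k; split=> // k' _.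
  apply: (sub_mono (s := realized_sub (nabla_object A T))).
  exact: (terminal_unique _ _ (preserves_terminal limF tT)).
- move=> P Q; have [X [p [q pq]]] := has_products lim (robase P) (robase Q).
  exists (meet cc p q); do 2!eexists; split; first exact: rel_product pq.
  have Fpq := preserves_product limF pq; apply: productP => [Z f g|Z f g e1 e2].
    have [h [hf hg]] := product_pair (sub_arr (realized_sub P) ∘ f)
      (sub_arr (realized_sub Q) ∘ g) Fpq.
    have [||k kh] := @realized_meet _ P Q p q _ h; rewrite ?hf ?hg; try by eexists.
    exists k; split.
      by apply: (sub_mono (s := realized_sub P)); rewrite compA realized_mapE -compA kh.
    by apply: (sub_mono (s := realized_sub Q)); rewrite compA realized_mapE -compA kh.
  apply: (sub_mono (s := realized_sub (meet cc p q))).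
  apply: (product_jointly_monic Fpq).
    have := congr1 (comp (sub_arr (realized_sub P))) e1.
    by rewrite !compA !realized_mapE.
  have := congr1 (comp (sub_arr (realized_sub Q))) e2.
  by rewrite !compA !realized_mapE.
- move=> P Q f g; have [X [e eq]] := has_equalizers lim (sval f) (sval g).
  exists (pull e), (rel_restrict e); split; first exact: rel_equalizer.
  have Feq := preserves_equalizer limF eq; apply: equalizerP.
  + by rewrite -!fmapM; congr (fmap Phi _); apply: rel_hom_eq; exact: (proj1 eq).
  + apply: (mono_of_comp (g := sub_arr (realized_sub P))); rewrite realized_mapE.
    apply: mono_comp (sub_mono (s := _)); exact: equalizer_mono Feq.
  + move=> Z z zfg.
    have [|h hz] := @equalizer_fact _ _ _ _ _ _ _ _ (sub_arr (realized_sub P) ∘ z) Feq.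
      by rewrite !compA -!realized_mapE -!compA [realized_map f ∘ z]zfg.
    have [|k kh] := @realized_pull _ P e _ h; first by rewrite hz; eexists.
    exists k; apply: (sub_mono (s := realized_sub P)).
    by rewrite compA realized_mapE -compA kh.
Qed.

(** Tracking of the identity into the direct image puts the generic realized point of [Q] in the
    realized direct image, so it lifts to [P] on a cover. *)
Lemma realized_cov (P Q : RC) (s : P ~> Q) : cov phi (sval s) -> regular_epi (fmap Phi s).
Proof.
move=> cs; have : fmap F (idm (robase Q)) ∘ sub_arr (realized_sub Q) ∈ realized_sub (push (sval s)).
  by apply: realized_tracked cs _; exists (idm _); rewrite compm1.
rewrite fmap1 comp1m => /realized_push [Z [e [x [re [k kx] sx]]]].
apply: (regular_epi_of_comp regN (g := k)).
suff -> : fmap Phi s ∘ k = e by [].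
apply: (sub_mono (s := realized_sub Q)).
by rewrite compA realized_mapE -compA kx.
Qed.

Lemma realized_inv (P Q : RC) (w : P ~> Q) : W _ _ w -> is_iso (fmap Phi w).
Proof.
move=> /supine_monoP [mw cw]; apply: mono_regular_epi_iso; last exact: realized_cov.
apply: (mono_of_comp (g := sub_arr (realized_sub Q))); rewrite realized_mapE.
by apply: mono_comp (sub_mono (s := _)); apply: (preserves_mono lim limF).
Qed.

Definition induced_functor : functor (asm cc) N := loc_lift realized_inv.

Lemma induced_regular : regular_functor induced_functor.
Proof.
split.
  apply: (loc_lift_preserves_finite_limits (supine_mono_fractions cc)).
    exact: rel_has_finite_limits.
  exact: realized_finite_limits.
move=> P Q f /asm_regular_epi [P' [I [w [s [i [Ww cs iI fw]]]]]].
have [v [wv vw]] := loc_iso Ww.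
have -> : f = i ∘ fmap L s ∘ v by rewrite -fw -compA vw compm1.
rewrite !fmapM; apply: regular_epi_comp_isor.
  apply: regular_epi_comp_isol (fmap_iso _ iI).
  by rewrite loc_liftE; apply: realized_cov.
by apply: fmap_iso; apply: iso_inv wv vw.
Qed.

Lemma induced_natural (X Y : H) (f : X ~> Y) :
  sub_arr (realized_sub (nabla_object A Y)) ∘ fmap (comp_functor induced_functor (nabla cc)) f =
  fmap F f ∘ sub_arr (realized_sub (nabla_object A X)).
Proof.
have -> : fmap (comp_functor induced_functor (nabla cc)) f = realized_map (fmap (rel_nabla cc) f).
  exact: loc_liftE.
exact: realized_mapE.
Qed.

Lemma induced_iso (X : H) : is_iso (sub_arr (realized_sub (nabla_object A X))).
Proof.
have [k kE] := realized_nabla (idm (F X)).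
exact: mono_split_iso (sub_mono (s := _)) kE.
Qed.

Definition induced_nat_iso : nat_iso (comp_functor induced_functor (nabla cc)) F :=
  @NatIso H N (comp_functor induced_functor (nabla cc)) F
    (fun X => sub_arr (realized_sub (nabla_object A X))) induced_natural induced_iso.

(** Being above some element of [C] is the same as being in [C]: upward closure one way, reflexivity
    the other. *)
Lemma realized_ring (Z : N) (z : Z ~> F A) :
  z ∈ realized_sub (ring_object A) <-> z ∈ Sub (filter_mono filt).
Proof.
rewrite (realized_mem (P := ring_object A)); split=> [[Z' [e [a [k [re ka kz]]]]]|[a /= <-]].
  apply: (mem_descent re).
  have [|d dE] := filter_up filt (x := a) (y := z ∘ e); first by exists k.
  by exists d.
have [k [kl kr]] := ole_refl OA (idm (A : H)).
exists Z, (idm Z), a, (fmap F k ∘ (c ∘ a)); rewrite !compA -!fmapM kl kr fmap1.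
by rewrite !comp1m compm1; split=> //; apply: regular_epi_id.
Qed.

Lemma induced_filter : exists i : induced_functor (ring_object A) ~> C,
  is_iso i /\ c ∘ i = induced_nat_iso A ∘ fmap induced_functor (ring_incl cc).
Proof.
have [i iI iE] := same_sub_iso realized_ring.
exists i; split=> //; rewrite loc_liftE.
by rewrite [RHS]realized_mapE /= fmap1 comp1m.
Qed.

End InducedFunctor.

(** * Uniqueness *)

Section GenericCover.
Variables (H : heyting_category) (A : opas H) (phi : external_filter A).
Variable cc : combinatory_complete phi.
Let OA := opasP A.
Local Notation RC := (rel_category cc).
Local Notation "P ⊢[ f ] Q" := (tracked phi (P := P) (Q := Q) f)
  (at level 70, f at level 200, no associativity).

(** The unit of the adjunction between the realizability fibration and [rel_nabla]. *)
Definition base_incl (P : RC) : hom (c := RC) P (rel_nabla cc (robase P)) :=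
  nabla_hom cc (idm (robase P)).

Lemma base_incl_mono (P : RC) : mono (base_incl P).
Proof. by apply/rel_monoP; apply: mono_id. Qed.

(** [{(a, (b, x)) | a ≤ b, (b, x) ∈ Y}], the intersection of [Å] and [∇Y]. *)
Definition generic_cover (P : RC) : RC := pull (Q := ring_object A) (lleg (rorel P)).

Definition generic_code (P : RC) : hom (c := RC) (generic_cover P) (ring_object A) :=
  rel_restrict (P := ring_object A : RC) (lleg (rorel P)).

Lemma generic_tracked (P : RC) : generic_cover P ⊢[rleg (rorel P)] P.
Proof.
apply: (tracked_sub cc) => Z a t /pull_mem ax.
by apply: rorel_down ax _; exists t.
Qed.

Definition generic_proj (P : RC) : hom (c := RC) (generic_cover P) P :=
  rel_mor cc (generic_tracked P).

(** A code [a] of [x] also codes the point [(a, x)] of the generic cover, since [a ≤ a]. *)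
Lemma generic_proj_cov (P : RC) : cov phi (sval (generic_proj P)).
Proof.
apply: (tracked_sub cc) => Z a x [t [ta tx]]; rewrite comp1m -tx; apply: push_intro.
by apply/pull_mem; rewrite ta; exact: (ole_refl OA).
Qed.

Lemma generic_pullback (P : RC) :
  is_pullback (base_incl (ring_object A)) (fmap (rel_nabla cc) (lleg (rorel P)))
    (generic_code P) (base_incl (generic_cover P)).
Proof.
apply: pullbackP => [|Z x y xy|Z f g _ /(congr1 sval) /=].
- by apply: rel_hom_eq; rewrite /= comp1m compm1.
- have /= := congr1 sval xy; rewrite comp1m => sxy.
  have Zy : Z ⊢[sval y] generic_cover P.
    by apply/tracked_pull; rewrite -sxy; apply: (svalP x).
  by exists (rel_mor cc Zy); split; apply: rel_hom_eq; rewrite /= ?comp1m.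
- by rewrite !comp1m => fg; apply: rel_hom_eq.
Qed.

Lemma generic_projE (P : RC) :
  base_incl P ∘ generic_proj P = fmap (rel_nabla cc) (rleg (rorel P)) ∘ base_incl (generic_cover P).
Proof. by apply: rel_hom_eq; rewrite /= comp1m compm1. Qed.

End GenericCover.

Section Uniqueness.
Variables (H : heyting_category) (A : opas H) (phi : external_filter A).
Variable cc : combinatory_complete phi.
Variables (N : category) (regN : is_regular N) (F : functor H N) (regF : regular_functor F).
Variables (C : N) (c : C ~> F A).
Hypothesis filt : @is_filter N (map_opas F A) C c.
Hypothesis inh : forall U, phi U ->
  forall (P : N) (p : P ~> C) (q : P ~> F (sub_dom U)),
    is_pullback c (fmap F (sub_arr U)) p q -> inhabited_object P.
Variables (K : functor (asm cc) N) (regK : regular_functor K).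
Variable k : nat_iso (comp_functor K (nabla cc)) F.
Variables (i : K (ring_object A) ~> C) (iI : is_iso i).
Hypothesis ci : c ∘ i = k A ∘ fmap K (ring_incl cc).
Local Notation RC := (rel_category cc).
Local Notation L := (loc_functor (supine_mono cc)).
Local Notation realized := (realized_sub regN c).
Let limK := regular_functor_finlim regK.
Let fr := supine_mono_fractions cc.
Let limA := localization_has_finite_limits fr (rel_has_finite_limits cc).

(** Embeds [K P] in [F (robase P)], where it can be compared with [realized P] as a subobject. *)
Definition cell_incl (P : RC) : K P ~> F (robase P) :=
  k (robase P) ∘ fmap K (fmap L (base_incl P)).

Lemma k_natural (X Y : H) (f : X ~> Y) :
  k Y ∘ fmap K (fmap L (fmap (rel_nabla cc) f)) = fmap F f ∘ k X.
Proof. exact: (ncomp_natural k). Qed.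

Lemma cell_incl_mono (P : RC) : mono (cell_incl P).
Proof.
apply: mono_comp; first exact: iso_mono (ncomp_iso k _).
apply: (preserves_mono limA limK); apply: (loc_mono fr).
exact: base_incl_mono.
Qed.

Lemma k_generic (P : RC) :
  fmap F (rleg (rorel P)) ∘ (k (tip (rorel P)) ∘ fmap K (fmap L (base_incl (generic_cover P)))) =
  cell_incl P ∘ fmap K (fmap L (generic_proj P)).
Proof.
by rewrite /cell_incl compA -k_natural -!compA -!fmapM -generic_projE.
Qed.

Lemma k_code (P : RC) :
  fmap F (lleg (rorel P)) ∘ (k (tip (rorel P)) ∘ fmap K (fmap L (base_incl (generic_cover P)))) =
  c ∘ (i ∘ fmap K (fmap L (generic_code P))).
Proof.
rewrite compA -k_natural -compA -!fmapM -(proj1 (generic_pullback P)) !fmapM.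
by rewrite !compA ci.
Qed.

(** [K] preserves the pullback [generic_pullback] and the regular epimorphism given by
    [generic_proj]. Hence [K P] is the image of the part of [F] of the relation whose codes lie in
    [C], as [realized P] is. *)
Lemma realized_cell (P : RC) (Z : N) (z : Z ~> F (robase P)) :
  z ∈ realized P <-> z ∈ Sub (@cell_incl_mono P).
Proof.
rewrite realized_mem; split.
  move=> [Z' [e [a [t [re ta tz]]]]]; apply: (mem_descent re).
  have [i' [_ ii]] := iI; have [k' [_ kk]] := ncomp_iso k (tip (rorel P)).
  have pb := preserves_pullback limA limK
    (preserves_pullback (rel_has_finite_limits cc) (loc_preserves_finite_limits fr)
      (generic_pullback P)).
  have eq : fmap K (fmap L (base_incl (ring_object A : RC))) ∘ (i' ∘ a) =
      fmap K (fmap L (fmap (rel_nabla cc) (lleg (rorel P)))) ∘ (k' ∘ t).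
    apply: (iso_mono (ncomp_iso k A)).
    rewrite !compA k_natural -[_ ∘ fmap K (fmap L (base_incl _))]ci.
    by rewrite -!compA (compA i) ii (compA (k _)) kk !comp1m ta.
  have [h [_ hk]] := pullback_pair pb eq.
  exists (fmap K (fmap L (generic_proj P)) ∘ h).
  by rewrite compA /= -k_generic -!compA hk (compA (k _)) kk comp1m.
move=> [y /= <-].
have [Z' [e [t [re ty]]]] := regular_epi_lift regN y
  (regular_functor_epi regK (loc_cov_regular_epi (generic_proj_cov P))).
exists Z', e, (i ∘ fmap K (fmap L (generic_code P)) ∘ t).
exists (k (tip (rorel P)) ∘ fmap K (fmap L (base_incl (generic_cover P))) ∘ t); split=> //.
  by rewrite !(compA _ _ t) k_code.
by rewrite (compA _ _ t) k_generic -!compA ty.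
Qed.

Lemma comparison_exists (P : RC) : exists j : sub_dom (realized P) ~> K P,
  is_iso j /\ cell_incl P ∘ j = sub_arr (realized P).
Proof. by have [j jI jE] := same_sub_iso (@realized_cell P); exists j. Qed.

Definition comparison_map (P : RC) : sub_dom (realized P) ~> K P :=
  sval (cid (comparison_exists P)).

Lemma comparison_mapP (P : RC) :
  is_iso (comparison_map P) /\ cell_incl P ∘ comparison_map P = sub_arr (realized P).
Proof. exact: svalP (cid (comparison_exists P)). Qed.

Local Notation M := (induced_functor cc regN regF filt inh).

(** By [localization_unique] only arrows of the form [L f] matter. For these both sides agree after
    the monomorphism [cell_incl Q]. *)
Lemma comparison_natural (P Q : asm cc) (f : P ~> Q) :
  comparison_map Q ∘ fmap M f = fmap K f ∘ comparison_map P.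
Proof.
move: P Q f; apply: (@localization_unique _ _ _ M K comparison_map) => P Q f.
rewrite loc_liftE; apply: (@cell_incl_mono Q).
rewrite compA (proj2 (comparison_mapP Q)) [LHS]realized_mapE -(proj2 (comparison_mapP P)).
rewrite (compA _ (cell_incl P)) (compA (cell_incl Q)); congr (_ ∘ _).
rewrite /cell_incl compA -k_natural -!compA -!fmapM.
have <- : fmap (rel_nabla cc) (sval f) ∘ base_incl P = base_incl Q ∘ f.
  by apply: rel_hom_eq; rewrite /= comp1m compm1.
by rewrite (fmapM L).
Qed.

Definition comparison : nat_iso M K :=
  @NatIso (asm cc) N M K comparison_map comparison_natural (fun P => proj1 (comparison_mapP P)).

Lemma comparisonE (X : H) :
  k X ∘ comparison (nabla cc X) = induced_nat_iso cc regN regF filt inh X.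
Proof.
rewrite /= -(proj2 (comparison_mapP (nabla_object A X : RC))) /cell_incl.
have -> : base_incl (nabla_object A X : RC) = idm _ by apply: rel_hom_eq.
by rewrite !fmap1 compm1.
Qed.

End Uniqueness.

Theorem corollary2p3p14 (H : heyting_category) (A : opas H) (phi : external_filter A)
    (cc : combinatory_complete phi) :
  pseudoinitial_regular_model phi (asm_model cc).
Proof.
split; first exact: asm_model_regular.
move=> [N F C c] [/= regN regF filt inh].
pose f := @ModelMorphism H A (asm_model cc) (ModelData c) _
  (induced_regular cc regN regF filt inh) (induced_nat_iso cc regN regF filt inh)
  (induced_filter cc regN regF filt inh).
exists f => -[K regK k [i [iI ci]]]; set g := (X in model_2morphism _ X).
exact (inhabits (@Model2Morphism H A _ _ f g (comparison regN regF filt inh regK iI ci)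
  (comparisonE regN regF filt inh regK iI ci))).
Qed.
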